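(* Given any $d\geq2$, $C_0\geq1$ and parameters $0<\tau_1\leq\tau_2<1$, there exist constants $\varepsilon_0\in(0,1)$ and $J_0\in\mathbb N$, depending on these quantities, with the following property. For $s\in(d-\varepsilon_0,d)$, let $E\subseteq[0,1]^d$ be any quasi-regular Borel set (with respect to dimension $s$), equipped with a locally uniformly $s$-dimensional probability measure $\mu$ supported on $E$ for which $$C_0^{-1}T^{d-s}\leq\mathbb F_\mu(T)\leq C_0T^{d-s}\quad\text{for all }T\geq1$$ with the specified constant $C_0$. Then $\Delta(E)$ intersects every $J_0$-long sequence that is $(\tau_1,\tau_2)$-lacunary. Specifically, any sequence $\{t_j:1\leq j\leq J_0\}\subseteq(0,1]$ with $\tau_1\leq t_{j+1}/t_j\leq\tau_2$ for all $j$ must satisfy $$\#\big[\Delta(E)\cap\{t_1,\ldots,t_{J_0}\}\big]\geq1 .$$ In particular, if $\{t_j:j\geq1\}\subseteq(0,1]$ is any infinite sequence that is $(\tau_1,\tau_2)$-lacunary, then every consecutive block $\{k+1,\ldots,k+J_0\}$ of $J_0$ integers (with $k\ge0$) contains an index $j$ with $t_j\in\Delta(E)$.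
   Context: $\Delta(E)=\{|x-y|:x,y\in E\}$ is the distance set ($|\cdot|$ Euclidean norm). $\mathbb H^s$ is the $s$-dimensional Hausdorff measure. A (finite or infinite) sequence $\{t_j\}\subseteq(0,1]$ is $(\tau_1,\tau_2)$-lacunary if $\tau_1\leq t_{j+1}/t_j\leq\tau_2$ for all $j$ for which both terms are defined. A probability measure $\mu$ on $[0,1]^d$ is locally uniformly $s$-dimensional if there is a constant $C>0$ such that $\mu(Q)\leq C\,\ell(Q)^s$ for all cubes $Q\subseteq[0,1]^d$, $\ell(Q)$ being the side-length. An $s$-dimensional set $E\subseteq[0,1]^d$ is quasi-regular if there exists $\kappa>0$ such that $\liminf_{r\to0}(2r)^{-s}\,\mathbb H^s(E\cap B(x;r))\geq\kappa$ for $\mathbb H^s$-almost every $x\in E$, where $B(x;r)$ is the ball of radius $r$ centred at $x$. For a probability measure $\mu$, $\widehat\mu(\xi)=\int e^{-ix\cdot\xi}\,d\mu(x)$ and $\mathbb F_\mu(T)=\int_{|\xi|\leq T}|\widehat\mu(\xi)|^2\,d\xi$. *)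

(* Defs.v *)
From HB Require Import structures.
From mathcomp Require Import all_boot all_order all_algebra.
From mathcomp Require Import all_classical all_reals all_analysis.
From mathcomp Require Import complex.

Set Implicit Arguments.
Unset Strict Implicit.
Unset Printing Implicit Defensive.

Import Order.TTheory GRing.Theory Num.Theory.
Import numFieldNormedType.Exports.

Local Open Scope classical_set_scope.
Local Open Scope ring_scope.

(* R^d as a measurable space: [measurableTypeR R] is R with its Borel sets, and
   d-tuples carry the product sigma-algebra, which is the Borel one since R is
   second countable. *)
Notation Rn R d := (d.-tuple (measurableTypeR R)).

Section EuclideanSpace.
Context {R : realType}.

Definition coord d (x : Rn R d) (i : 'I_d) : R := tnth x i.

Definition edot d (x y : Rn R d) : R := \sum_(i < d) coord x i * coord y i.

Definition enorm d (x : Rn R d) : R := Num.sqrt (edot x x).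

Definition edist d (x y : Rn R d) : R :=
  Num.sqrt (\sum_(i < d) (coord x i - coord y i) ^+ 2).

(* The axis-parallel closed cube with lowest corner [a] and side-length [l]. *)
Definition cube d (a : Rn R d) (l : R) : set (Rn R d) :=
  [set x | forall i, coord a i <= coord x i <= coord a i + l].

Definition unit_cube d : set (Rn R d) :=
  [set x | forall i, 0 <= coord x i <= 1].

Definition eball d (x : Rn R d) (r : R) : set (Rn R d) :=
  [set y | edist x y <= r].

Definition distance_set d (E : set (Rn R d)) : set R :=
  [set edist p.1 p.2 | p in E `*` E].

End EuclideanSpace.

Section LebesgueMeasure.
Context {R : realType}.

Definition tuple_cons d (p : measurableTypeR R * Rn R d) : Rn R d.+1 :=
  [tuple of p.1 :: p.2].

Lemma measurable_tuple_cons d : measurable_fun setT (@tuple_cons d).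
Proof. exact: measurable_cons. Qed.

Section Cons.
Context d (m : {sigma_finite_measure set (Rn R d) -> \bar R}).

Definition lebesgue_cons : set (Rn R d.+1) -> \bar R :=
  pushforward (lebesgue_measure \x m)%E (@tuple_cons d).

Let lebesgue_cons0 : lebesgue_cons set0 = 0%E.
Proof. by rewrite /lebesgue_cons /pushforward preimage_set0 measure0. Qed.

Let lebesgue_cons_ge0 A : (0 <= lebesgue_cons A)%E.
Proof. exact: (measure_ge0 (lebesgue_measure \x m)%E). Qed.

Let lebesgue_cons_sigma_additive : semi_sigma_additive lebesgue_cons.
Proof.
move=> F mF tF mUF; rewrite /lebesgue_cons /pushforward preimage_bigcup.
apply: measure_semi_sigma_additive.
- by move=> n; rewrite -[X in measurable X]setTI; exact: measurable_tuple_cons.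
- apply/trivIsetP => /= i j _ _ ij; rewrite -preimage_setI.
  by move/trivIsetP : tF => /(_ _ _ _ _ ij) ->//; rewrite preimage_set0.
- rewrite -preimage_bigcup -[X in measurable X]setTI.
  exact: measurable_tuple_cons.
Qed.

HB.instance Definition _ := isMeasure.Build _ _ _ lebesgue_cons
  lebesgue_cons0 lebesgue_cons_ge0 lebesgue_cons_sigma_additive.

Let uncons (x : Rn R d.+1) : measurableTypeR R * Rn R d :=
  (thead x, [tuple of behead x]).

Let measurable_uncons : measurable_fun setT uncons.
Proof.
apply/measurable_fun_pairP; split => /=; last exact: measurable_behead.
exact: measurable_tnth.
Qed.

Let tuple_consK : cancel (@tuple_cons d) uncons.
Proof. by move=> [x y]; congr pair; apply: val_inj. Qed.

Let lebesgue_cons_sigma_finite : sigma_finite setT lebesgue_cons.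
Proof.
have /sigma_finiteP[F [TF ndF Foo]] :=
  sigma_finiteT (@lebesgue_measure R : {sigma_finite_measure set _ -> \bar R}).
have /sigma_finiteP[G [TG ndG Goo]] := sigma_finiteT m.
have mFG n : measurable (F n `*` G n).
  by apply: measurableX; [have [] := Foo n|have [] := Goo n].
exists (fun n => uncons @^-1` (F n `*` G n)).
  rewrite -preimage_bigcup; apply/esym/seteqP; split => // x _.
  have [i _ Fi] : (\bigcup_n F n) (uncons x).1 by rewrite -TF.
  have [j _ Gj] : (\bigcup_n G n) (uncons x).2 by rewrite -TG.
  exists (maxn i j) => //; split.
    by move: Fi; exact/subsetPset/ndF/leq_maxl.
  by move: Gj; exact/subsetPset/ndG/leq_maxr.
move=> n; split.
  by rewrite -[X in measurable X]setTI; exact: measurable_uncons.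
rewrite /lebesgue_cons /pushforward -comp_preimage.
rewrite (_ : _ \o _ = id); last by apply/funext => p; exact: tuple_consK.
have [mF Fn] := Foo n; have [mG Gn] := Goo n.
by rewrite preimage_id product_measure1E// lte_mul_pinfty// ge0_fin_numE.
Qed.

HB.instance Definition _ := Measure_isSigmaFinite.Build _ _ _ lebesgue_cons
  lebesgue_cons_sigma_finite.

End Cons.

(* Lebesgue measure on R^d, by iterated products: R^0 is a single point, and
   R^(d+1) is identified with R * R^d. *)
Fixpoint lebesgue_measure_Rn d : {sigma_finite_measure set (Rn R d) -> \bar R} :=
  match d with
  | 0 => \d_([tuple])
  | d'.+1 => lebesgue_cons (lebesgue_measure_Rn d')
  end.

Lemma measurable_box d (a b : 'I_d -> R) :
  measurable [set x : Rn R d | forall i, a i <= coord x i <= b i].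
Proof.
rewrite (_ : [set _ | _] = \bigcap_(i in [set: 'I_d])
    ((fun x : Rn R d => tnth x i) @^-1` `[a i, b i]%classic)).
  apply: fin_bigcap_measurable => // i _; rewrite -[X in measurable X]setTI.
  exact: measurable_tnth.
apply/seteqP; split => x /= H i; first by rewrite /= in_itv/= => _; exact: H.
by have := H i I; rewrite /= in_itv.
Qed.

Lemma lebesgue_measure_Rn_box d (a b : 'I_d -> R) : (forall i, a i <= b i) ->
  lebesgue_measure_Rn d [set x | forall i, a i <= coord x i <= b i] =
  (\prod_(i < d) (b i - a i))%:E.
Proof.
elim: d => [|d IH] in a b *; move=> ab.
  rewrite big_ord0 /= /dirac indicE mem_set//=.
  by case.
rewrite big_ord_recl /= /lebesgue_cons /pushforward.
rewrite [X in product_measure1 _ _ X](_ : _ = `[a ord0, b ord0]%classic `*`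
    [set x : Rn R d | forall i, a (lift ord0 i) <= coord x i <= b (lift ord0 i)]).
  rewrite product_measure1E//=; last exact: measurable_box.
  rewrite IH; last by move=> i; exact: ab.
  rewrite lebesgue_measure_itv/= lte_fin EFinM.
  case: ltP => // ba.
  by rewrite (_ : b ord0 = a ord0) ?subrr//; apply/eqP; rewrite eq_le ba ab.
apply/seteqP; split => -[x y] /=.
  move=> H; split; first by have := H ord0; rewrite in_itv.
  by move=> i; have := H (lift ord0 i); rewrite /coord tnthS.
move=> [H1 H2] i; rewrite /coord.
by case: (unliftP ord0 i) => [j ->|->]; rewrite ?tnthS//=; exact: H2.
Qed.

End LebesgueMeasure.

Section HausdorffMeasure.
Context {R : realType} {d : nat}.
Local Open Scope ereal_scope.

Definition diameter (A : set (Rn R d)) : \bar R :=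
  maxe 0 (ereal_sup [set (edist p.1 p.2)%:E | p in A `*` A]).

(* The s-dimensional gauge diam(A)^s, with value 0 at the empty set also when
   s = 0 (so that the 0-dimensional Hausdorff measure counts points). *)
Definition hausdorff_gauge (s : R) (A : set (Rn R d)) : \bar R :=
  if `[< A = set0 >] then 0 else poweR (diameter A) s.

Definition hausdorff_content (s delta : R) (A : set (Rn R d)) : \bar R :=
  ereal_inf [set \sum_(0 <= n <oo) hausdorff_gauge s (U n) |
    U in [set U : (set (Rn R d))^nat |
      A `<=` \bigcup_n U n /\ forall n, diameter (U n) <= delta%:E]].

Definition hausdorff_measure (s : R) (A : set (Rn R d)) : \bar R :=
  ereal_sup [set hausdorff_content s delta A | delta in `]0%R, +oo[].

Definition hausdorff_dim (A : set (Rn R d)) : \bar R :=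
  ereal_inf [set s%:E | s in [set s : R | (0 <= s)%R /\ hausdorff_measure s A = 0]].

Definition quasi_regular (s : R) (E : set (Rn R d)) :=
  hausdorff_dim E = s%:E /\
  exists2 kappa : R, (0 < kappa)%R &
    hausdorff_measure s
      [set x | E x /\ ~ (kappa%:E <= limf_einf
         (fun r : R => ((2 * r) `^ (- s))%:E * hausdorff_measure s (E `&` eball x r))
         (0%R^'+))] = 0.

End HausdorffMeasure.

Section FourierTransform.
Context {R : realType} {d : nat}.
Implicit Type mu : probability (Rn R d) R.

Definition locally_uniformly_dimensional (s : R) mu :=
  mu (@unit_cube R d) = 1%E /\
  exists2 C : R, 0 < C &
    forall (a : Rn R d) (l : R), 0 < l -> cube a l `<=` @unit_cube R d ->
      (mu (cube a l) <= (C * l `^ s)%:E)%E.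

(* The integral of exp(- i x . xi), taken on real and imaginary parts. *)
Definition fourier_transform mu (xi : Rn R d) : R[i] :=
  ((\int[mu]_x cos (edot x xi)) +i* (- \int[mu]_x sin (edot x xi)))%C.

Definition fourier_energy mu (T : R) : \bar R :=
  (\int[lebesgue_measure_Rn d]_(xi in [set xi | (enorm xi <= T)%R])
     (Normc.normc (fourier_transform mu xi) ^+ 2)%:E)%E.

End FourierTransform.

(* The terms of the sequence are the [t j] with [j] in the set of indices [I]. *)
Definition lacunary (R : realType) (tau1 tau2 : R) (I : set nat) (t : nat -> R) :=
  (forall j, I j -> 0 < t j <= 1) /\
  (forall j, I j -> I j.+1 -> tau1 <= t j.+1 / t j <= tau2).

(* Main.v *)
From HB Require Import structures.
From mathcomp Require Import all_boot all_order all_algebra.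
From mathcomp Require Import all_classical all_reals all_analysis.
From mathcomp Require Import measurable_realfun ring lra.
Require Import Defs.

(** Write D = d - s and let e = |mu^|^2 be the energy density, so that the
    energy F of e over balls of radius T lies between T^D / C0 and C0 T^D.
    Fix a random unit vector w, depending on the dimension only, whose
    transform at xi is O(|xi|^(-1/2)) ([sphere_measure_decay]), and let u_t be
    the cosine transform of t w.  The proof evaluates the sphere energy

      I(v, t) = int weight_v(xi) e(xi) u_t(xi) dxi

    in two ways, where weight_v is a product of Fejer kernels at scale 1/v.

    On the space side, the Fejer kernel is the transform of a compactly
    supported tent, and Fubini's theorem ([kernel_identity]) turns I(v, t) into
    the integral of a bump of width v at x - y - t w, against mu, mu and the law
    of w: a smoothed count of the pairs of points at distance t.  If t
    is not a distance of E, inner regularity and compactness give a subset K of E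
    of nearly full mass on which distances stay away from t ([compact_gap]).
    Pairs in K contribute nothing once v is small; a pair with a point outside K
    contributes little, because the form is bounded on L^2(mu): this is where
    mu(Q) <= C l(Q)^s and the decay of u_t enter ([schur_energy],
    [tail_energy], [trilinear_le]).  Hence I(v, t) becomes arbitrarily small
    ([sphere_energy_small]).

    On the frequency side, for |xi| <= 1/t the factor u_t is at least 1/2, which
    yields a fixed multiple of F(1/t) >= t^(-D) / C0.  The frequencies beyond A/t
    are negligible for a large constant A, since D <= 1/4 is beaten by the decay
    exponent 1/2.  The frequencies in between cost at most F(A/t) - F(1/t).  So
    if this increment is less than a small multiple of t^(-D), then I(v, t) is
    bounded below uniformly in v <= t ([sphere_energy_ge]), and t must be a
    distance.

    It remains to find such a t in the sequence.  Take every m-th term, with m so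
    large that 1/t grows by a factor A at each step.  If the increment were large
    at each of N such terms, the increments would add up to more than the total
    energy C0 t_N^(-D) allows, provided that t^(-D) is nearly constant along the
    N m terms considered; this is what a small D ensures
    ([scale_pigeonhole]). *)

Set Implicit Arguments.
Unset Strict Implicit.
Unset Printing Implicit Defensive.

Import Order.TTheory GRing.Theory Num.Theory.
Import numFieldNormedType.Exports.

Local Open Scope classical_set_scope.
Local Open Scope ring_scope.

(** * Real-valued integrals and a dominated Fubini theorem *)
Section RealIntegrable.
Context d {T : measurableType d} {R : realType}.
Variable m : {measure set T -> \bar R}.
Implicit Types f g : T -> R.

Lemma integrableRZl (r : R) f : m.-integrable setT (fun x => (f x)%:E) ->
  m.-integrable setT (fun x => (r * f x)%:E).
Proof. exact: (integrableZl measurableT r). Qed.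

Lemma integrableRZr (r : R) f : m.-integrable setT (fun x => (f x)%:E) ->
  m.-integrable setT (fun x => (f x * r)%:E).
Proof. exact: (integrableZr measurableT r). Qed.

Lemma integrableRD f g : m.-integrable setT (fun x => (f x)%:E) ->
  m.-integrable setT (fun x => (g x)%:E) ->
  m.-integrable setT (fun x => (f x + g x)%:E).
Proof. exact: (integrableD measurableT). Qed.

Lemma integrableRB f g : m.-integrable setT (fun x => (f x)%:E) ->
  m.-integrable setT (fun x => (g x)%:E) ->
  m.-integrable setT (fun x => (f x - g x)%:E).
Proof. exact: (integrableB measurableT). Qed.

Lemma measurable_integrableR f : m.-integrable setT (fun x => (f x)%:E) ->
  measurable_fun setT f.
Proof. by move=> /measurable_int /measurable_EFinP. Qed.

Lemma integrableR_le f g : measurable_fun setT f -> (forall x, `|f x| <= g x) ->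
  m.-integrable setT (fun x => (g x)%:E) -> m.-integrable setT (fun x => (f x)%:E).
Proof.
move=> mf fg; apply: le_integrable => //; first exact/measurable_EFinP.
by move=> x _ /=; rewrite lee_fin (le_trans (fg x))// ler_norm.
Qed.

Lemma integralRE f : m.-integrable setT (fun x => (f x)%:E) ->
  (\int[m]_x (f x)%:E)%E = (\int[m]_x f x)%:E.
Proof. by move=> If; rewrite fineK//; exact: integrable_fin_num. Qed.

Lemma Rintegral_lin (g h : T -> R) (a b : R) :
  m.-integrable setT (fun x => (g x)%:E) -> m.-integrable setT (fun x => (h x)%:E) ->
  \int[m]_x (a * g x + b * h x) = a * \int[m]_x g x + b * \int[m]_x h x.
Proof.
move=> Ig Ih.
transitivity (\int[m]_x (a * g x) + \int[m]_x (b * h x)).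
  exact: (RintegralD measurableT (integrableRZl a Ig) (integrableRZl b Ih)).
by congr (_ + _); exact: RintegralZl.
Qed.

End RealIntegrable.

Section BoundedFinite.
Context d {T : measurableType d} {R : realType}.
Variable m : {measure set T -> \bar R}.
Implicit Types f g : T -> R.

Lemma integrableR_bounded f (M : R) : (m setT < +oo)%E -> measurable_fun setT f ->
  (forall x, `|f x| <= M) -> m.-integrable setT (fun x => (f x)%:E).
Proof.
move=> mT mf fM; apply: measurable_bounded_integrable => //.
exists M; split; first exact: num_real.
by move=> N MN x _; exact: (le_trans (fM x) (ltW MN)).
Qed.

End BoundedFinite.

Section ProbabilityIntegral.
Context d {T : measurableType d} {R : realType} (P : probability T R).
Implicit Types f g : T -> R.

Lemma probability_lty : (P setT < +oo)%E.
Proof. by rewrite probability_setT ltry. Qed.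

Lemma Rintegral_probability_cst (c : R) : \int[P]_x c = c.
Proof.
by rewrite Rintegral_cst// [X in fine X](_ : _ = 1%E) ?mulr1//; exact: probability_setT.
Qed.

Lemma Rintegral_le_bound f (M : R) : measurable_fun setT f ->
  (forall x, `|f x| <= M) -> `|\int[P]_x f x| <= M.
Proof.
move=> mf fM.
have If := integrableR_bounded probability_lty mf fM.
apply: (le_trans (le_normr_Rintegral measurableT If)).
rewrite -[leRHS](Rintegral_probability_cst M).
apply: le_Rintegral => //; first exact: integrable_norm.
exact: finite_measure_integrable_cst.
Qed.

End ProbabilityIntegral.

Section MeasurableParameter.
Context d1 d2 (T1 : measurableType d1) (T2 : measurableType d2) {R : realType}.
Variables (Q : probability T2 R) (f : T1 * T2 -> R).
Hypothesis (mf : measurable_fun setT f).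

Lemma measurable_pair1R x : measurable_fun setT (fun y => f (x, y)).
Proof. exact: (measurableT_comp mf (pair1_measurable x)). Qed.

Lemma measurable_pair2R y : measurable_fun setT (fun x => f (x, y)).
Proof. exact: (measurableT_comp mf (pair2_measurable y)). Qed.

(** Adding the bound makes the integrand nonnegative, so that Tonelli's theorem
    gives measurability in the parameter. *)
Lemma measurable_Rintegral_param (M : R) : (forall z, `|f z| <= M) ->
  measurable_fun setT (fun x => \int[Q]_y f (x, y)).
Proof.
move=> fM.
have I1 x : Q.-integrable setT (fun y => (f (x, y))%:E).
  exact: (integrableR_bounded (probability_lty Q) (measurable_pair1R x) (fun y => fM (x, y))).
have I2 : Q.-integrable setT (fun y => M%:E) by exact: finite_measure_integrable_cst.
pose g (z : T1 * T2) := (f z + M)%:E.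
have mg : measurable_fun setT g.
  by apply/measurable_EFinP; exact: measurable_funD.
have g0 z : (0 <= g z)%E.
  by rewrite lee_fin; have := fM z; rewrite ler_norml => /andP[]; lra.
have mG : measurable_fun setT (fubini_F Q g) by exact: measurable_fun_fubini_tonelli_F.
have -> : (fun x => \int[Q]_y f (x, y)) = (fun x => fine (fubini_F Q g x) - M).
  apply/funext => x.
  have e : \int[Q]_y (f (x, y) + M) = \int[Q]_y f (x, y) + M.
    transitivity (\int[Q]_y f (x, y) + \int[Q]_y M).
      exact: (RintegralD measurableT (I1 x) I2).
    by congr (_ + _); exact: Rintegral_probability_cst.
  by apply/eqP; rewrite eq_sym subr_eq -e.
apply: measurable_funB => //.
by apply: (measurableT_comp (@fine_measurable R setT measurableT) mG).
Qed.

End MeasurableParameter.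

Section DominatedFubini.
Context d1 d2 (T1 : measurableType d1) (T2 : measurableType d2) {R : realType}.
Variables (m : {sigma_finite_measure set T1 -> \bar R}) (Q : probability T2 R).
Variables (f : T1 * T2 -> R) (W : T1 -> R).
Hypotheses (mf : measurable_fun setT f) (IW : m.-integrable setT (fun x => (W x)%:E)).
Hypothesis fW : forall x y, `|f (x, y)| <= W x.

Let If : (m \x Q)%E.-integrable setT (fun z => (f z)%:E).
Proof.
have mfE : measurable_fun setT (fun z => (f z)%:E) by exact/measurable_EFinP.
apply/(integrable12ltyP _ _ mfE).
apply: le_lt_trans (integrable_lty measurableT IW).
apply: ge0_le_integral => //.
- by move=> x _; exact: integral_ge0.
- apply: (measurable_fun_fubini_tonelli_F (fun z => `|(f z)%:E|)%E) => //.
  exact: measurableT_comp.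
- exact: measurable_int IW.
move=> x _.
apply: (@le_trans _ _ (\int[Q]_y (W x)%:E)%E).
  apply: ge0_le_integral => //.
  - apply: measurableT_comp => //; apply/measurable_EFinP; exact: measurable_pair1R.
  - by move=> y _; rewrite lee_fin fW.
suff e : (\int[Q]_y (W x)%:E = (W x)%:E)%E by rewrite e.
rewrite integralRE; last exact: finite_measure_integrable_cst.
by congr EFin; exact: Rintegral_probability_cst.
Qed.

Let inner1 x : (\int[Q]_y (f (x, y))%:E)%E = (\int[Q]_y f (x, y))%:E.
Proof.
apply: integralRE.
exact: (integrableR_bounded (probability_lty Q) (measurable_pair1R mf x) (fW x)).
Qed.

Let inner2 y : (\int[m]_x (f (x, y))%:E)%E = (\int[m]_x f (x, y))%:E.
Proof.
apply: integralRE; apply: integrableR_le IW => //; exact: measurable_pair2R.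
Qed.

Lemma measurable_Rintegral2 : measurable_fun setT (fun y => \int[m]_x f (x, y)).
Proof.
apply/measurable_EFinP; rewrite (_ : _ \o _ = fubini_G m (fun z => (f z)%:E)).
  exact: (measurable_fubini_G If).
by apply/funext => x /=; rewrite /fubini_G inner2.
Qed.

Lemma Rfubini1 : \int[(m \x Q)%E]_z f z = \int[m]_x \int[Q]_y f (x, y).
Proof.
rewrite /Rintegral -(integral12_prod_meas1 If); congr fine.
by apply: eq_integral => x _; rewrite /fubini_F inner1.
Qed.

Lemma Rfubini2 : \int[(m \x Q)%E]_z f z = \int[Q]_y \int[m]_x f (x, y).
Proof.
rewrite /Rintegral -(integral21_prod_meas1 If); congr fine.
by apply: eq_integral => x _; rewrite /fubini_G inner2.
Qed.

Lemma Rfubini : \int[m]_x \int[Q]_y f (x, y) = \int[Q]_y \int[m]_x f (x, y).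
Proof. by rewrite -Rfubini1 Rfubini2. Qed.

End DominatedFubini.

(** * The Fejer kernel *)
Section Fejer.
Context {R : realType}.
Notation leb := (@lebesgue_measure R).

Lemma sin_eq_mul_cos (x : R) : exists2 c, `|c| <= `|x| & sin x = x * cos c.
Proof.
have pos (y : R) : 0 <= y -> exists2 c, `|c| <= `|y| & sin y = y * cos c.
  move=> y0.
  have dsin z : z \in `]0, y[ -> is_derive z 1 (@sin R) (cos z) by move=> _; exact: is_derive_sin.
  have csin : {within `[0, y], continuous (@sin R)}.
    by apply: continuous_subspaceT => z; exact: continuous_sin.
  have [c] := MVT_segment y0 dsin csin.
  rewrite in_itv/= sin0 !subr0 => /andP[c0 cy] ->.
  by exists c; [by rewrite !ger0_norm|rewrite mulrC].
have [|x0] := leP 0 x; first exact: pos.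
have [|c cx e] := pos (- x); first by rewrite oppr_ge0 ltW.
exists c; first by rewrite -(normrN x).
by rewrite -[x]opprK sinN e !mulNr.
Qed.

Lemma normr_sin_le (x : R) : `|sin x| <= `|x|.
Proof.
have [c _ ->] := sin_eq_mul_cos x; rewrite normrM -[leRHS]mulr1.
by rewrite ler_wpM2l// cos_max.
Qed.

Lemma onem_cos (x : R) : 1 - cos x = 2 * sin (x / 2) ^+ 2.
Proof.
have {1}-> : x = (x / 2) *+ 2 by rewrite mulr2n; lra.
rewrite cos_mulr2n cos2sin2; lra.
Qed.

Lemma cos_ge_onem (x : R) : 1 - x ^+ 2 / 2 <= cos x.
Proof.
suff : 1 - cos x <= x ^+ 2 / 2 by lra.
rewrite onem_cos -[x in leRHS](divfK (_ : 2 != 0 :> R))//.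
have : sin (x / 2) ^+ 2 <= (x / 2) ^+ 2.
  by rewrite -real_normK ?num_real// -[leRHS]real_normK ?num_real// lerXn2r ?nnegrE// normr_sin_le.
rewrite exprMn; lra.
Qed.

(** The square of sin (a / 2) / (a / 2), with its continuous value 1 at 0. *)
Definition fejer (a : R) : R :=
  if a == 0 then 1 else 2 * (1 - cos a) / a ^+ 2.

Lemma fejer0 : fejer 0 = 1.
Proof. by rewrite /fejer eqxx. Qed.

Lemma fejer_eq_sqr_cos (a : R) : exists2 c, `|c| <= `|a| / 2 & fejer a = cos c ^+ 2.
Proof.
rewrite /fejer; case: eqVneq => [->|a0].
  by exists 0; rewrite ?normr0 ?mul0r// cos0 expr1n.
have [c ca e] := sin_eq_mul_cos (a / 2).
exists c; first by move: ca; rewrite normrM (ger0_norm (_ : 0 <= 2^-1 :> R)).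
by rewrite onem_cos e; field.
Qed.

Lemma fejer_ge0 a : 0 <= fejer a.
Proof. by have [c _ ->] := fejer_eq_sqr_cos a; exact: sqr_ge0. Qed.

Lemma fejer_le1 a : fejer a <= 1.
Proof.
have [c _ ->] := fejer_eq_sqr_cos a.
by rewrite -real_normK ?num_real// exprn_ile1 ?cos_max.
Qed.

Lemma fejer_ge_half a : `|a| <= 1 -> 2^-1 <= fejer a.
Proof.
move=> a1; have [c ca ->] := fejer_eq_sqr_cos a.
have c1 : `|c| <= 2^-1 by apply: le_trans ca _; lra.
have : c ^+ 2 <= 2^-1 ^+ 2 by rewrite -real_normK ?num_real// lerXn2r ?nnegrE.
have := cos_ge_onem c; set x := cos c; set y := c ^+ 2 => h1 h2.
have : 7/8 <= x by lra.
nra.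
Qed.

Lemma fejerN a : fejer (- a) = fejer a.
Proof. by rewrite /fejer oppr_eq0 cosN sqrrN. Qed.

Lemma fejer_sqr a : a ^+ 2 * fejer a = 2 * (1 - cos a).
Proof.
rewrite /fejer; case: eqVneq => [->|a0]; first by rewrite cos0; lra.
by field.
Qed.

Lemma onem_fejer_le a : 1 - fejer a <= a ^+ 2 / 4.
Proof.
have [c ca ->] := fejer_eq_sqr_cos a.
have -> : 1 - cos c ^+ 2 = sin c ^+ 2 by rewrite sin2cos2.
apply: (@le_trans _ _ (c ^+ 2)).
  by rewrite -real_normK ?num_real// -[leRHS]real_normK ?num_real// lerXn2r ?nnegrE// normr_sin_le.
have -> : a ^+ 2 / 4 = (`|a| / 2) ^+ 2 by rewrite expr_div_n real_normK ?num_real//; lra.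
by rewrite -real_normK ?num_real// lerXn2r ?nnegrE// ?divr_ge0.
Qed.

Lemma continuous_fejer : continuous fejer.
Proof.
move=> a; have [->|a0] := eqVneq a 0.
  apply/cvgrPdist_le => /= e e0.
  near=> x.
  rewrite /fejer eqxx -/(fejer x) ger0_norm ?subr_ge0 ?fejer_le1//.
  apply: (le_trans (onem_fejer_le x)).
  have x1 : `|x| <= 1 by near: x; exact: (@nbhs0_le R R^o 1 ltr01).
  have xe : `|x| <= e by near: x; exact: (@nbhs0_le R R^o e e0).
  by rewrite -real_normK ?num_real//; have := normr_ge0 x; nra.
apply: (@cvg_trans _ ((fun x => 2 * (1 - cos x) / x ^+ 2) @ a)).
  apply: near_eq_cvg; near=> x; rewrite /fejer ifF//.
  apply/negbTE; near: x.
  by apply: (@cvgr_neq0 R R^o _ _ _ _ a) => //; exact: cvg_id.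
rewrite /fejer (negbTE a0).
have c1 : 2 * (1 - cos x) @[x --> a] --> 2 * (1 - cos a).
  apply: cvgM; first exact: cvg_cst.
  by apply: cvgB; [exact: cvg_cst|exact: continuous_cos].
have c2 : x ^+ 2 @[x --> a] --> a ^+ 2 by exact: exprn_continuous.
have a20 : a ^+ 2 != 0 by rewrite expf_neq0.
exact: (cvgM c1 (cvgV a20 c2)).
Unshelve. all: end_near. Qed.

Lemma measurable_fejer (v : R) : measurable_fun setT (fun a => fejer (v * a)).
Proof.
apply: (measurableT_comp (continuous_measurable_fun continuous_fejer)).
exact: measurable_funM.
Qed.

Lemma lebesgue_measure_scale (v : R) (v0 : 0 < v) (A : set R) : measurable A ->
  (leb A = v%:E * pushforward leb (fun x : R => (v * x)%R : measurableTypeR R) A)%E.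
Proof.
move=> mA.
have mv : measurable_fun setT (fun x : R => v * x : measurableTypeR R).
  exact: measurable_funM.
pose vn : {nonneg R} := NngNum (ltW v0).
pose pm : {measure set (measurableTypeR R) -> \bar R} :=
  pushforward leb (fun x : R => v * x : measurableTypeR R).
rewrite (@lebesgue_measure_unique R (mscale vn (pm mv)))//.
move=> _ [[a b]] _ <-; rewrite /mscale/= /pushforward.
rewrite [X in _ = (_ * leb X)%E](_ : _ = `]a / v, b / v]%classic); last first.
  by apply/seteqP; split => x /=; rewrite !in_itv/= ltr_pdivrMr// ler_pdivlMr// ![x * v]mulrC.
rewrite !lebesgue_measure_itv/= !lte_fin ltr_pM2r ?invr_gt0//.
case: ltP => // _; rewrite ?mule0//.
by rewrite -!EFinB -EFinM mulrBr !(mulrC v) !divfK ?gt_eqF.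
Qed.

Lemma integral_scale (v : R) (f : R -> R) : 0 < v -> measurable_fun setT f ->
  (forall x, 0 <= f x) ->
  (\int[leb]_x (f x)%:E = v%:E * \int[leb]_x (f (v * x)%R)%:E)%E.
Proof.
move=> v0 mf f0.
have mv : measurable_fun setT (fun x : R => v * x : measurableTypeR R).
  exact: measurable_funM.
pose vn : {nonneg R} := NngNum (ltW v0).
pose pm : {measure set (measurableTypeR R) -> \bar R} :=
  pushforward leb (fun x : R => v * x : measurableTypeR R).
rewrite (eq_measure_integral (mscale vn (pm mv))); last first.
  by move=> A mA _; exact: lebesgue_measure_scale.
have mfE : measurable_fun [set: R] (fun x => (f x)%:E) by exact/measurable_EFinP.
rewrite ge0_integral_mscale//=; last by move=> x _; rewrite lee_fin.
congr (_ * _)%E.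
rewrite ge0_integral_pushforward//.
by move=> x _; rewrite lee_fin.
Qed.

Lemma integralN_lebesgue (f : R -> R) : measurable_fun setT f ->
  (forall x, 0 <= f x) ->
  (\int[leb]_x (f x)%:E = \int[leb]_x (f (- x)%R)%:E)%E.
Proof.
move=> mf f0.
have mN : measurable_fun setT (-%R : R -> measurableTypeR R) by [].
rewrite (eq_measure_integral (pushforward leb (-%R : R -> measurableTypeR R))); last first.
  by move=> A mA _; exact/esym/(@lebesgue_measureN R A mA).
rewrite ge0_integral_pushforward//; first exact/measurable_EFinP.
by move=> x _; rewrite lee_fin.
Qed.

End Fejer.

(** * The cosine transform of the Fejer kernel *)
Section Tent.
Context {R : realType}.
Notation leb := (@lebesgue_measure R).
Notation fejer := (@fejer R).

(** The value is 2 pi. *)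
Definition fejer_mass : R := \int[leb]_a fejer a.

(** Integrability comes from comparison with 1 / (1 + a^2), whose integral is
    known through the arctangent. *)
Lemma oneDsqr_mul_fejer_le a : (1 + a ^+ 2) * fejer a <= 5.
Proof.
rewrite mulrDl mul1r fejer_sqr; have := fejer_le1 a; have := cos_geN1 a; lra.
Qed.

Lemma integrable_fejer1 : leb.-integrable setT (EFin \o fejer).
Proof.
have mfejer : measurable_fun setT fejer.
  exact: (continuous_measurable_fun continuous_fejer).
have : leb.-integrable setT (fun a : R => (5 * (oneDsqr a)^-1)%:E).
  under eq_fun do rewrite EFinM.
  apply: integrableZl => //; apply/integrableP; split.
    apply/measurable_EFinP; apply: continuous_measurable_fun.
    exact: continuous_oneDsqrV.
  have -> : (fun x : R => `|((oneDsqr x)^-1)%:E|)%E = (fun x => (oneDsqr x)^-1%:E).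
    by apply/funext => a; rewrite /= ger0_norm// invr_ge0 oneDsqr_ge0.
  rewrite ge0_symfun_integralT//.
  - rewrite -set_itvcy integral0y_oneDsqr -EFinM ltry//.
  - exact: continuous_oneDsqrV.
  - by move=> x; rewrite /= /oneDsqr sqrrN.
apply: le_integrable => //; first exact/measurable_EFinP.
move=> a _ /=; rewrite lee_fin ger0_norm ?fejer_ge0//.
rewrite ger0_norm ?divr_ge0 ?oneDsqr_ge0//.
rewrite ler_pdivlMr ?oneDsqr_gt0// mulrC; exact: oneDsqr_mul_fejer_le.
Qed.

Lemma fejer_mass_ge0 : 0 <= fejer_mass.
Proof. by apply: Rintegral_ge0 => x _; exact: fejer_ge0. Qed.

Lemma integral_fejer_pos (v : R) : 0 < v ->
  (\int[leb]_a (fejer (v * a))%:E)%E = (fejer_mass / v)%:E.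
Proof.
move=> v0.
have := @integral_scale _ v fejer v0 (continuous_measurable_fun continuous_fejer) (@fejer_ge0 R).
have : (\int[leb]_x (fejer x)%:E)%E = fejer_mass%:E.
  by rewrite fineK// (integrable_fin_num _ integrable_fejer1).
move=> -> /(congr1 (fun x => (v^-1)%:E * x)%E).
by rewrite muleA -!EFinM mulVf ?gt_eqF// mul1e mulrC => ->.
Qed.

Lemma integrable_fejer (v : R) : v != 0 ->
  leb.-integrable setT (fun a => (fejer (v * a))%:E).
Proof.
move=> v0; apply/integrableP; split.
  by apply/measurable_EFinP; exact: measurable_fejer.
have -> : (fun a : R => `|(fejer (v * a))%:E|)%E = (fun a => (fejer (v * a))%:E).
  by apply/funext => a; rewrite /= ger0_norm// fejer_ge0.
wlog {v0}v0 : v / 0 < v => [H|]; last by rewrite integral_fejer_pos// ltry.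
have [v1|v1] := ltP 0 v; first exact: H.
have := H (- v).
have -> : (fun a : R => (fejer (- v * a))%:E)%E = (fun a => (fejer (v * a))%:E).
  by apply/funext => a; rewrite mulNr fejerN.
by apply; rewrite oppr_gt0 lt_neqAle v0.
Qed.

Lemma integral_fejer_sqr (p v : R) : 0 < v ->
  leb.-integrable setT (fun a => (p ^+ 2 * fejer (p * (v * a)))%:E) /\
  \int[leb]_a (p ^+ 2 * fejer (p * (v * a))) = `|p| * (fejer_mass / v).
Proof.
move=> v0; have [->|p0] := eqVneq p 0.
  split.
    apply: (eq_integrable _ (cst 0)) => //; last exact: integrable0.
    by move=> x _; rewrite expr0n mul0r.
  rewrite normr0 mul0r; under eq_Rintegral do rewrite expr0n mul0r.
  by rewrite Rintegral_cst// mul0r.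
have pv : p * v != 0 by rewrite mulf_neq0// lt0r_neq0.
have ifej : leb.-integrable setT (fun a => (fejer (p * (v * a)))%:E).
  by under eq_fun do rewrite mulrA; exact: integrable_fejer.
split; first by under eq_fun do rewrite EFinM; exact: integrableZl.
rewrite RintegralZl//.
have -> : \int[leb]_a fejer (p * (v * a)) = fejer_mass / (`|p| * v).
  rewrite /Rintegral.
  have -> : (fun a : R => (fejer (p * (v * a)))%:E) = (fun a => (fejer ((`|p| * v) * a))%:E).
    apply/funext => a; rewrite -mulrA; congr EFin; case: (ler0P p) => // _.
    by rewrite mulNr fejerN.
  by rewrite integral_fejer_pos// mulr_gt0// normr_gt0.
have : `|p| != 0 by rewrite normr_eq0.
have : p ^+ 2 = `|p| ^+ 2 by rewrite real_normK ?num_real.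
by move=> -> ?; field; rewrite gt_eqF.
Qed.

(** The triangle of half-width [v] and height [fejer_mass / v]. *)
Definition tent (v z : R) : R := fejer_mass / v * Num.max 0 (1 - `|z / v|).

Lemma tent_ge0 v z : 0 < v -> 0 <= tent v z.
Proof.
by move=> v0; rewrite /tent mulr_ge0// ?divr_ge0 ?fejer_mass_ge0 ?(ltW v0)//.
Qed.

Lemma tent_le v z : 0 < v -> tent v z <= fejer_mass / v.
Proof.
by move=> v0; rewrite /tent -[leRHS]mulr1 ler_wpM2l ?divr_ge0 ?fejer_mass_ge0 ?(ltW v0)//.
Qed.

Lemma tent_eq0 v z : 0 < v -> v <= `|z| -> tent v z = 0.
Proof.
move=> v0 vz; rewrite /tent (_ : Num.max _ _ = 0) ?mulr0//.
apply/max_idPl; rewrite subr_le0 normrM normfV (gtr0_norm v0).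
by rewrite ler_pdivlMr// mul1r.
Qed.

Lemma measurable_tent v : measurable_fun setT (tent v).
Proof.
apply: measurable_funM => //; apply: measurable_maxr => //.
apply: measurable_funB => //.
by apply: measurableT_comp => //; exact: measurable_funM.
Qed.

Lemma integrable_fejer_mul (v : R) (h : R -> R) : 0 < v ->
  measurable_fun setT h -> (forall a, `|h a| <= 1) ->
  leb.-integrable setT (fun a => (fejer (v * a) * h a)%:E).
Proof.
move=> v0 mh h1.
have iv := integrable_fejer (lt0r_neq0 v0).
apply: le_integrable iv => //.
  by apply/measurable_EFinP; apply: measurable_funM => //; exact: measurable_fejer.
move=> a _ /=; rewrite lee_fin normrM -[leRHS]mulr1.
by rewrite ler_wpM2l.
Qed.

Lemma measurable_affine (z phi : R) : measurable_fun setT (fun a => z * a + phi).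
Proof. by apply: measurable_funD => //; exact: measurable_funM. Qed.

Lemma measurable_cos_affine (z phi : R) :
  measurable_fun setT (fun a => cos (z * a + phi)).
Proof.
exact: (measurableT_comp (continuous_measurable_fun (@continuous_cos R)) (measurable_affine z phi)).
Qed.

Lemma measurable_sin_affine (z phi : R) :
  measurable_fun setT (fun a => sin (z * a + phi)).
Proof.
exact: (measurableT_comp (continuous_measurable_fun (@continuous_sin R)) (measurable_affine z phi)).
Qed.

(** After multiplication by the square of v a, everything is a combination of
    cosines, and the product formula expresses fejer (v a) cos (w v a) as
    1/2 p^2 fejer (p v a) at p = 1 + w, plus the same at p = 1 - w, minus
    p^2 fejer (p v a) at p = w.  By scaling, p^2 fejer (p v a) has integral
    |p| fejer_mass / v, so the result is a second difference of the absolute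
    value, which is a tent. *)
Lemma integral_fejer_cos0 (v z : R) : 0 < v ->
  \int[leb]_a (fejer (v * a) * cos (z * a)) = tent v z.
Proof.
move=> v0; pose w := z / v.
pose G p a := p ^+ 2 * fejer (p * (v * a)).
have GI p : leb.-integrable setT (EFin \o G p) by have [] := integral_fejer_sqr p v0.
have GE p : \int[leb]_a G p a = `|p| * (fejer_mass / v).
  by have [] := integral_fejer_sqr p v0.
have GS p a : (v * a) ^+ 2 * G p a = 2 * (1 - cos (p * (v * a))).
  by rewrite /G -fejer_sqr; ring.
transitivity (\int[leb]_a (2^-1 * G (1 + w) a + 2^-1 * G (1 - w) a - G w a)).
  apply: eq_Rintegral => a _.
  have [->|a0] := eqVneq a 0.
    by rewrite /G !mulr0 cos0 fejer0; lra.
  have va : (v * a) ^+ 2 != 0 by rewrite expf_neq0// mulf_neq0// lt0r_neq0.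
  apply: (mulfI va); rewrite mulrA fejer_sqr.
  rewrite [RHS](_ : _ = 2^-1 * ((v * a) ^+ 2 * G (1 + w) a) +
    2^-1 * ((v * a) ^+ 2 * G (1 - w) a) - (v * a) ^+ 2 * G w a); last ring.
  rewrite !GS.
  have -> : z * a = w * (v * a) by rewrite /w; field; rewrite gt_eqF.
  rewrite [(1 + w) * _]mulrDl [(1 - w) * _]mulrDl mulNr !mul1r cosD cosB; by field.
have h2 p : leb.-integrable setT (fun a => (2^-1 * G p a)%:E).
  by have := integrableZl measurableT 2^-1 (GI p).
have h3 : leb.-integrable setT (fun a => (2^-1 * G (1 + w) a + 2^-1 * G (1 - w) a)%:E).
  have := integrableD measurableT (h2 (1 + w)) (h2 (1 - w)).
  by apply: eq_integrable => // a _; rewrite /= EFinD.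
transitivity (\int[leb]_a (2^-1 * G (1 + w) a + 2^-1 * G (1 - w) a) - \int[leb]_a G w a).
  exact: (RintegralB measurableT h3 (GI w)).
transitivity (\int[leb]_a (2^-1 * G (1 + w) a) + \int[leb]_a (2^-1 * G (1 - w) a) - \int[leb]_a G w a).
  by congr (_ - _); exact: (RintegralD measurableT (h2 _) (h2 _)).
have hZ p : \int[leb]_a (2^-1 * G p a) = 2^-1 * (`|p| * (fejer_mass / v)).
  by rewrite -GE; exact: (RintegralZl _ measurableT (GI p)).
rewrite !hZ GE /tent -/w.
rewrite (_ : Num.max 0 (1 - `|w|) = 2^-1 * `|1 + w| + 2^-1 * `|1 - w| - `|w|); first ring.
rewrite maxEle; case: ifP.
  by case: (ger0P (1 + w)); case: (ger0P (1 - w)); case: (ger0P w) => *; lra.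
by move/negbT; rewrite -ltNge; case: (ger0P (1 + w)); case: (ger0P (1 - w)); case: (ger0P w) => *; lra.
Qed.

Lemma integral_fejer_sin0 (v z : R) : 0 < v ->
  \int[leb]_a (fejer (v * a) * sin (z * a)) = 0.
Proof.
move=> v0.
have msin := measurable_sin_affine z 0.
have I1 := integrable_fejer (lt0r_neq0 v0).
have I2 : leb.-integrable setT (fun a => (fejer (v * a) * sin (z * a))%:E).
  apply: integrable_fejer_mul => //; last by move=> a; exact: sin_max.
  by move: msin; under eq_fun do rewrite addr0.
have mf : measurable_fun setT (fun a => fejer (v * a) + fejer (v * a) * sin (z * a)).
  apply/measurable_EFinP.
  exact: measurable_int (integrableD measurableT I1 I2).
have f0 a : 0 <= fejer (v * a) + fejer (v * a) * sin (z * a).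
  have := sin_geN1 (z * a); have := fejer_ge0 (v * a); nra.
have := integralN_lebesgue mf f0 => /(congr1 fine).
rewrite -!/(Rintegral _ _ _) RintegralD//.
under [X in _ = X -> _]eq_Rintegral do rewrite !mulrN fejerN sinN mulrN.
rewrite RintegralB//; lra.
Qed.

(** The phase splits into an even part, given by the tent, and an odd part, which
    integrates to 0. *)
Lemma integral_fejer_cos (v z phi : R) : 0 < v ->
  \int[leb]_a (fejer (v * a) * cos (z * a + phi)) = tent v z * cos phi.
Proof.
move=> v0.
have Ic : leb.-integrable setT (fun a => (fejer (v * a) * cos (z * a))%:E).
  apply: integrable_fejer_mul => //; last by move=> a; exact: cos_max.
  by have := measurable_cos_affine z 0; under eq_fun do rewrite addr0.
have Is : leb.-integrable setT (fun a => (fejer (v * a) * sin (z * a))%:E).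
  apply: integrable_fejer_mul => //; last by move=> a; exact: sin_max.
  by have := measurable_sin_affine z 0; under eq_fun do rewrite addr0.
under eq_Rintegral do rewrite cosD mulrBr !mulrA.
rewrite RintegralB//; [|exact: integrableRZr Ic|exact: integrableRZr Is].
by rewrite !RintegralZr// integral_fejer_cos0// integral_fejer_sin0// mul0r subr0.
Qed.

End Tent.

(** * Product kernels on Euclidean space *)
Section LebesgueRn.
Context {R : realType}.
Notation leb := (@lebesgue_measure R).
Notation lebn d := (@lebesgue_measure_Rn R d).

Lemma coord_cons0 d (p : measurableTypeR R * Rn R d) : coord (tuple_cons p) ord0 = p.1.
Proof. by []. Qed.

Lemma coord_consS d (p : measurableTypeR R * Rn R d) i :
  coord (tuple_cons p) (lift ord0 i) = coord p.2 i.
Proof. by rewrite /coord tnthS. Qed.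

Lemma measurable_coord d (i : 'I_d) : measurable_fun setT (fun x : Rn R d => coord x i).
Proof. exact: measurable_tnth. Qed.

Lemma edot_cons d (p : measurableTypeR R * Rn R d) (z : Rn R d.+1) :
  edot z (tuple_cons p) =
  coord z ord0 * p.1 + edot [tuple of behead z] p.2.
Proof.
rewrite /edot big_ord_recl coord_cons0; congr (_ + _); apply: eq_bigr => i _.
by rewrite coord_consS /coord tnth_behead; congr (tnth _ _ * _); apply: val_inj; rewrite /= inordK// ltnS.
Qed.

Lemma ge0_integral_lebesgue_cons d (f : Rn R d.+1 -> \bar R) : measurable_fun setT f ->
  (forall x, 0 <= f x)%E ->
  (\int[lebn d.+1]_x f x = \int[(leb \x lebn d)%E]_p f (tuple_cons p))%E.
Proof.
move=> mf f0.
rewrite -(@ge0_integral_pushforward _ _ _ _ _ _ (@measurable_tuple_cons R d) (leb \x lebn d)%E setT f)//.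
Qed.

Lemma integrable_lebesgue_cons d (f : Rn R d.+1 -> R) : measurable_fun setT f ->
  (leb \x lebn d)%E.-integrable setT (fun p => (f (tuple_cons p))%:E) ->
  (lebn d.+1).-integrable setT (fun x => (f x)%:E).
Proof.
move=> mf /integrableP[_ If]; apply/integrableP; split; first exact/measurable_EFinP.
rewrite ge0_integral_lebesgue_cons//.
by apply: measurableT_comp => //; exact/measurable_EFinP.
Qed.

Lemma integral_lebesgue_cons d (f : Rn R d.+1 -> R) : measurable_fun setT f ->
  (leb \x lebn d)%E.-integrable setT (fun p => (f (tuple_cons p))%:E) ->
  (\int[lebn d.+1]_x (f x)%:E =
   \int[leb]_a \int[lebn d]_y (f (tuple_cons (a, y)))%:E)%E.
Proof.
move=> mf If.
transitivity (\int[(leb \x lebn d)%E]_p (f (tuple_cons p))%:E)%E.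
  have mfE : measurable_fun setT (EFin \o f) by exact/measurable_EFinP.
  rewrite -(@integral_pushforward _ _ _ _ _ _ (@measurable_tuple_cons R d) (leb \x lebn d)%E
    setT (EFin \o f) mfE If measurableT).
  by [].
by rewrite -(integral12_prod_meas1 If).
Qed.

Definition weight d (v : R) (xi : Rn R d) : R := \prod_(i < d) fejer (v * coord xi i).

Definition tentn d (v : R) (z : Rn R d) : R := \prod_(i < d) tent v (coord z i).

Lemma weight_ge0 d v (xi : Rn R d) : 0 <= weight v xi.
Proof. by apply: prodr_ge0 => i _; exact: fejer_ge0. Qed.

Lemma weight_le1 d v (xi : Rn R d) : weight v xi <= 1.
Proof. by apply: prodr_ile1 => i _; rewrite fejer_ge0 fejer_le1. Qed.

Lemma measurable_weight d v : measurable_fun setT (@weight d v).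
Proof.
apply: measurable_prod => i _.
exact: (measurableT_comp (measurable_fejer v) (measurable_coord i)).
Qed.

Lemma tentn_ge0 d v (z : Rn R d) : 0 < v -> 0 <= tentn v z.
Proof. by move=> v0; apply: prodr_ge0 => i _; exact: tent_ge0. Qed.

Lemma tentn_eq0 d v (z : Rn R d) i : 0 < v -> v <= `|coord z i| -> tentn v z = 0.
Proof. by move=> v0 vz; rewrite /tentn (bigD1 i)//= tent_eq0// mul0r. Qed.

Lemma tentn_le d v (z : Rn R d) : 0 < v -> tentn v z <= (fejer_mass / v) ^+ d.
Proof.
move=> v0; rewrite /tentn -[X in _ ^+ X]card_ord -prodr_const.
by apply: ler_prod => i _; rewrite tent_ge0// tent_le.
Qed.

Lemma measurable_tentn d v : measurable_fun setT (@tentn d v).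
Proof.
apply: measurable_prod => i _.
exact: (measurableT_comp (measurable_tent v) (measurable_coord i)).
Qed.

Lemma measurable_edotr d (z : Rn R d) : measurable_fun setT (fun x => edot z x).
Proof.
apply: measurable_sum => i; apply: measurable_funM => //; exact: measurable_coord.
Qed.

Lemma weight_cons d v (p : measurableTypeR R * Rn R d) :
  weight v (tuple_cons p) = fejer (v * p.1) * weight v p.2.
Proof.
rewrite /weight big_ord_recl coord_cons0; congr (_ * _).
by apply: eq_bigr => i _; rewrite coord_consS.
Qed.

Lemma integrable_weight_prod d v : 0 < v ->
  (lebn d).-integrable setT (fun x => (weight v x)%:E) ->
  (leb \x lebn d)%E.-integrable setT (fun p => (weight v (tuple_cons p))%:E).
Proof.
move=> v0 Iw.
have mw : measurable_fun [set: measurableTypeR R * Rn R d] (fun p => (weight v (tuple_cons p))%:E).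
  apply/measurable_EFinP.
  exact: (measurableT_comp (@measurable_weight d.+1 v) (@measurable_tuple_cons R d)).
apply/(integrable12ltyP _ _ mw).
rewrite [ltLHS](_ : _ = \int[leb]_a ((\int[lebn d]_x weight v x) * fejer (v * a))%:E)%E.
  apply: integrable_lty => //; apply: integrableRZl.
  exact: integrable_fejer (lt0r_neq0 v0).
apply: eq_integral => a _.
transitivity (\int[lebn d]_y ((fejer (v * a))%:E * (weight v y)%:E))%E.
  apply: eq_integral => y _.
  by rewrite gee0_abs ?lee_fin ?weight_ge0// weight_cons EFinM.
by rewrite integralZl// integralRE// -EFinM mulrC.
Qed.

Lemma integrable_weight d v : 0 < v ->
  (lebn d).-integrable setT (fun x => (weight v x)%:E).
Proof.
move=> v0; elim: d => [|d IH].
  rewrite (_ : (fun x => _) = cst 1%:E); last first.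
    by apply/funext => x; rewrite /weight big_ord0.
  apply/integrableP; split => //.
  rewrite integral_dirac//= ?diracT ?mul1e ?normr1 ?ltry//.
apply: integrable_lebesgue_cons; first exact: measurable_weight.
exact: integrable_weight_prod.
Qed.

Lemma integrable_weight_mul d v (h : Rn R d -> R) (M : R) : 0 < v -> measurable_fun setT h ->
  (forall x, `|h x| <= M) ->
  (lebn d).-integrable setT (fun x => (weight v x * h x)%:E).
Proof.
move=> v0 mh hM.
apply: (@integrableR_le _ _ _ _ _ (fun x => M * weight v x)).
- by apply: measurable_funM => //; exact: measurable_weight.
- move=> x; rewrite normrM ger0_norm ?weight_ge0// mulrC ler_wpM2r ?weight_ge0//.
- exact: integrableRZl (integrable_weight d v0).
Qed.

Lemma measurable_cos_edot d (z : Rn R d) (phi : R) :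
  measurable_fun setT (fun x => cos (edot z x + phi)).
Proof.
apply: (measurableT_comp (continuous_measurable_fun (@continuous_cos R))).
by apply: measurable_funD => //; exact: measurable_edotr.
Qed.

(** By induction on the dimension: once a coordinate of the variable is frozen,
    its contribution to the scalar product is a phase for the remaining ones,
    which is why the statement has a phase. *)
Lemma integral_weight_cos d v (z : Rn R d) (phi : R) : 0 < v ->
  \int[lebn d]_x (weight v x * cos (edot z x + phi)) = tentn v z * cos phi.
Proof.
move=> v0; elim: d => [|d IH] in z phi *.
  rewrite /tentn big_ord0 mul1r /Rintegral /=.
  rewrite integral_dirac//=; last first.
    apply/measurable_EFinP/measurable_funM; first exact: measurable_weight.
    exact: measurable_cos_edot.
  by rewrite indicT mul1r /weight /edot !big_ord0 add0r mul1r.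
have mf : measurable_fun setT (fun x => weight v x * cos (edot z x + phi)).
  by apply: measurable_funM; [exact: measurable_weight|exact: measurable_cos_edot].
have If : (leb \x lebn d)%E.-integrable setT
    (fun p => (weight v (tuple_cons p) * cos (edot z (tuple_cons p) + phi))%:E).
  apply: integrableR_le (integrable_weight_prod v0 (integrable_weight d v0)).
    exact: (measurableT_comp mf (@measurable_tuple_cons R d)).
  move=> p; rewrite normrM ger0_norm ?weight_ge0//.
  by rewrite -[leRHS]mulr1 ler_wpM2l ?weight_ge0// cos_max.
rewrite /Rintegral integral_lebesgue_cons//.
pose z' : Rn R d := [tuple of behead z].
rewrite -[RHS]/(fine (_)%:E); congr fine.
transitivity (\int[leb]_a (tentn v z' * (fejer (v * a) * cos (coord z ord0 * a + phi)))%:E)%E.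
  apply: eq_integral => a _.
  have Iy : (lebn d).-integrable setT
      (fun y => (weight v y * cos (edot z' y + (coord z ord0 * a + phi)))%:E).
    apply: (@integrable_weight_mul _ _ _ 1) => //; first exact: measurable_cos_edot.
    by move=> x; exact: cos_max.
  transitivity (\int[lebn d]_y ((fejer (v * a))%:E *
      (weight v y * cos (edot z' y + (coord z ord0 * a + phi)))%:E))%E.
    apply: eq_integral => y _.
    by rewrite weight_cons edot_cons /= -mulrA EFinM (addrC (coord z ord0 * a)) addrA.
  by rewrite integralZl// integralRE// IH -EFinM; congr EFin; ring.
have Ia : leb.-integrable setT
    (fun a => (fejer (v * a) * cos (coord z ord0 * a + phi))%:E).
  apply: integrable_fejer_mul => //; first exact: measurable_cos_affine.
  by move=> a; exact: cos_max.
rewrite integralRE; last exact: integrableRZl.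
rewrite RintegralZl// integral_fejer_cos// /tentn big_ord_recl mulrCA mulrA.
congr (_ * _ * _)%:E; apply: eq_bigr => i _.
by rewrite /z' /coord tnth_behead; congr (tent _ (tnth _ _)); apply: val_inj; rewrite /= inordK// ltnS.
Qed.

End LebesgueRn.

(** * Decay of an oscillatory integral over an arc *)
Section Oscillation.
Context {R : realType}.
Notation leb := (@lebesgue_measure R).

(** A one-sided comparison by the mean value theorem, which asks nothing of the
    regularity of the majorant [f] beyond its primitive. *)
Lemma integral01_le_primitive (g F f : R -> R) : continuous g ->
  (forall x : R, 0 <= x <= 1 -> is_derive x 1 F (f x)) ->
  (forall x : R, 0 < x < 1 -> g x <= f x) ->
  \int[leb]_(x in `[0, 1]) g x <= F 1 - F 0.
Proof.
move=> cg dF gf.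
have Ig (u : R) : leb.-integrable `[0, u] (EFin \o g).
  apply: continuous_compact_integrable; first exact: segment_compact.
  exact: continuous_subspaceT.
pose G (x : R) := \int[leb]_(t in `[0, x]) g t.
have dG (x : R) : 0 < x < 1 -> is_derive x 1 G (g x).
  move=> /andP[x0 x1].
  have [dG1 dG2] := @continuous_FTC1_closed R g 0 x 1 x1 (Ig 1) x0 (cg x).
  by apply: DeriveDef; [exact: dG1|rewrite -derive1E; exact: dG2].
have cG : {within `[0, 1], continuous G}.
  exact: (parameterized_integral_continuous ler01 (Ig 1)).
have cF : {within `[0, 1], continuous F}.
  apply: derivable_within_continuous => x; rewrite in_itv/= => x01.
  by case: (dF x x01).
have dH (x : R) : x \in `]0, 1[ -> is_derive x 1 (fun y => F y - G y) (f x - g x).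
  rewrite in_itv/= => x01; apply: is_deriveB; last exact: dG.
  by apply: dF; case/andP: x01 => /ltW -> /ltW ->.
have cH : {within `[0, 1], continuous (fun y => F y - G y)}.
  by move=> x; apply: continuousB; [exact: cF|exact: cG].
have [c] := MVT ltr01 dH cH.
rewrite in_itv/= subr0 mulr1 => c01 e.
have G0 : G 0 = 0 by rewrite /G set_itv1 Rintegral_set1.
have -> : \int[leb]_(x in `[0, 1]) g x = G 1 by [].
have := gf c c01; move: e; rewrite G0; lra.
Qed.

Lemma cos_ge_half (x : R) : 0 <= x <= 1 -> 2^-1 <= cos x.
Proof.
move=> /andP[x0 x1]; apply: le_trans (cos_ge_onem x).
have : x ^+ 2 <= 1 by rewrite exprn_ile1.
lra.
Qed.

(** Integration by parts for cos (h + phi), where h'' = - h.  Write k = h'.  The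
    natural primitive sin (h + phi) / k breaks down where k vanishes, so 1 / k is
    regularised to q = k / (k^2 + r^2).  The derivative of S = sin (h + phi) q
    differs from cos (h + phi) by at most 2 r^2 / (k^2 + r^2): half of this is the
    loss in k q, half is q', because |h| <= r^2 when r^4 = a^2 + b^2.  As
    |q| <= 1 / (2 r), what is left is to bound the integral of
    rem = r^2 / (k^2 + r^2). *)
Section Phase.
Variables (a b phi r : R).
Hypotheses (r0 : 0 < r) (hr : r ^+ 4 = a ^+ 2 + b ^+ 2).

Let h x := a * sin x + b * cos x.
Let k x := a * cos x - b * sin x.
Let q x := k x / (k x ^+ 2 + r ^+ 2).
Let S x := sin (h x + phi) * q x.
Let rem x := r ^+ 2 / (k x ^+ 2 + r ^+ 2).

Let den_gt0 x : 0 < k x ^+ 2 + r ^+ 2.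
Proof. by rewrite ltr_wpDl ?sqr_ge0// exprn_gt0. Qed.

Let sqr_hk x : h x ^+ 2 + k x ^+ 2 = r ^+ 4.
Proof.
rewrite hr /h /k.
transitivity ((a ^+ 2 + b ^+ 2) * (cos x ^+ 2 + sin x ^+ 2)); first by ring.
by rewrite cos2Dsin2 mulr1.
Qed.

Let normr_h x : `|h x| <= r ^+ 2.
Proof.
rewrite -(@ler_pXn2r _ 2)// ?nnegrE ?exprn_ge0 ?(ltW r0)//.
rewrite real_normK ?num_real// -exprM; have := sqr_hk x; have := sqr_ge0 (k x); lra.
Qed.

Let normr_q x : `|q x| <= (2 * r)^-1.
Proof.
rewrite /q normrM normfV (gtr0_norm (den_gt0 x)) ler_pdivrMr// mulrC.
rewrite ler_pdivlMr ?mulr_gt0//.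
have <- : `|k x| ^+ 2 = k x ^+ 2 by rewrite real_normK ?num_real.
have := sqr_ge0 (`|k x| - r); rewrite sqrrB; lra.
Qed.

Let normr_S x : `|S x| <= (2 * r)^-1.
Proof.
rewrite /S normrM -[leRHS]mul1r ler_pM ?sin_max//.
Qed.

Let dk (x : R) : is_derive x 1 k (- h x).
Proof.
rewrite /k; apply: is_derive_eq.
rewrite /h /GRing.scale/=; ring.
Qed.

Let dh (x : R) : is_derive x 1 h (k x).
Proof.
rewrite /h; apply: is_derive_eq.
rewrite /k /GRing.scale/=; ring.
Qed.

Let dq (x : R) : is_derive x 1 q (- h x * (r ^+ 2 - k x ^+ 2) / (k x ^+ 2 + r ^+ 2) ^+ 2).
Proof.
pose den y := k y ^+ 2 + r ^+ 2.
have d0 : den x != 0 by rewrite lt0r_neq0 ?den_gt0.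
have dd : is_derive x 1 den (- 2 * k x * h x).
  apply: is_derive_eq.
  rewrite /h /GRing.scale/=; ring.
apply: (is_derive_eq (is_deriveM (dk x) (is_deriveV d0 dd))).
move: d0; rewrite /den /GRing.scale/= => d0; by field.
Qed.

Let dS (x : R) : is_derive x 1 S (cos (h x + phi) * (1 - rem x) +
  sin (h x + phi) * (- h x * (r ^+ 2 - k x ^+ 2) / (k x ^+ 2 + r ^+ 2) ^+ 2)).
Proof.
rewrite /S.
have d0 := lt0r_neq0 (den_gt0 x).
have d1 : is_derive x 1 (fun y => h y + phi) (k x).
  by apply: (is_derive_eq (is_deriveD (dh x) (is_derive_cst _ _ _))); rewrite addr0.
have d2 := @is_derive1_comp R sin (fun y => h y + phi) x _ _ (is_derive_sin _) d1.
apply: (is_derive_eq (is_deriveM d2 (dq x))).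
rewrite /GRing.scale/= /q /rem; by field.
Qed.

Let rem_ge0 x : 0 <= rem x.
Proof. by rewrite divr_ge0 ?exprn_ge0 ?(ltW r0)// ltW. Qed.

Let phase_le x : `|cos (h x + phi) - (cos (h x + phi) * (1 - rem x) +
  sin (h x + phi) * (- h x * (r ^+ 2 - k x ^+ 2) / (k x ^+ 2 + r ^+ 2) ^+ 2))|
  <= 2 * rem x.
Proof.
set c := cos _; set s := sin _; set e := (X in s * X).
have -> : c - (c * (1 - rem x) + s * e) = c * rem x - s * e by ring.
have eb : `|e| <= rem x.
  rewrite /e normrM normfV [`|_ ^+ 2|]gtr0_norm ?exprn_gt0//.
  rewrite ler_pdivrMr ?exprn_gt0// expr2 mulrA /rem divfK ?(lt0r_neq0 (den_gt0 x))//.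
  rewrite normrM normrN ler_pM//.
  have := sqr_ge0 (k x); have := sqr_ge0 r; rewrite ler_norml; lra.
apply: (le_trans (ler_normB _ _)).
rewrite [`|c * _|]normrM [`|s * e|]normrM (ger0_norm (rem_ge0 x)).
have : `|c| * rem x <= rem x by rewrite -[leRHS]mul1r ler_wpM2r// cos_max.
have : `|s| * `|e| <= rem x by rewrite -[leRHS]mul1r ler_pM// sin_max.
lra.
Qed.

Let g x := cos (h x + phi).

Let cg : continuous g.
Proof.
move=> x; apply: differentiable_continuous; apply/derivable1_diffP.
rewrite /g.
have d1 : is_derive x 1 (fun y => h y + phi) (k x).
  by apply: (is_derive_eq (is_deriveD (dh x) (is_derive_cst _ _ _))); rewrite addr0.
have := @is_derive1_comp R cos (fun y => h y + phi) x _ _ (is_derive_cos _) d1.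
by case.
Qed.

(** The remainder is controlled through any majorant [u] that has an explicit
    primitive [U]. *)
Lemma osc_of_primitive (U u : R -> R) (B : R) :
  (forall x : R, 0 <= x <= 1 -> is_derive x 1 U (u x)) ->
  (forall x : R, 0 <= x <= 1 -> rem x <= u x) ->
  U 1 - U 0 <= B ->
  `|\int[leb]_(x in `[0, 1]) cos (a * sin x + b * cos x + phi)| <= r^-1 + 2 * B.
Proof.
move=> dU ru UB.
have Sb : `|S 1 - S 0| <= r^-1.
  apply: (le_trans (ler_normB _ _)).
  have -> : r^-1 = (2 * r)^-1 + (2 * r)^-1 by field; rewrite lt0r_neq0.
  by rewrite lerD.
rewrite ler_norml; apply/andP; split.
  rewrite lerNl.
  have -> : - (\int[leb]_(x in `[0, 1]) cos (a * sin x + b * cos x + phi)) =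
      \int[leb]_(x in `[0, 1]) (- g x).
    have -> : (fun x => - g x) = (fun x => - 1 * g x) by apply/funext => x; rewrite mulN1r.
    rewrite RintegralZl ?mulN1r//.
    apply: continuous_compact_integrable; first exact: segment_compact.
    exact: continuous_subspaceT.
  have := @integral01_le_primitive (fun x => - g x) (fun x => 2 * U x - S x)
    (fun x => 2 * u x - (cos (h x + phi) * (1 - rem x) +
  sin (h x + phi) * (- h x * (r ^+ 2 - k x ^+ 2) / (k x ^+ 2 + r ^+ 2) ^+ 2))).
  move=> /(_ _ _ _)/le_trans; apply.
  - by move=> x; apply: continuousN; exact: cg.
  - move=> x x01; have := dU x x01 => dUx; have := dS x => dSx.
    by apply: is_derive_eq.
  - move=> x /andP[x0 x1]; have x01 : 0 <= x <= 1 by rewrite !ltW.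
    have := ru x x01; have := phase_le x; rewrite ler_norml /g => /andP[]; lra.
  move: Sb; rewrite ler_norml => /andP[]; lra.
have := @integral01_le_primitive g (fun x => 2 * U x + S x)
    (fun x => 2 * u x + (cos (h x + phi) * (1 - rem x) +
  sin (h x + phi) * (- h x * (r ^+ 2 - k x ^+ 2) / (k x ^+ 2 + r ^+ 2) ^+ 2))).
move=> /(_ _ _ _)/le_trans; apply.
- exact: cg.
- move=> x x01; have := dU x x01 => dUx; have := dS x => dSx.
  by apply: is_derive_eq.
- move=> x /andP[x0 x1]; have x01 : 0 <= x <= 1 by rewrite !ltW.
  have := ru x x01; have := phase_le x; rewrite ler_norml /g => /andP[]; lra.
move: Sb; rewrite ler_norml => /andP[]; lra.
Qed.

End Phase.

Lemma normr_cos_phase_le1 (a b phi : R) :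
  `|\int[leb]_(x in `[0, 1]) cos (a * sin x + b * cos x + phi)| <= 1.
Proof.
have Ic : leb.-integrable `[0, 1] (fun x => (cos (a * sin x + b * cos x + phi))%:E).
  apply: continuous_compact_integrable; first exact: segment_compact.
  apply: continuous_subspaceT => x.
  apply: continuous_comp; last exact: continuous_cos.
  apply: cvgD; last exact: cvg_cst.
  by apply: cvgD; apply: cvgM => //; (try exact: cvg_cst); [exact: continuous_sin|exact: continuous_cos].
apply: (le_trans (le_normr_Rintegral _ Ic)) => //.
apply: (@le_trans _ _ (\int[leb]_(x in `[0, 1]) (cst 1 x))).
  apply: le_Rintegral => //; first exact: integrable_norm.
    apply: continuous_compact_integrable; first exact: segment_compact.
    by apply: continuous_subspaceT => x; exact: cvg_cst.
  by move=> x _; exact: cos_max.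
have h01 : leb `[0%R, 1%R]%classic = 1%E.
  by rewrite lebesgue_measure_itv/= lte_fin ltr01 sube0.
by rewrite Rintegral_cst// mul1r [X in fine X](_ : _ = 1%E).
Qed.

(** The phase is r^2 cos (x - x0), whose second derivative is of order r^2 where
    its first one vanishes: hence the decay 1 / r. *)
Lemma normr_cos_phase_le (a b phi r : R) : 0 < r -> r ^+ 4 = a ^+ 2 + b ^+ 2 ->
  r * `|\int[leb]_(x in `[0, 1]) cos (a * sin x + b * cos x + phi)| <= 51.
Proof.
move=> r0 hr; have [r1|r1] := leP r 1.
  apply: (@le_trans _ _ (1 * 1)); last by lra.
  by rewrite ler_pM ?(ltW r0)// normr_cos_phase_le1.
rewrite mulrC -ler_pdivlMr//.
(* The remainder will be shown to have integral at most 25 / r. *)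
have -> : 51 / r = r^-1 + 2 * (25 / r) by field; rewrite lt0r_neq0.
have r20 : 0 < r ^+ 2 by rewrite exprn_gt0.
have r4 : r ^+ 4 = (r ^+ 2) ^+ 2 by rewrite -exprM.
have [b4|b4] := leP (r ^+ 2 / 4) `|b|.
  (* Here k = cos x (a - b tan x), so r^2 / (k^2 + r^2 cos x ^ 2), which is larger
     than the remainder, is a multiple of the derivative of an arctangent. *)
  have b0 : b != 0 by rewrite -normr_gt0 (lt_le_trans _ b4)// divr_gt0.
  pose u x := (a - b * tan x) / r.
  pose U x := - (r / b) * atan (u x).
  pose k x := a * cos x - b * sin x.
  have cosx_gt0 (x : R) : 0 <= x <= 1 -> 0 < cos x.
    by move=> x01; apply: (lt_le_trans _ (cos_ge_half x01)).
  have du (x : R) : 0 <= x <= 1 -> is_derive x 1 u (- (b / r) * (cos x) ^- 2).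
    move=> x01; have dt := is_derive_tan (lt0r_neq0 (cosx_gt0 _ x01)).
    rewrite /u; apply: is_derive_eq; rewrite /GRing.scale/=; ring.
  apply: (@osc_of_primitive a b phi r r0 hr U
    (fun x => r / b * (1 + u x ^+ 2)^-1 * ((b / r) * (cos x) ^- 2))).
  - move=> x x01; have dux := du x x01.
    have dat := @is_derive1_comp R atan u x _ _ (is_derive1_atan _) dux.
    have dU : is_derive x 1 U (- (r / b) *: ((1 + u x ^+ 2)^-1 * (- (b / r) * (cos x) ^- 2))).
      exact: is_deriveZ.
    by apply: (is_derive_eq dU); rewrite /GRing.scale/=; ring.
  - move=> x x01; have c0 := cosx_gt0 x x01.
    have c1 : cos x ^+ 2 <= 1 by rewrite exprn_ile1 ?cos_le1// ltW.
    have uE : u x = k x / (r * cos x).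
      by rewrite /u /k /tan; field; rewrite !lt0r_neq0.
    have c20 : 0 < cos x ^+ 2 by rewrite exprn_gt0.
    have d0 : 0 < cos x ^+ 2 * r ^+ 2 + k x ^+ 2.
      by rewrite ltr_pwDl ?sqr_ge0// mulr_gt0.
    have -> : r / b * (1 + u x ^+ 2)^-1 * (b / r * cos x ^- 2) =
        r ^+ 2 / (cos x ^+ 2 * r ^+ 2 + k x ^+ 2).
      rewrite uE; field.
      rewrite b0 (lt0r_neq0 c0) (lt0r_neq0 r0) exprMn (lt0r_neq0 d0).
      by [].
    rewrite ler_pM2l//; rewrite lef_pV2 ?posrE//; last first.
      by rewrite ltr_wpDl ?sqr_ge0.
    by rewrite -/(k x) [leRHS]addrC lerD2r -[leRHS]mul1r ler_wpM2r// ltW.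
  rewrite /U -mulrBr mulNr -mulrN opprB.
  apply: (le_trans (ler_norm _)); rewrite normrM normrM normfV (gtr0_norm r0).
  have : `|atan (u 0) - atan (u 1)| <= 4.
    have := atan_gtNpi2 (u 0); have := atan_gtNpi2 (u 1).
    have := atan_ltpi2 (u 0); have := atan_ltpi2 (u 1).
    have := @pihalf_lt2 R; rewrite ler_norml; lra.
  have rb : r / `|b| <= 4 / r.
    rewrite ler_pdivrMr ?normr_gt0// mulrAC ler_pdivlMr//; lra.
  move=> h4; apply: (@le_trans _ _ (4 / r * 4)).
    by rewrite ler_pM// divr_ge0// ltW.
  by rewrite mulrAC ler_pM2r ?invr_gt0//; lra.
(* Here |a| dominates, and cos x >= 1/2 keeps k away from 0. *)
pose k x := a * cos x - b * sin x.
apply: (@osc_of_primitive a b phi r r0 hr (fun x => 25 / r * x) (fun x => 25 / r)).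
- move=> x _; apply: is_derive_eq; rewrite /GRing.scale/=; ring.
- move=> x x01; rewrite -/(k x).
  have d0 : 0 < k x ^+ 2 + r ^+ 2 by rewrite ltr_wpDl ?sqr_ge0.
  rewrite ler_pdivrMr// mulrAC ler_pdivlMr//.
  have a9 : 9 / 10 * r ^+ 2 <= `|a|.
    have p9 : 0 <= 9 / 10 * r ^+ 2 by lra.
    rewrite -(@ler_pXn2r _ 2) ?nnegrE//.
    have : `|b| ^+ 2 <= (r ^+ 2 / 4) ^+ 2 by rewrite lerXn2r ?nnegrE ?divr_ge0 ?(ltW r20)// ltW.
    have -> : (9 / 10 * r ^+ 2) ^+ 2 = 81 / 100 * r ^+ 4 by field.
    have -> : (r ^+ 2 / 4) ^+ 2 = r ^+ 4 / 16 by field.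
    have r40 : 0 <= r ^+ 4 by rewrite exprn_ge0// ltW.
    by rewrite !real_normK ?num_real//; lra.
  have kl : r ^+ 2 / 5 <= `|k x|.
    have : `|a * cos x| - `|b * sin x| <= `|k x| by exact: lerB_dist.
    rewrite !normrM.
    have : `|b| * `|sin x| <= `|b| by rewrite -[leRHS]mulr1 ler_wpM2l// sin_max.
    have ch := cos_ge_half x01.
    have : `|a| * 2^-1 <= `|a| * `|cos x| by rewrite ler_wpM2l// (le_trans ch)// ler_norm.
    lra.
  have : (r ^+ 2 / 5) ^+ 2 <= k x ^+ 2.
    by rewrite -[leRHS]real_normK ?num_real// lerXn2r ?nnegrE ?divr_ge0 ?(ltW r20).
  have : r ^+ 3 <= r ^+ 4 by rewrite ler_eXn2l.
  have -> : r ^+ 2 * r = r ^+ 3 by rewrite -exprSr.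
  have -> : (r ^+ 2 / 5) ^+ 2 = r ^+ 4 / 25 by field.
  have := ltW r20; lra.
- by rewrite mulr1 mulr0 subr0.
Qed.

End Oscillation.

(** * A measure on the sphere with decaying transform *)
Section SphereMeasure.
Context {R : realType}.
Notation leb := (@lebesgue_measure R).

(** Clamping the angle makes the points of the sphere below well defined, with
    cosine at least 1/2, for every real parameter and not only almost surely. *)
Definition clamp (u : R) : R := Num.max 0 (Num.min u 1).

Lemma clamp_itv u : 0 <= clamp u <= 1.
Proof. by rewrite /clamp le_max lexx/= ge_max ler01/= ge_min lexx orbT. Qed.

Lemma clamp_id u : 0 <= u <= 1 -> clamp u = u.
Proof.
by move=> /andP[u0 u1]; rewrite /clamp (min_idPl u1) (max_idPr u0).
Qed.

Lemma measurable_clamp : measurable_fun setT clamp.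
Proof. by apply: measurable_maxr => //; exact: measurable_minr. Qed.

Definition unif01 : probability (measurableTypeR R) R := uniform_prob (@ltr01 R).

Lemma Rintegral_unif01 (g : R -> R) : measurable_fun setT g -> (forall x, `|g x| <= 1) ->
  \int[unif01]_u g (clamp u) = \int[leb]_(x in `[0, 1]) g x.
Proof.
move=> mg g1.
have mgc : measurable_fun setT (fun u => g (clamp u)).
  exact: (measurableT_comp mg measurable_clamp).
have UT : (unif01 setT < +oo)%E by rewrite probability_setT ltry.
have L1 : (leb `[0%R, 1%R]%classic = 1)%E.
  by rewrite lebesgue_measure_itv/= lte_fin ltr01 sube0.
have Iu : unif01.-integrable setT (fun u => (g (clamp u))%:E).
  exact: (integrableR_bounded UT mgc (fun u => g1 (clamp u))).
have Ig : leb.-integrable `[0, 1] (fun u => (g u)%:E).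
  apply: measurable_bounded_integrable => //.
  - by rewrite [ltLHS](_ : _ = 1%E) ?ltry.
  - exact: measurable_funTS.
  - exists 1; split; first exact: num_real.
    by move=> N MN x _; exact: (le_trans (g1 x) (ltW MN)).
have I1 : leb.-integrable `[0, 1] (fun u : R => (1 : R)%:E).
  apply: measurable_bounded_integrable => //.
  - by rewrite [ltLHS](_ : _ = 1%E) ?ltry.
  - exists 1; split; first exact: num_real.
    by move=> N MN x _; rewrite normr1 ltW.
have I1u : unif01.-integrable setT (fun u => (1 : R)%:E).
  by apply: (@integrableR_bounded _ _ _ _ _ 1) => // x; rewrite normr1.
have e1 : \int[unif01]_u (1 + g (clamp u)) = 1 + \int[unif01]_u g (clamp u).
  rewrite RintegralD// Rintegral_cst// mul1r; congr (_ + _).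
  by rewrite [X in fine X](_ : _ = 1%E)//; exact: probability_setT.
have e2 : \int[leb]_(x in `[0, 1]) (1 + g x) = 1 + \int[leb]_(x in `[0, 1]) g x.
  rewrite RintegralD// Rintegral_cst// mul1r; congr (_ + _).
  by rewrite [X in fine X](_ : _ = 1%E).
suff : \int[unif01]_u (1 + g (clamp u)) = \int[leb]_(x in `[0, 1]) (1 + g x).
  by rewrite e1 e2 => /addrI.
rewrite /Rintegral /unif01 integral_uniform.
- rewrite subr0 invr1 mul1e; congr fine; apply: eq_integral => x.
  by rewrite inE/= in_itv/= => x01; rewrite clamp_id.
- by apply/measurable_EFinP; apply: measurable_funD.
- by move=> x; rewrite lee_fin; have := g1 (clamp x); rewrite ler_norml; lra.
Qed.

(** The point (sin theta, cos theta w) of the sphere of one more dimension.  The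
    angle is kept in [0, 1], where the cosine is bounded below, at the price of
    reaching only a part of that sphere. *)
Definition arc_join d d0 (Om : measurableType d0) (w : Om -> Rn R d)
  (p : measurableTypeR R * Om) : Rn R d.+1 :=
  tuple_cons (sin (clamp p.1), [tuple cos (clamp p.1) * coord (w p.2) i | i < d]).

Lemma coord_mktuple d (F : 'I_d -> R) i : coord ([tuple F i | i < d] : Rn R d) i = F i.
Proof. by rewrite /coord tnth_mktuple. Qed.

Lemma measurable_arc_join d d0 (Om : measurableType d0) (w : Om -> Rn R d) :
  measurable_fun setT w -> measurable_fun setT (arc_join w).
Proof.
move=> mw.
have mc : measurable_fun setT (fun p : measurableTypeR R * Om => clamp p.1).
  exact: (measurableT_comp measurable_clamp measurable_fst).
apply: measurable_cons.
  exact: (measurableT_comp (continuous_measurable_fun (@continuous_sin R)) mc).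
apply/measurable_fun_tnthP => i.
rewrite (_ : _ \o _ = fun p : measurableTypeR R * Om => cos (clamp p.1) * coord (w p.2) i).
  apply: measurable_funM.
    exact: (measurableT_comp (continuous_measurable_fun (@continuous_cos R)) mc).
  exact: (measurableT_comp (measurable_coord i) (measurableT_comp mw measurable_snd)).
by apply/funext => p; rewrite /= tnth_mktuple.
Qed.

Lemma edotC d (x y : Rn R d) : edot x y = edot y x.
Proof. by apply: eq_bigr => i _; rewrite mulrC. Qed.

Lemma edot_arc_join d d0 (Om : measurableType d0) (w : Om -> Rn R d) (xi : Rn R d.+1) p :
  edot xi (arc_join w p) = coord xi ord0 * sin (clamp p.1) +
    edot [tuple of behead xi] (w p.2) * cos (clamp p.1).
Proof.
rewrite /arc_join edot_cons/=; congr (_ + _).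
rewrite /edot mulr_suml; apply: eq_bigr => i _.
by rewrite coord_mktuple mulrCA mulrC.
Qed.

Lemma arc_join_unit d d0 (Om : measurableType d0) (w : Om -> Rn R d) p :
  (forall q, edot (w q) (w q) = 1) -> edot (arc_join w p) (arc_join w p) = 1.
Proof.
move=> w1; rewrite /edot big_ord_recl coord_cons0 /=.
rewrite -(cos2Dsin2 (clamp p.1)) addrC expr2; congr (_ + _).
under eq_bigr do rewrite coord_consS coord_mktuple mulrACA.
by rewrite -mulr_sumr -/(edot _ _) w1 mulr1.
Qed.

Lemma edot_ge0 d (x : Rn R d) : 0 <= edot x x.
Proof. by apply: sumr_ge0 => i _; rewrite -expr2 sqr_ge0. Qed.

Lemma sqr_enorm d (x : Rn R d) : enorm x ^+ 2 = edot x x.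
Proof. by rewrite sqr_sqrtr ?edot_ge0. Qed.

Lemma enorm_ge0 d (x : Rn R d) : 0 <= enorm x.
Proof. exact: sqrtr_ge0. Qed.

(** By Lagrange's identity. *)
Lemma cauchy_schwarz d (x y : Rn R d) : edot x y ^+ 2 <= edot x x * edot y y.
Proof.
have : 0 <= \sum_(i < d) \sum_(j < d) (coord x i * coord y j - coord x j * coord y i) ^+ 2.
  by apply: sumr_ge0 => i _; apply: sumr_ge0 => j _; exact: sqr_ge0.
have -> : \sum_(i < d) \sum_(j < d) (coord x i * coord y j - coord x j * coord y i) ^+ 2
   = 2 * (edot x x * edot y y - edot x y ^+ 2).
  transitivity (\sum_(i < d) \sum_(j < d) ((coord x i * coord x i) * (coord y j * coord y j)
     + (coord y i * coord y i) * (coord x j * coord x j)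
     - 2 * ((coord x i * coord y i) * (coord x j * coord y j)))).
    by apply: eq_bigr => i _; apply: eq_bigr => j _; ring.
  rewrite /edot.
  under eq_bigr do rewrite sumrB big_split/= -!mulr_sumr.
  rewrite sumrB big_split/= -!mulr_suml -mulr_sumr -mulr_suml; ring.
lra.
Qed.

Lemma normr_edot_le d (x y : Rn R d) : edot x x = 1 -> `|edot x y| <= enorm y.
Proof.
move=> x1; rewrite -(@ler_pXn2r _ 2) ?nnegrE ?enorm_ge0// real_normK ?num_real//.
by rewrite sqr_enorm (le_trans (cauchy_schwarz x y))// x1 mul1r.
Qed.

Section ArcJoinDecay.
Context d d0 (Om : measurableType d0) (P : probability Om R) (w : Om -> Rn R d).
Hypotheses (mw : measurable_fun setT w).

Let phase (xi : Rn R d.+1) phi p := cos (edot xi (arc_join w p) + phi).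

Let mphase xi phi : measurable_fun setT (phase xi phi).
Proof. exact: (measurableT_comp (measurable_cos_edot xi phi) (measurable_arc_join mw)). Qed.

Let phase1 xi phi p : `|phase xi phi p| <= 1. Proof. exact: cos_max. Qed.

Let I1 (P' : probability (measurableTypeR R) R) : P'.-integrable setT (fun _ => (1 : R)%:E).
Proof. exact: finite_measure_integrable_cst. Qed.

(** For a fixed point of the smaller sphere, the angle alone produces the
    oscillation. *)
Lemma arc_join_decay_arc (xi : Rn R d.+1) (phi m : R) : 0 < m ->
  (forall q, m ^+ 4 <= coord xi ord0 ^+ 2 + edot [tuple of behead xi] (w q) ^+ 2) ->
  m * `|\int[(unif01 \x P)%E]_p cos (edot xi (arc_join w p) + phi)| <= 51.
Proof.
move=> m0 hm; rewrite (Rfubini2 P (mphase xi phi) (I1 _) (fun u q => phase1 xi phi (u, q))).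
rewrite mulrC -ler_pdivlMr//.
apply: Rintegral_le_bound.
  exact: (measurable_Rintegral2 P (mphase xi phi) (I1 _) (fun u q => phase1 xi phi (u, q))).
move=> q; rewrite ler_pdivlMr// mulrC.
pose a := coord xi ord0; pose b := edot [tuple of behead xi] (w q).
have -> : \int[unif01]_u phase xi phi (u, q) =
    \int[leb]_(x in `[0, 1]) cos (a * sin x + b * cos x + phi).
  rewrite -(@Rintegral_unif01 (fun x => cos (a * sin x + b * cos x + phi))).
  - by apply: eq_Rintegral => u _; rewrite /phase edot_arc_join.
  - apply: (measurableT_comp (continuous_measurable_fun (@continuous_cos R))).
    apply: measurable_funD => //; apply: measurable_funD; apply: measurable_funM => //.
      exact: (continuous_measurable_fun (@continuous_sin R)).
    exact: (continuous_measurable_fun (@continuous_cos R)).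
  - by move=> x; exact: cos_max.
have s0 : 0 < a ^+ 2 + b ^+ 2 by apply: (lt_le_trans _ (hm q)); rewrite exprn_gt0.
pose r := Num.sqrt (Num.sqrt (a ^+ 2 + b ^+ 2)).
have r0 : 0 < r by rewrite !sqrtr_gt0.
have r4 : r ^+ 4 = a ^+ 2 + b ^+ 2.
  by rewrite (exprM r 2 2) sqr_sqrtr ?sqrtr_ge0// sqr_sqrtr// ltW.
apply: (le_trans _ (normr_cos_phase_le phi r0 r4)).
rewrite ler_wpM2r// -(@ler_pXn2r _ 4) ?nnegrE ?(ltW m0) ?(ltW r0)//.
by rewrite r4 hm.
Qed.

(** For a fixed angle, the first coordinate only contributes a phase, and the
    decay is that of the smaller sphere at a frequency shrunk by a cosine that is
    at least 1/2. *)
Lemma arc_join_decay_factor (xi : Rn R d.+1) (phi m C : R) : 0 < m ->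
  (forall z psi, Num.sqrt (enorm z) * `|\int[P]_q cos (edot z (w q) + psi)| <= C) ->
  m ^+ 2 <= enorm ([tuple of behead xi] : Rn R d) / 2 ->
  m * `|\int[(unif01 \x P)%E]_p cos (edot xi (arc_join w p) + phi)| <= C.
Proof.
move=> m0 hC hm; rewrite (Rfubini1 P (mphase xi phi) (I1 _) (fun u q => phase1 xi phi (u, q))).
rewrite mulrC -ler_pdivlMr//.
apply: Rintegral_le_bound.
  exact: (measurable_Rintegral_param P (mphase xi phi) (phase1 xi phi)).
move=> u; rewrite ler_pdivlMr// mulrC.
pose x' : Rn R d := [tuple of behead xi].
pose z : Rn R d := [tuple cos (clamp u) * coord x' i | i < d].
have -> : \int[P]_q phase xi phi (u, q) =
    \int[P]_q cos (edot z (w q) + (coord xi ord0 * sin (clamp u) + phi)).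
  apply: eq_Rintegral => q _; rewrite /phase edot_arc_join /=.
  have -> : edot z (w q) = edot x' (w q) * cos (clamp u).
    rewrite /edot mulr_suml; apply: eq_bigr => i _.
    by rewrite coord_mktuple; ring.
  by congr cos; rewrite /x'; ring.
apply: (le_trans _ (hC z (coord xi ord0 * sin (clamp u) + phi))); rewrite ler_wpM2r//.
have c0 := cos_ge_half (clamp_itv u).
have ez : enorm z = cos (clamp u) * enorm x'.
  rewrite /enorm (_ : edot z z = cos (clamp u) ^+ 2 * edot x' x').
    rewrite sqrtrM ?sqr_ge0// sqrtr_sqr ger0_norm//; lra.
  by rewrite /edot mulr_sumr; apply: eq_bigr => i _; rewrite coord_mktuple; ring.
rewrite -(@ler_pXn2r _ 2) ?nnegrE ?(ltW m0) ?sqrtr_ge0//.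
rewrite sqr_sqrtr ?enorm_ge0// ez (le_trans hm)// mulrC ler_wpM2r ?enorm_ge0//.
Qed.

End ArcJoinDecay.

Lemma edot_behead d (xi : Rn R d.+1) :
  edot xi xi = coord xi ord0 ^+ 2 +
    edot ([tuple of behead xi] : Rn R d) [tuple of behead xi].
Proof.
rewrite {1}/edot big_ord_recl expr2; congr (_ + _); apply: eq_bigr => i _.
rewrite /coord tnth_behead.
by have -> : inord i.+1 = lift ord0 i by apply: val_inj; rewrite /= inordK// ltnS.
Qed.

(** By induction on the dimension.  If the first coordinate of xi carries half of
    its squared norm, the angle of the join oscillates; otherwise the decay is
    inherited from the smaller sphere.  The exponent 1/2 is that of the circle
    and does not improve with the dimension.  The uniformity in phi covers cosine
    and sine transforms together. *)
Lemma sphere_measure_decay d : (2 <= d)%N ->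
  exists (dd : measure_display) (Om : measurableType dd) (P : probability Om R)
    (w : Om -> Rn R d) (C : R),
  [/\ measurable_fun setT w, (forall p, edot (w p) (w p) = 1) &
    forall xi phi,
      Num.sqrt (enorm xi) * `|\int[P]_p cos (edot xi (w p) + phi)| <= C].
Proof.
case: d => // -[//|d] _.
have sqrt4 (x : R) : 0 <= x -> Num.sqrt x ^+ 4 = x ^+ 2.
  by move=> x0; rewrite (exprM _ 2 2) sqr_sqrtr.
elim: d => [|d [dd [Om [P [w [C [mw w1 hC]]]]]]].
  (* An arc of the circle is the join of one point of the 0-sphere with an arc. *)
  pose w0 : measurableTypeR R -> Rn R 1 := cst [tuple 1].
  have mw0 : measurable_fun setT w0 by exact: measurable_cst.
  exists _, _, (unif01 \x unif01)%E, (arc_join w0), 51; split.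
  - exact: measurable_arc_join.
  - move=> p; apply: arc_join_unit => q.
    by rewrite /edot big_ord1 /coord /w0 /= mulr1.
  - move=> xi phi.
    have [e0|e0] := eqVneq (enorm xi) 0; first by rewrite e0 sqrtr0 mul0r.
    have e1 : 0 < enorm xi by rewrite lt_neqAle eq_sym e0 enorm_ge0.
    apply: arc_join_decay_arc => //; first by rewrite sqrtr_gt0.
    move=> q; rewrite sqrt4 ?enorm_ge0// sqr_enorm edot_behead lerD2l.
    by rewrite /edot !big_ord1 /w0 {3}/coord /= mulr1 expr2.
exists _, _, (unif01 \x P)%E, (arc_join w), (102 + 2 * C); split.
- exact: measurable_arc_join.
- by move=> p; exact: arc_join_unit.
move=> xi phi.
have C0 : 0 <= C.
  by apply: (le_trans _ (hC [tuple 0 | i < _] 0)); rewrite mulr_ge0 ?sqrtr_ge0.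
have [e0|e0] := eqVneq (enorm xi) 0.
  by rewrite e0 sqrtr0 mul0r; lra.
have e1 : 0 < enorm xi by rewrite lt_neqAle eq_sym e0 enorm_ge0.
set I := `|_|.
pose m := Num.sqrt (enorm xi) / 2.
have m0 : 0 < m by rewrite divr_gt0// sqrtr_gt0.
have hm : Num.sqrt (enorm xi) = 2 * m by rewrite /m; field.
rewrite hm -mulrA.
pose x' : Rn R d.+2 := [tuple of behead xi].
have E : enorm xi ^+ 2 = coord xi ord0 ^+ 2 + enorm x' ^+ 2.
  by rewrite !sqr_enorm edot_behead.
have I0 : 0 <= I by exact: normr_ge0.
have [h|h] := leP (enorm x' ^+ 2) (coord xi ord0 ^+ 2).
  have : m * I <= 51.
    apply: arc_join_decay_arc => // q.
    have -> : m ^+ 4 = enorm xi ^+ 2 / 16 by rewrite -sqrt4 ?enorm_ge0// /m; field.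
    have := sqr_ge0 (edot [tuple of behead xi] (w q)).
    have := sqr_ge0 (coord xi ord0); rewrite E; lra.
  lra.
have : m * I <= C.
  apply: arc_join_decay_factor => //.
  have -> : m ^+ 2 = enorm xi / 4 by rewrite /m expr_div_n sqr_sqrtr ?enorm_ge0//; field.
  suff : enorm xi <= 2 * enorm x' by rewrite -/x'; lra.
  rewrite -(@ler_pXn2r _ 2) ?nnegrE ?mulr_ge0 ?enorm_ge0// exprMn E.
  have := sqr_ge0 (enorm x'); lra.
lra.
Qed.

End SphereMeasure.

(** * Fourier side and space side of the smoothed configuration count *)
Section KernelFubini.
Context {R : realType} {d : nat}.
Notation lebn := (@lebesgue_measure_Rn R d).

Lemma measurable_edot dT (T : measurableType dT) (y z : T -> Rn R d) :
  measurable_fun setT y -> measurable_fun setT z ->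
  measurable_fun setT (fun p => edot (y p) (z p)).
Proof.
move=> my mz; apply: measurable_sum => i; apply: measurable_funM.
  exact: (measurableT_comp (measurable_coord i) my).
exact: (measurableT_comp (measurable_coord i) mz).
Qed.

Lemma measurable_cosT dT (T : measurableType dT) (h : T -> R) :
  measurable_fun setT h -> measurable_fun setT (fun p => cos (h p)).
Proof. exact: (measurableT_comp (continuous_measurable_fun (@continuous_cos R))). Qed.

Lemma measurable_sinT dT (T : measurableType dT) (h : T -> R) :
  measurable_fun setT h -> measurable_fun setT (fun p => sin (h p)).
Proof. exact: (measurableT_comp (continuous_measurable_fun (@continuous_sin R))). Qed.

(** The integrand is dominated by the weight, which is integrable; without the
    weight the integrals could not be exchanged. *)
Lemma kernel_fubini dZ (Z : measurableType dZ) (rho : probability Z R)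
  (z : Z -> Rn R d) (F : Z -> R) (v : R) : 0 < v ->
  measurable_fun setT z -> measurable_fun setT F -> (forall x, `|F x| <= 1) ->
  \int[lebn]_xi (weight v xi * \int[rho]_x (F x * cos (edot (z x) xi))) =
  \int[rho]_x (F x * tentn v (z x)).
Proof.
move=> v0 mz mF F1.
pose f (p : Rn R d * Z) := weight v p.1 * (F p.2 * cos (edot (z p.2) p.1)).
have mz2 : measurable_fun setT (fun p : Rn R d * Z => z p.2).
  exact: (measurableT_comp mz measurable_snd).
have mf : measurable_fun setT f.
  apply: measurable_funM.
    exact: (measurableT_comp (@measurable_weight R d v) measurable_fst).
  apply: measurable_funM; first exact: (measurableT_comp mF measurable_snd).
  by apply: measurable_cosT; apply: measurable_edot => //; exact: measurable_fst.
have fW xi x : `|f (xi, x)| <= weight v xi.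
  rewrite /f /= normrM ger0_norm ?weight_ge0// -[leRHS]mulr1 ler_wpM2l ?weight_ge0//.
  by rewrite normrM -[leRHS]mulr1 ler_pM// cos_max.
have IW := @integrable_weight R d v v0.
transitivity (\int[lebn]_xi \int[rho]_x f (xi, x)).
  apply: eq_Rintegral => xi _; rewrite /f /= RintegralZl//.
  apply: (@integrableR_bounded _ _ _ _ _ 1) => //; first exact: probability_lty.
    apply: measurable_funM => //; apply: measurable_cosT; apply: measurable_edot => //.
  by move=> x; rewrite normrM -[leRHS]mulr1 ler_pM// cos_max.
rewrite (Rfubini rho mf IW fW).
apply: eq_Rintegral => x _; rewrite /f /=.
transitivity (\int[lebn]_xi (F x * (weight v xi * cos (edot (z x) xi + 0)))).
  by apply: eq_Rintegral => xi _; rewrite addr0 mulrCA.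
rewrite RintegralZl//; first by rewrite integral_weight_cos// cos0 mulr1.
apply: (@integrable_weight_mul _ _ _ _ 1) => //; first exact: measurable_cos_edot.
by move=> xi; exact: cos_max.
Qed.

End KernelFubini.

Section Characters.
Context {R : realType} {d : nat}.
Variable mu : probability (Rn R d) R.
Context dO (Om : measurableType dO) (P : probability Om R) (w : Om -> Rn R d).
Hypothesis mw : measurable_fun setT w.
Notation lebn := (@lebesgue_measure_Rn R d).

(** The transform of the measure f mu is [cosint f] - i [sinint f], and
    [energy_density f] is the square of its modulus. *)
Definition cosint (f : Rn R d -> R) (xi : Rn R d) : R :=
  \int[mu]_x (f x * cos (edot x xi)).

Definition sinint (f : Rn R d -> R) (xi : Rn R d) : R :=
  \int[mu]_x (f x * sin (edot x xi)).

Definition energy_density f xi : R := cosint f xi ^+ 2 + sinint f xi ^+ 2.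

Definition sphere_cos (t : R) (xi : Rn R d) : R := \int[P]_p cos (t * edot xi (w p)).
Definition sphere_sin (t : R) (xi : Rn R d) : R := \int[P]_p sin (t * edot xi (w p)).

Definition displacement (t : R) (p : (Rn R d * Rn R d) * Om) : Rn R d :=
  [tuple coord p.1.1 i - coord p.1.2 i - t * coord (w p.2) i | i < d].

Lemma measurable_displacement t : measurable_fun setT (displacement t).
Proof.
apply/measurable_fun_tnthP => i.
rewrite (_ : _ \o _ = fun p : (Rn R d * Rn R d) * Om =>
  coord p.1.1 i - coord p.1.2 i - t * coord (w p.2) i); last first.
  by apply/funext => p; rewrite /= tnth_mktuple.
apply: measurable_funB.
  apply: measurable_funB.
    exact: (measurableT_comp (measurable_coord i) (measurableT_comp measurable_fst measurable_fst)).
  exact: (measurableT_comp (measurable_coord i) (measurableT_comp measurable_snd measurable_fst)).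
apply: measurable_funM => //.
exact: (measurableT_comp (measurable_coord i) (measurableT_comp mw measurable_snd)).
Qed.

Lemma edot_displacement t p xi :
  edot (displacement t p) xi = edot p.1.1 xi - edot p.1.2 xi - t * edot xi (w p.2).
Proof.
rewrite /edot mulr_sumr -!sumrB; apply: eq_bigr => i _.
by rewrite coord_mktuple; ring.
Qed.

Definition unit_valued (f : Rn R d -> R) := measurable_fun setT f /\ forall x, 0 <= f x <= 1.

Lemma unit_valued_norm f x : unit_valued f -> `|f x| <= 1.
Proof. by move=> [_ /(_ x)/andP[f0 f1]]; rewrite ger0_norm. Qed.

Lemma integrable_mulcos f (phi : R) xi : unit_valued f ->
  mu.-integrable setT (fun x => (f x * cos (edot x xi + phi))%:E).
Proof.
move=> fu; apply: (integrableR_bounded (M := 1) (probability_lty mu)).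
  apply: measurable_funM; first by case: fu.
  apply: measurable_cosT; apply: measurable_funD => //.
  by apply: measurable_edot.
by move=> x; rewrite normrM -[leRHS]mulr1 ler_pM ?unit_valued_norm ?cos_max.
Qed.

Lemma integrable_mulcos0 f xi : unit_valued f ->
  mu.-integrable setT (fun x => (f x * cos (edot x xi))%:E).
Proof.
move=> fu; have := integrable_mulcos 0 xi fu.
by congr (mu.-integrable _ _); apply/funext => x; rewrite addr0.
Qed.

Lemma integrable_mulsin0 f xi : unit_valued f ->
  mu.-integrable setT (fun x => (f x * sin (edot x xi))%:E).
Proof.
move=> fu; apply: (integrableR_bounded (M := 1) (probability_lty mu)).
  apply: measurable_funM; first by case: fu.
  by apply: measurable_sinT; exact: measurable_edot.
by move=> x; rewrite normrM -[leRHS]mulr1 ler_pM ?unit_valued_norm ?sin_max.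
Qed.

(** The transform of x - y - t w at independent arguments is the product of the
    three transforms, the last two conjugated; the right-hand side is its real
    part. *)
Lemma integral_cos_displacement f g t xi : unit_valued f -> unit_valued g ->
  \int[((mu \x mu) \x P)%E]_p (f p.1.1 * g p.1.2 * cos (edot (displacement t p) xi)) =
  (cosint f xi * cosint g xi + sinint f xi * sinint g xi) * sphere_cos t xi +
  (sinint f xi * cosint g xi - cosint f xi * sinint g xi) * sphere_sin t xi.
Proof.
move=> fu gu.
set u := sphere_cos t xi; set v := sphere_sin t xi.
pose X (x : Rn R d) := edot x xi.
pose O p := t * edot xi (w p).
have mX : measurable_fun setT X by exact: measurable_edot.
have mO : measurable_fun setT O by apply: measurable_funM => //; exact: measurable_edot.
have fn x := unit_valued_norm x fu; have gn x := unit_valued_norm x gu.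
have [mf _] := fu; have [mg _] := gu.
have I1 (m : probability (Rn R d * Rn R d)%type R) : m.-integrable setT (fun=> (1 : R)%:E).
  exact: finite_measure_integrable_cst.
have I1' : mu.-integrable setT (fun=> (1 : R)%:E) by exact: finite_measure_integrable_cst.
pose fg (p : Rn R d * Rn R d) := f p.1 * g p.2.
have mfg : measurable_fun setT fg.
  apply: measurable_funM; first exact: (measurableT_comp mf measurable_fst).
  exact: (measurableT_comp mg measurable_snd).
have fgn p : `|fg p| <= 1 by rewrite normrM -[leRHS]mulr1 ler_pM.
have mXY : measurable_fun setT (fun p : Rn R d * Rn R d => X p.1 - X p.2).
  apply: measurable_funB; first exact: (measurableT_comp mX measurable_fst).
  exact: (measurableT_comp mX measurable_snd).
pose h (p : (Rn R d * Rn R d) * Om) := fg p.1 * cos (X p.1.1 - X p.1.2 - O p.2).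
have mh : measurable_fun setT h.
  apply: measurable_funM; first exact: (measurableT_comp mfg measurable_fst).
  apply: measurable_cosT; apply: measurable_funB.
    exact: (measurableT_comp mXY measurable_fst).
  exact: (measurableT_comp mO measurable_snd).
have h1 p q : `|h (p, q)| <= 1.
  by rewrite normrM -[leRHS]mulr1 ler_pM ?fgn ?cos_max.
transitivity (\int[((mu \x mu) \x P)%E]_p h p).
  by apply: eq_Rintegral => p _; rewrite /h edot_displacement.
rewrite (Rfubini1 P mh (I1 _) h1).
have IcO : P.-integrable setT (fun p => (cos (O p))%:E).
  apply: (integrableR_bounded (M := 1) (probability_lty P)); first exact: measurable_cosT.
  by move=> p; exact: cos_max.
have IsO : P.-integrable setT (fun p => (sin (O p))%:E).
  apply: (integrableR_bounded (M := 1) (probability_lty P)); first exact: measurable_sinT.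
  by move=> p; exact: sin_max.
pose k (p : Rn R d * Rn R d) := fg p * (cos (X p.1 - X p.2) * u + sin (X p.1 - X p.2) * v).
have hk p : \int[P]_q h (p, q) = k p.
  transitivity (\int[P]_q ((fg p * cos (X p.1 - X p.2)) * cos (O q) +
      (fg p * sin (X p.1 - X p.2)) * sin (O q))).
    by apply: eq_Rintegral => q _; rewrite /h /= cosB; ring.
  by rewrite Rintegral_lin// -/(sphere_cos t xi) -/(sphere_sin t xi) -/u -/v /k; ring.
transitivity (\int[(mu \x mu)%E]_p k p); first by apply: eq_Rintegral => p _; exact: hk.
have mk : measurable_fun setT k.
  have -> : k = (fun p => \int[P]_q h (p, q)) by apply/funext => p; rewrite hk.
  by apply: (measurable_Rintegral_param P mh (M := 1)) => -[]; exact: h1.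
have k1 x y : `|k (x, y)| <= 1.
  rewrite -hk; apply: Rintegral_le_bound; last by move=> q; exact: h1.
  exact: measurable_pair1R.
rewrite (Rfubini1 mu mk I1' k1).
pose A := u * cosint g xi - v * sinint g xi.
pose B := u * sinint g xi + v * cosint g xi.
have kA x : \int[mu]_y k (x, y) = A * (f x * cos (X x)) + B * (f x * sin (X x)).
  transitivity (\int[mu]_y (f x * (cos (X x) * u + sin (X x) * v) * (g y * cos (X y)) +
     f x * (sin (X x) * u - cos (X x) * v) * (g y * sin (X y)))).
    by apply: eq_Rintegral => y _; rewrite /k /fg /= cosB sinB; ring.
  rewrite Rintegral_lin; [|exact: integrable_mulcos0|exact: integrable_mulsin0].
  by rewrite -/(cosint g xi) -/(sinint g xi) /A /B; ring.
transitivity (\int[mu]_x (A * (f x * cos (X x)) + B * (f x * sin (X x)))).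
  by apply: eq_Rintegral => x _; exact: kA.
rewrite Rintegral_lin; [|exact: integrable_mulcos0|exact: integrable_mulsin0].
by rewrite -/(cosint f xi) -/(sinint f xi) /A /B; ring.
Qed.

(** The bridge between frequencies and points: the right-hand side counts, with a
    bump of width [v], the triples where x - y is close to t w. *)
Lemma kernel_identity f g t v : 0 < v -> unit_valued f -> unit_valued g ->
  \int[lebn]_xi (weight v xi *
    ((cosint f xi * cosint g xi + sinint f xi * sinint g xi) * sphere_cos t xi +
    (sinint f xi * cosint g xi - cosint f xi * sinint g xi) * sphere_sin t xi)) =
  \int[((mu \x mu) \x P)%E]_p (f p.1.1 * g p.1.2 * tentn v (displacement t p)).
Proof.
move=> v0 fu gu; have [mf _] := fu; have [mg _] := gu.
have mF : measurable_fun setT (fun p : (Rn R d * Rn R d) * Om => f p.1.1 * g p.1.2).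
  apply: measurable_funM.
    exact: (measurableT_comp mf (measurableT_comp measurable_fst measurable_fst)).
  exact: (measurableT_comp mg (measurableT_comp measurable_snd measurable_fst)).
have F1 (p : (Rn R d * Rn R d) * Om) : `|f p.1.1 * g p.1.2| <= 1.
  by rewrite normrM -[leRHS]mulr1 ler_pM ?unit_valued_norm.
rewrite -(kernel_fubini ((mu \x mu) \x P)%E v0 (measurable_displacement t) mF F1).
by apply: eq_Rintegral => xi _; rewrite integral_cos_displacement.
Qed.

Lemma measurable_cosint f : unit_valued f -> measurable_fun setT (cosint f).
Proof.
move=> fu; have [mf _] := fu.
pose h (p : Rn R d * Rn R d) := f p.2 * cos (edot p.2 p.1).
have mh : measurable_fun setT h.
  apply: measurable_funM; first exact: (measurableT_comp mf measurable_snd).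
  by apply: measurable_cosT; exact: measurable_edot.
apply: (measurable_Rintegral_param mu mh (M := 1)) => p.
by rewrite normrM -[leRHS]mulr1 ler_pM ?unit_valued_norm ?cos_max.
Qed.

Lemma measurable_sinint f : unit_valued f -> measurable_fun setT (sinint f).
Proof.
move=> fu; have [mf _] := fu.
pose h (p : Rn R d * Rn R d) := f p.2 * sin (edot p.2 p.1).
have mh : measurable_fun setT h.
  apply: measurable_funM; first exact: (measurableT_comp mf measurable_snd).
  by apply: measurable_sinT; exact: measurable_edot.
apply: (measurable_Rintegral_param mu mh (M := 1)) => p.
by rewrite normrM -[leRHS]mulr1 ler_pM ?unit_valued_norm ?sin_max.
Qed.

Lemma cosint_le1 f xi : unit_valued f -> `|cosint f xi| <= 1.
Proof.
move=> fu; apply: Rintegral_le_bound.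
  by have /measurable_integrableR := integrable_mulcos0 xi fu.
by move=> x; rewrite normrM -[leRHS]mulr1 ler_pM ?unit_valued_norm ?cos_max.
Qed.

Lemma sinint_le1 f xi : unit_valued f -> `|sinint f xi| <= 1.
Proof.
move=> fu; apply: Rintegral_le_bound.
  by have /measurable_integrableR := integrable_mulsin0 xi fu.
by move=> x; rewrite normrM -[leRHS]mulr1 ler_pM ?unit_valued_norm ?sin_max.
Qed.

Lemma energy_density_ge0 f xi : 0 <= energy_density f xi.
Proof. by rewrite addr_ge0 ?sqr_ge0. Qed.

Lemma measurable_energy_density f : unit_valued f -> measurable_fun setT (energy_density f).
Proof.
move=> fu; apply: measurable_funD; apply: measurable_funX.
  exact: measurable_cosint.
exact: measurable_sinint.
Qed.

Lemma energy_density_le2 f xi : unit_valued f -> energy_density f xi <= 2.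
Proof.
move=> fu; have hc := cosint_le1 xi fu; have hs := sinint_le1 xi fu.
rewrite /energy_density -(real_normK (num_real (cosint f xi))).
rewrite -(real_normK (num_real (sinint f xi))).
by rewrite (_ : 2 = 1 + 1)// lerD// exprn_ile1.
Qed.

Lemma measurable_sphere_phase t :
  measurable_fun setT (fun p : Rn R d * Om => t * edot p.1 (w p.2)).
Proof.
apply: measurable_funM => //; apply: measurable_edot => //.
exact: (measurableT_comp mw measurable_snd).
Qed.

Lemma measurable_sphere_cos t : measurable_fun setT (sphere_cos t).
Proof.
apply: (measurable_Rintegral_param P (measurable_cosT (measurable_sphere_phase t)) (M := 1)).
by move=> p; exact: cos_max.
Qed.

Lemma measurable_sphere_sin t : measurable_fun setT (sphere_sin t).
Proof.
apply: (measurable_Rintegral_param P (measurable_sinT (measurable_sphere_phase t)) (M := 1)).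
by move=> p; exact: sin_max.
Qed.

Lemma sphere_cos_le1 t xi : `|sphere_cos t xi| <= 1.
Proof.
apply: Rintegral_le_bound; last by move=> p; exact: cos_max.
exact: (measurable_pair1R (measurable_cosT (measurable_sphere_phase t)) xi).
Qed.

Lemma sphere_sin_le1 t xi : `|sphere_sin t xi| <= 1.
Proof.
apply: Rintegral_le_bound; last by move=> p; exact: sin_max.
exact: (measurable_pair1R (measurable_sinT (measurable_sphere_phase t)) xi).
Qed.

End Characters.

Section SphereFactor.
Context {R : realType} {d : nat}.
Context dO (Om : measurableType dO) (P : probability Om R) (w : Om -> Rn R d).
Hypotheses (mw : measurable_fun setT w) (w1 : forall p, edot (w p) (w p) = 1).

Lemma sphere_cos_ge_half t xi : 0 <= t -> t * enorm xi <= 1 -> 2^-1 <= sphere_cos P w t xi.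
Proof.
move=> t0 txi.
rewrite -[leLHS](Rintegral_probability_cst P); apply: le_Rintegral => //.
- exact: finite_measure_integrable_cst.
- apply: (integrableR_bounded (M := 1) (probability_lty P)); last by move=> p; exact: cos_max.
  by apply: measurable_cosT; apply: measurable_funM => //; exact: measurable_edot.
move=> p _; apply: (le_trans _ (cos_ge_onem _)).
have : `|t * edot xi (w p)| <= 1.
  rewrite normrM ger0_norm// (le_trans _ txi)// ler_wpM2l// edotC.
  exact: normr_edot_le.
by rewrite -ler_sqr ?nnegrE// real_normK ?num_real// expr1n; lra.
Qed.

Variable C : R.
Hypothesis decay : forall xi phi,
  Num.sqrt (enorm xi) * `|\int[P]_p cos (edot xi (w p) + phi)| <= C.

Let scaled (t : R) (xi : Rn R d) : Rn R d := [tuple t * coord xi i | i < d].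

Let edot_scaled t xi p : edot (scaled t xi) (w p) = t * edot xi (w p).
Proof.
by rewrite /edot mulr_sumr; apply: eq_bigr => i _; rewrite coord_mktuple mulrA.
Qed.

Let enorm_scaled t xi : 0 <= t -> enorm (scaled t xi) = t * enorm xi.
Proof.
move=> t0; rewrite /enorm (_ : edot (scaled t xi) (scaled t xi) = t ^+ 2 * edot xi xi).
  by rewrite sqrtrM ?sqr_ge0// sqrtr_sqr ger0_norm.
by rewrite /edot mulr_sumr; apply: eq_bigr => i _; rewrite coord_mktuple; ring.
Qed.

Lemma sphere_cos_decay t xi : 0 <= t -> Num.sqrt (t * enorm xi) * `|sphere_cos P w t xi| <= C.
Proof.
move=> t0; rewrite -(enorm_scaled _ t0); apply: (le_trans _ (decay (scaled t xi) 0)).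
rewrite le_eqVlt; apply/orP; left; apply/eqP; congr (_ * `|_|).
by apply: eq_Rintegral => p _; rewrite edot_scaled addr0.
Qed.

Lemma sphere_sin_decay t xi : 0 <= t -> Num.sqrt (t * enorm xi) * `|sphere_sin P w t xi| <= C.
Proof.
move=> t0; rewrite -(enorm_scaled _ t0); apply: (le_trans _ (decay (scaled t xi) (- (pi / 2)))).
rewrite le_eqVlt; apply/orP; left; apply/eqP; congr (_ * `|_|).
by apply: eq_Rintegral => p _; rewrite edot_scaled cosBpihalf.
Qed.

Lemma sphere_decay_ge0 : 0 <= C.
Proof. by apply: (le_trans _ (decay [tuple 0 | i < _] 0)); rewrite mulr_ge0 ?sqrtr_ge0. Qed.

End SphereFactor.

(** * Energy over balls and over their complements *)
Section EnergyGrowth.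
Context {R : realType} {d : nat}.
Notation lebn := (@lebesgue_measure_Rn R d).

Definition origin_ball (T : R) : set (Rn R d) := [set xi | enorm xi <= T].

Lemma measurable_enorm : measurable_fun setT (@enorm R d).
Proof.
apply: (measurableT_comp (continuous_measurable_fun (@sqrt_continuous R))).
by apply: measurable_edot.
Qed.

Lemma measurable_sqrt_enormV : measurable_fun setT (fun xi : Rn R d => (Num.sqrt (enorm xi))^-1).
Proof.
under eq_fun do rewrite -powR_inv1 ?sqrtr_ge0//.
apply: (measurableT_comp (@measurable_powR R (-1))).
exact: (measurableT_comp (continuous_measurable_fun (@sqrt_continuous R)) measurable_enorm).
Qed.

Lemma measurable_origin_ball T : measurable (origin_ball T).
Proof.
rewrite -[origin_ball T]setTI; apply: (measurable_fun_ler measurable_enorm (measurable_cst T)) => //.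
Qed.

Definition ball_energy (e : Rn R d -> R) (T : R) : \bar R :=
  (\int[lebn]_(xi in origin_ball T) (e xi)%:E)%E.

(** Cut at the radii 16^k r.  On the k-th annulus |xi|^(-1/2) is at most
    4^(-k) r^(-1/2), and the energy is at most B 16^((k+1) D) r^D, hence at most
    B 2^(k+1) r^D because D <= 1/4; the bounds form a geometric series of ratio
    1/2. *)
Lemma tail_energy (e : Rn R d -> R) (B D r : R) : measurable_fun setT e ->
  (forall xi, 0 <= e xi) -> 0 < r -> 0 <= B -> 0 <= D <= 4^-1 ->
  (forall T, r <= T -> (ball_energy e T <= (B * T `^ D)%:E)%E) ->
  (\int[lebn]_(xi in ~` origin_ball r) ((Num.sqrt (enorm xi))^-1 * e xi)%:E <=
    (4 * B * r `^ D / Num.sqrt r)%:E)%E.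
Proof.
move=> me e0 r0 B0 /andP[D0 D4] hB.
have r_ge0 := ltW r0.
pose rad k := 16 ^+ k.+1 * r.
pose c k := (4 ^+ k * Num.sqrt r)^-1.
have c0 k : 0 <= c k by rewrite invr_ge0 mulr_ge0 ?exprn_ge0 ?sqrtr_ge0.
have mE k : measurable_fun setT (fun xi => (c k * e xi)%:E).
  by apply/measurable_EFinP; exact: measurable_funM.
pose g k xi := (((fun xi => (c k * e xi)%:E) \_ (origin_ball (rad k))) xi)%E.
have g0 k xi : (0 <= g k xi)%E.
  by rewrite /g patchE; case: ifP => // _; rewrite lee_fin mulr_ge0.
have mg k : measurable_fun setT (g k).
  apply/(measurable_restrictT _ (measurable_origin_ball _)).
  exact: measurable_funTS.
have mlhs : measurable_fun setT (fun xi => ((Num.sqrt (enorm xi))^-1 * e xi)%:E).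
  apply/measurable_EFinP; apply: measurable_funM => //.
  exact: measurable_sqrt_enormV.
apply: (@le_trans _ _ (\int[lebn]_xi (\sum_(0 <= k <oo) g k xi)%E)%E).
  rewrite integral_mkcond; apply: ge0_le_integral => //.
  - move=> xi _; rewrite patchE; case: ifP => // _.
    by rewrite lee_fin mulr_ge0// invr_ge0 sqrtr_ge0.
  - apply/(measurable_restrictT _ (measurableC (measurable_origin_ball _))).
    exact: measurable_funTS.
  - by apply: ge0_emeasurable_sum => // k xi _ _; exact: g0.
  move=> xi _; rewrite patchE; case: ifPn => [|_]; last exact: nneseries_ge0.
  rewrite inE /origin_ball /= => /negP; rewrite -ltNge => rxi.
  (* The first ball that contains xi gives a term that is large enough. *)
  have [n nP] : exists n, enorm xi <= 16 ^+ n.+1 * r.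
    have xr : 0 <= enorm xi / r by rewrite divr_ge0// enorm_ge0.
    exists (Num.truncn (enorm xi / r)); rewrite -ler_pdivrMr//.
    apply: (le_trans (ltW (truncnS_gt _))).
    rewrite -natrX ler_nat; exact: ltnW (ltn_expl _ _).
  pose Q n := enorm xi <= 16 ^+ n.+1 * r.
  have exQ : exists n, Q n by exists n.
  case: (ex_minnP exQ) => k Qk kmin.
  have kl : 16 ^+ k * r <= enorm xi.
    case: k Qk kmin => [|k] _ kmin; first by rewrite expr0 mul1r ltW.
    by rewrite leNgt; apply/negP => /ltW /kmin; rewrite ltnn.
  have gk : (((Num.sqrt (enorm xi))^-1 * e xi)%:E <= g k xi)%E.
    rewrite /g patchE mem_set//= lee_fin ler_wpM2r// /c lef_pV2 ?posrE.
    - have -> : 4 ^+ k = Num.sqrt (16 ^+ k) :> R.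
        have -> : 16 ^+ k = (4 ^+ k) ^+ 2 :> R.
          by rewrite -exprM mulnC exprM; congr (_ ^+ _); ring.
        by rewrite sqrtr_sqr ger0_norm// exprn_ge0.
      by rewrite -sqrtrM ?exprn_ge0// ler_wsqrtr.
    - by rewrite sqrtr_gt0 (lt_trans r0).
    - by rewrite mulr_gt0 ?exprn_gt0// sqrtr_gt0.
  apply: (le_trans gk).
  apply: (le_trans _ (nneseries_lim_ge k.+1 _)); last by move=> *; exact: g0.
  rewrite big_nat_recr//= leeDr// sume_ge0// => *; exact: g0.
rewrite integral_nneseries//.
(* The k-th term is at most eps / 2 ^ k.+1. *)
pose eps := 4 * B * r `^ D / Num.sqrt r.
apply: (le_trans _ (epsilon_trick0 (eps := eps) xpredT _)); last first.
  by rewrite divr_ge0 ?sqrtr_ge0// !mulr_ge0// powR_ge0.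
apply: lee_nneseries => [k _ _|k _]; first exact: integral_ge0.
rewrite /g -integral_mkcond.
have rk : r <= rad k by rewrite -[leLHS]mul1r ler_wpM2r// exprn_ege1// ler1n.
have -> : (\int[lebn]_(x in origin_ball (rad k)) (c k * e x)%:E = (c k)%:E * ball_energy e (rad k))%E.
  under eq_integral do rewrite EFinM.
  rewrite ge0_integralZl_EFin//; first exact: measurable_origin_ball.
    by move=> xi _; rewrite lee_fin.
  by apply/measurable_EFinP; exact: measurable_funTS.
apply: (@le_trans _ _ ((c k)%:E * (B * rad k `^ D)%:E)%E).
  by apply: lee_wpmul2l; [rewrite lee_fin|exact: hB].
rewrite -EFinM lee_fin.
have a0 : 0 <= 2 ^+ k.+1 :> R by rewrite exprn_ge0.
have e16 : 16 ^+ k.+1 = (2 ^+ k.+1) ^+ 4 :> R.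
  by rewrite -exprM mulnC exprM; congr (_ ^+ _); ring.
have radD : rad k `^ D <= 2 ^+ k.+1 * r `^ D.
  rewrite /rad powRM ?exprn_ge0// ler_wpM2r ?powR_ge0//.
  apply: (@le_trans _ _ ((16 ^+ k.+1) `^ 4^-1)).
    by apply: ler_powR => //; rewrite exprn_ege1// ler1n.
  by rewrite e16 -powR_mulrn// -powRrM divff ?powRr1// pnatr_eq0.
have sr0 : Num.sqrt r != 0 by rewrite lt0r_neq0// sqrtr_gt0.
have k0 : 2 ^+ k != 0 :> R by rewrite expf_neq0// pnatr_eq0.
have -> : eps / (2 ^ k.+1)%:R = c k * (B * (2 ^+ k.+1 * r `^ D)).
  rewrite /eps /c natrX exprS.
  have -> : 4 ^+ k = 2 ^+ k * 2 ^+ k :> R by rewrite -exprMn; congr (_ ^+ _); ring.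
  by field; rewrite sr0 k0.
by rewrite ler_wpM2l// ler_wpM2l.
Qed.

End EnergyGrowth.

(** * Energy of a density against a uniformly dimensional measure *)
Section Schur.
Context {R : realType} {d : nat}.
Variable mu : probability (Rn R d) R.
Notation lebn := (@lebesgue_measure_Rn R d).

Lemma unit_valued1 : unit_valued (cst 1 : Rn R d -> R).
Proof. by split => // x; rewrite ler01 lexx. Qed.

Lemma fourier_energyE T :
  fourier_energy mu T = ball_energy (energy_density mu (cst 1)) T.
Proof.
apply: eq_integral => xi _; congr EFin.
rewrite /fourier_transform /= sqr_sqrtr ?addr_ge0 ?sqr_ge0// sqrrN /energy_density.
by congr (_ ^+ 2 + _ ^+ 2); apply: eq_Rintegral => x _; rewrite /= mul1r.
Qed.

Lemma enorm_ge_coord (xi : Rn R d) i : `|coord xi i| <= enorm xi.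
Proof.
rewrite -(@ler_pXn2r _ 2) ?nnegrE ?enorm_ge0// sqr_enorm real_normK ?num_real//.
rewrite /edot (bigD1 i)//= -expr2 lerDl; apply: sumr_ge0 => j _.
by rewrite -expr2 sqr_ge0.
Qed.

Lemma weight_ge_on_ball v T (xi : Rn R d) : 0 < v -> v * T <= 1 -> enorm xi <= T ->
  (2^-1) ^+ d <= weight v xi.
Proof.
move=> v0 vT xT; rewrite /weight -[X in _ ^+ X]card_ord -prodr_const.
apply: ler_prod => i _; rewrite invr_ge0 ler0n/=.
apply: fejer_ge_half; rewrite normrM (gtr0_norm v0) (le_trans _ vT)// ler_wpM2l ?(ltW v0)//.
exact: le_trans (enorm_ge_coord _ _) xT.
Qed.

Variables (s C : R).
Hypothesis mu_unit : mu (@unit_cube R d) = 1%E.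
Hypothesis mu_cube : forall (a : Rn R d) (l : R), 0 < l -> cube a l `<=` @unit_cube R d ->
  (mu (cube a l) <= (C * l `^ s)%:E)%E.

Definition box (x : Rn R d) (v : R) : set (Rn R d) :=
  [set y | forall i, coord x i - v <= coord y i <= coord x i + v].

Lemma measurable_unit_cube : measurable (@unit_cube R d).
Proof. exact: (measurable_box (fun=> 0) (fun=> 1)). Qed.

Lemma measurable_box_set x v : measurable (box x v).
Proof. exact: measurable_box. Qed.

(** The box may leave the unit cube; the part outside is negligible, and the part
    inside fits in a cube of the same side contained in the unit cube. *)
Lemma measure_box_le x (v : R) : 0 < v -> 2 * v <= 1 ->
  (mu (box x v) <= (C * (2 * v) `^ s)%:E)%E.
Proof.
move=> v0 v1; pose l := 2 * v.
(* The lowest corner of the box, moved so that the cube fits. *)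
pose a : Rn R d := [tuple Num.max 0 (Num.min (coord x i - v) (1 - l)) | i < d].
have l0 : 0 < l by rewrite mulr_gt0.
have cube_sub : cube a l `<=` @unit_cube R d.
  move=> y ya i; have := ya i; rewrite coord_mktuple => /andP[h1 h2].
  apply/andP; split; first by apply: le_trans h1; rewrite le_max lexx.
  apply: (le_trans h2); rewrite -lerBrDr ge_max subr_ge0 v1/= ge_min lexx orbT//.
have mc : measurable (cube a l) by exact: measurable_box.
have sub : box x v `<=` cube a l `|` ~` @unit_cube R d.
  move=> y xy; have [uy|nuy] := pselect (@unit_cube R d y); last by right.
  left => i; rewrite coord_mktuple.
  have /andP[u0 u1] := uy i; have /andP[x0 x1] := xy i.
  rewrite ge_max u0/= ge_min x0/= -lerBlDr le_max; apply/orP.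
  have [h|h] := leP (coord x i - v) (1 - l).
    by right; rewrite /l in h *; lra.
  by right; rewrite /l in h *; lra.
apply: (le_trans (le_measure mu _ _ sub)); rewrite ?inE.
- exact: measurable_box_set.
- apply: measurableU => //; apply: measurableC; exact: measurable_unit_cube.
apply: (le_trans (measureU2 _ _ _)) => //.
  by apply: measurableC; exact: measurable_unit_cube.
have nu : mu (~` @unit_cube R d) = 0%E.
  by rewrite probability_setC ?mu_unit ?subee//; exact: measurable_unit_cube.
by rewrite [X in (_ + X <= _)%E](_ : _ = 0%E)// adde0; exact: mu_cube.
Qed.

(** At radius 0 the space side is the integral of f(x) f(y) times the tent at
    x - y, which is at most (fejer_mass / v)^d and lives on a box of half-side v
    around x: this is Schur's test. *)
Lemma schur_kernel_bound f (v : R) : 0 < v -> 2 * v <= 1 -> unit_valued f ->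
  \int[lebn]_xi (weight v xi * energy_density mu f xi) <=
  (fejer_mass / v) ^+ d * (C * (2 * v) `^ s) * \int[mu]_x f x.
Proof.
move=> v0 v1 fu; have [mf f01] := fu.
(* The point of the sphere is multiplied by 0, so that any probability space can
   stand for it, for instance mu with the identity. *)
have mid : measurable_fun setT (@id (Rn R d)) by [].
have := kernel_identity mu mu mid 0 v0 fu fu.
have sc xi : sphere_cos mu id 0 xi = 1.
  rewrite /sphere_cos; under eq_Rintegral do rewrite mul0r cos0.
  exact: Rintegral_probability_cst.
have ss xi : sphere_sin mu id 0 xi = 0.
  rewrite /sphere_sin; under eq_Rintegral do rewrite mul0r sin0.
  exact: Rintegral_probability_cst.
under eq_Rintegral do rewrite sc ss mulr0 addr0 mulr1 -!expr2.
move=> ->.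
set M := (fejer_mass / v) ^+ d.
have M0 : 0 <= M by rewrite exprn_ge0// divr_ge0 ?fejer_mass_ge0// ltW.
pose h (p : (Rn R d * Rn R d) * Rn R d) := f p.1.1 * f p.1.2 * tentn v (displacement id 0 p).
pose k (p : Rn R d * Rn R d) := h (p, p.1).
have hk p q : h (p, q) = k p.
  rewrite /k /h; congr (_ * _ * tentn _ _); apply: eq_from_tnth => i.
  by rewrite !tnth_mktuple !mul0r.
have fn x : `|f x| <= 1 by exact: unit_valued_norm.
have tM (p : (Rn R d * Rn R d) * Rn R d) : `|tentn v (displacement id 0 p)| <= M.
  by rewrite ger0_norm ?tentn_ge0//; exact: tentn_le.
have ffM (p : (Rn R d * Rn R d) * Rn R d) : `|h p| <= M.
  rewrite /h normrM -[leRHS]mul1r ler_pM// normrM -[leRHS]mulr1 ler_pM//.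
have mh : measurable_fun setT h.
  apply: measurable_funM; last first.
    exact: (measurableT_comp (@measurable_tentn R d v) (measurable_displacement mid 0)).
  apply: measurable_funM.
    exact: (measurableT_comp mf (measurableT_comp measurable_fst measurable_fst)).
  exact: (measurableT_comp mf (measurableT_comp measurable_snd measurable_fst)).
have IM (m : probability (Rn R d * Rn R d)%type R) : m.-integrable setT (fun=> M%:E).
  exact: finite_measure_integrable_cst.
have IM' : mu.-integrable setT (fun=> M%:E) by exact: finite_measure_integrable_cst.
rewrite -[leLHS]/(\int[((mu \x mu) \x mu)%E]_p h p).
rewrite (Rfubini1 mu mh (IM _) (fun p q => ffM (p, q))).
have -> : \int[(mu \x mu)%E]_p \int[mu]_q h (p, q) = \int[(mu \x mu)%E]_p k p.
  apply: eq_Rintegral => p _; under eq_Rintegral do rewrite hk.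
  exact: Rintegral_probability_cst.
have mk : measurable_fun setT k.
  have mg : measurable_fun setT (fun p : Rn R d * Rn R d => (p, p.1)).
    by apply/measurable_fun_pairP; split; [exact: measurable_id|exact: measurable_fst].
  exact: (measurableT_comp mh mg).
rewrite (Rfubini1 mu mk IM' (fun x y => ffM ((x, y), x))).
have Ik x : mu.-integrable setT (fun y => (k (x, y))%:E).
  apply: (integrableR_bounded (M := M) (probability_lty mu)); first exact: measurable_pair1R.
  by move=> y; exact: (ffM ((x, y), x)).
have Ibox x : mu.-integrable setT (fun y => (\1_(box x v) y : R)%:E).
  apply: (integrableR_bounded (M := 1) (probability_lty mu)).
    exact: measurable_indic (measurable_box_set x v).
  by move=> y; rewrite indicE; case: (_ \in _); rewrite ?normr1 ?normr0.
have kb x : \int[mu]_y k (x, y) <= M * (C * (2 * v) `^ s) * f x.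
  apply: (@le_trans _ _ (\int[mu]_y (f x * M * \1_(box x v) y))).
    apply: le_Rintegral => //; [exact: Ik|exact: (integrableRZl (f x * M) (Ibox x))|].
    move=> y _; rewrite /k /h /= indicE.
    have [f0 f1] := andP (f01 x); have [g0 g1] := andP (f01 y).
    case: (boolP (y \in box x v)) => [_|]; last first.
      rewrite notin_setE => nb; rewrite !mulr0.
      have [i /negP ni] : exists i, ~ (coord x i - v <= coord y i <= coord x i + v).
        by apply/existsNP.
      rewrite (tentn_eq0 (i := i))// ?mulr0// /displacement coord_mktuple mul0r subr0/=.
      move: ni; rewrite negb_and -!ltNge => /orP[] h1.
        by rewrite ler_normr; apply/orP; left; lra.
      by rewrite ler_normr; apply/orP; right; lra.
    rewrite mulr1 -mulrA ler_wpM2l//.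
    rewrite -[leRHS]mul1r ler_pM ?tentn_ge0//; exact: tentn_le.
  have hb : \int[mu]_y (\1_(box x v) y : R) <= C * (2 * v) `^ s.
    rewrite -lee_fin -integralRE//.
    rewrite integral_indic ?setIT//; last exact: measurable_box_set.
    exact: measure_box_le.
  have -> : M * (C * (2 * v) `^ s) * f x = f x * M * (C * (2 * v) `^ s) by ring.
  have := RintegralZl (f x * M) measurableT (Ibox x) => /= ->.
  by rewrite ler_wpM2l// mulr_ge0//; case/andP: (f01 x).
apply: (@le_trans _ _ (\int[mu]_x (M * (C * (2 * v) `^ s) * f x))).
  apply: le_Rintegral => //.
  - apply: (integrableR_bounded (M := M) (probability_lty mu)).
      by apply: (measurable_Rintegral_param mu mk (M := M)) => -[x y]; exact: (ffM ((x, y), x)).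
    move=> x; apply: Rintegral_le_bound; first exact: measurable_pair1R.
    by move=> y; exact: (ffM ((x, y), x)).
  - by apply: integrableRZl; exact: (integrableR_bounded (M := 1) (probability_lty mu)).
rewrite RintegralZl//.
exact: (integrableR_bounded (M := 1) (probability_lty mu)).
Qed.

Lemma integrable_weight_energy f (v : R) : 0 < v -> unit_valued f ->
  lebn.-integrable setT (fun xi => (weight v xi * energy_density mu f xi)%:E).
Proof.
move=> v0 fu; apply: (integrable_weight_mul (M := 2)) => //.
  exact: measurable_energy_density.
by move=> xi; rewrite ger0_norm ?energy_density_ge0// energy_density_le2.
Qed.

(** With v = 1 / T the weight is at least 2^(-d) on the ball of radius T.  The
    bound is linear in the mass of f, which makes small sets have small energy. *)
Lemma schur_energy f (T : R) : 2 <= T -> unit_valued f ->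
  (ball_energy (energy_density mu f) T <=
   (2 ^+ d * (fejer_mass ^+ d * C * 2 `^ s) * T `^ (d%:R - s) * \int[mu]_x f x)%:E)%E.
Proof.
move=> T2 fu; have T0 : 0 < T by apply: lt_le_trans T2.
pose v := T^-1; have v0 : 0 < v by rewrite invr_gt0.
have Iw := integrable_weight_energy v0 fu.
have me := measurable_energy_density mu fu.
apply: (@le_trans _ _ (\int[lebn]_xi (2 ^+ d * (weight v xi * energy_density mu f xi))%:E)%E).
  apply: (@le_trans _ _ (\int[lebn]_(xi in origin_ball T)
      (2 ^+ d * (weight v xi * energy_density mu f xi))%:E)%E).
    apply: ge0_le_integral => //.
    - exact: measurable_origin_ball.
    - by move=> xi _; rewrite lee_fin energy_density_ge0.
    - by apply/measurable_EFinP; exact: measurable_funTS.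
    - by apply/measurable_EFinP; apply: measurable_funTS; apply: measurable_integrableR (integrableRZl _ Iw).
    move=> xi xT; rewrite lee_fin mulrA -[leLHS]mul1r ler_wpM2r ?energy_density_ge0//.
    apply: (@le_trans _ _ (2 ^+ d * 2^-1 ^+ d)).
      by rewrite -exprMn divff ?expr1n// pnatr_eq0.
    by rewrite ler_wpM2l ?exprn_ge0// (weight_ge_on_ball (T := T))// mulVf// gt_eqF.
  apply: ge0_subset_integral => //.
  - exact: measurable_origin_ball.
  - by apply/measurable_EFinP; apply: measurable_integrableR (integrableRZl _ Iw).
  - by move=> xi _; rewrite lee_fin !mulr_ge0 ?exprn_ge0 ?weight_ge0 ?energy_density_ge0.
rewrite integralRE; last exact: integrableRZl.
rewrite lee_fin RintegralZl// -!mulrA ler_wpM2l ?exprn_ge0//.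
apply: (le_trans (schur_kernel_bound v0 _ fu)).
  by rewrite ler_pdivrMr// mul1r.
rewrite le_eqVlt; apply/orP; left; apply/eqP.
rewrite !mulrA; congr (_ * _).
rewrite /v invrK powRM ?invr_ge0 ?(ltW T0)// -powR_inv1 ?(ltW T0)// -powRrM mulN1r.
rewrite powRD; last by rewrite (gt_eqF T0) implybT.
rewrite powR_mulrn ?(ltW T0)// exprMn. ring.
Qed.

End Schur.

(** * Large closed subsets that keep away from a missing distance *)
Section InnerRegularity.
Context {R : realType} {d : nat}.
Variable mu : probability (Rn R d) R.

Definition to_row (x : Rn R d) : 'rV[R]_d := \row_i coord x i.

(** Closedness is read through the identification with row vectors, which carry
    the Euclidean topology. *)
Definition eclosed (K : set (Rn R d)) :=
  measurable K /\ exists2 C : set 'rV[R]_d, closed C & K = to_row @^-1` C.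

Definition inner_regular (A : set (Rn R d)) :=
  measurable A /\ forall eps : R, 0 < eps -> exists K,
    [/\ eclosed K, K `<=` A & (mu (A `\` K) <= eps%:E)%E].

Lemma eclosed_bigcup_fin (K : nat -> set (Rn R d)) N : (forall n, eclosed (K n)) ->
  eclosed (\bigcup_(n in `I_N) K n).
Proof.
move=> cK; split; first by apply: bigcup_measurable => n _; case: (cK n).
have /choice[C hC] : forall n, exists C : set 'rV[R]_d, closed C /\ K n = to_row @^-1` C.
  by move=> n; case: (cK n) => _ [C cC e]; exists C.
exists (\bigcup_(n in `I_N) C n).
  by apply: closed_bigcup => // n _; case: (hC n).
by rewrite preimage_bigcup; apply: eq_bigcupr => n _; case: (hC n).
Qed.

Lemma eclosed_bigcap (K : nat -> set (Rn R d)) : (forall n, eclosed (K n)) ->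
  eclosed (\bigcap_n K n).
Proof.
move=> cK; split; first by apply: bigcap_measurable => // n _; case: (cK n).
have /choice[C hC] : forall n, exists C : set 'rV[R]_d, closed C /\ K n = to_row @^-1` C.
  by move=> n; case: (cK n) => _ [C cC e]; exists C.
exists (\bigcap_n C n).
  by apply: closed_bigI => n _; case: (hC n).
by rewrite preimage_bigcap; apply: eq_bigcapr => n _; case: (hC n).
Qed.

Lemma inner_regular_eclosed K : eclosed K -> inner_regular K.
Proof.
move=> cK; have [mK _] := cK; split=> // eps e0; exists K; split => //.
by rewrite setDv measure0 lee_fin ltW.
Qed.

Let half_pow (eps : R) n : 0 < eps -> 0 < eps / (2 ^ n.+1)%:R.
Proof. by move=> e0; rewrite divr_gt0// ltr0n expn_gt0. Qed.

(** A countable union of closed sets need not be closed: a finite one is taken,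
    with a tail of measure at most half of the error allowed. *)
Lemma inner_regular_bigcup (A : nat -> set (Rn R d)) :
  (forall n, inner_regular (A n)) -> inner_regular (\bigcup_n A n).
Proof.
move=> rA; split; first by apply: bigcup_measurable => n _; case: (rA n).
move=> eps e0; have e20 : 0 < eps / 2 by rewrite divr_gt0.
have /choice[K hK] : forall n, exists K, [/\ eclosed K, K `<=` A n &
    (mu (A n `\` K) <= (eps / 2 / (2 ^ n.+1)%:R)%:E)%E].
  by move=> n; case: (rA n) => _; apply; exact: half_pow.
have cK n : eclosed (K n) by case: (hK n).
have mK n : measurable (K n) by case: (cK n).
have mA n : measurable (A n) by case: (rA n).
pose V N := \bigcup_(n in `I_N) K n.
have mV N : measurable (V N) by case: (eclosed_bigcup_fin N cK).
pose D N := \bigcup_n K n `\` V N.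
have mUK : measurable (\bigcup_n K n) by exact: bigcup_measurable.
have mD N : measurable (D N) by exact: measurableD.
have D0 : \bigcap_n D n = set0.
  rewrite -subset0 => x Dx; have [[n _ Knx] _] := Dx 0%N I.
  by have [_] := Dx n.+1 I; apply; exists n => //=.
have cvD : mu (D N) @[N --> \oo] --> 0%E.
  rewrite -(measure0 mu) -D0; apply: nonincreasing_cvg_mu => //.
  - by rewrite (le_lt_trans (probability_le1 _ _)) ?ltry.
  - by rewrite D0.
  - move=> n m nm; apply/subsetPset => x [Kx nV]; split => // -[k /= kn Kkx].
    by apply: nV; exists k => //=; exact: leq_trans nm.
have [N DN] : exists N, (mu (D N) <= (eps / 2)%:E)%E.
  move: cvD => /fine_cvgP[_ /cvgrPdist_le /(_ _ e20)[N _ /(_ N (leqnn N))]] /=.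
  rewrite sub0r normrN => h; exists N.
  rewrite -[leLHS]fineK; last exact: fin_num_measure.
  by rewrite lee_fin (le_trans (ler_norm _)).
exists (V N); split.
- exact: eclosed_bigcup_fin.
- by move=> x [n _ Kx]; exists n => //; case: (hK n) => _ + _; apply.
have sub : \bigcup_n A n `\` V N `<=` (\bigcup_n (A n `\` K n)) `|` D N.
  move=> x [[n _ Ax] nV]; have [Kx|nKx] := pselect (K n x).
    by right; split => //; exists n.
  by left; exists n.
have mAK : measurable (\bigcup_n (A n `\` K n)).
  by apply: bigcup_measurable => n _; exact: measurableD.
apply: (le_trans (le_measure mu _ _ sub)); rewrite ?inE.
- by apply: measurableD => //; exact: bigcup_measurable.
- exact: measurableU.
apply: (le_trans (measureU2 _ _ _)) => //.
have -> : eps = eps / 2 + eps / 2 by field.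
rewrite EFinD leeD//.
apply: (@le_trans _ _ (\sum_(0 <= n <oo) mu (A n `\` K n))%E).
  apply: measure_sigma_subadditive => // n; exact: measurableD.
apply: (le_trans _ (epsilon_trick0 (eps := eps / 2) xpredT (ltW e20))).
by apply: lee_nneseries => // n _; case: (hK n).
Qed.

Lemma inner_regular_bigcap (A : nat -> set (Rn R d)) :
  (forall n, inner_regular (A n)) -> inner_regular (\bigcap_n A n).
Proof.
move=> rA; split; first by apply: bigcap_measurable => // n _; case: (rA n).
move=> eps e0.
have /choice[K hK] : forall n, exists K, [/\ eclosed K, K `<=` A n &
    (mu (A n `\` K) <= (eps / (2 ^ n.+1)%:R)%:E)%E].
  by move=> n; case: (rA n) => _; apply; exact: half_pow.
have cK n : eclosed (K n) by case: (hK n).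
have mK n : measurable (K n) by case: (cK n).
have mA n : measurable (A n) by case: (rA n).
exists (\bigcap_n K n); split.
- exact: eclosed_bigcap.
- by move=> x Kx n _; case: (hK n) => _ + _; apply; exact: Kx.
have sub : \bigcap_n A n `\` \bigcap_n K n `<=` \bigcup_n (A n `\` K n).
  move=> x [Ax /existsNP[n /not_implyP[_ nKx]]].
  by exists n => //; split => //; exact: Ax.
apply: (@le_trans _ _ (\sum_(0 <= n <oo) mu (A n `\` K n))%E).
  apply: measure_sigma_subadditive => //.
  - by move=> n; exact: measurableD.
  - apply: measurableD; exact: bigcap_measurable.
apply: (le_trans _ (epsilon_trick0 (eps := eps) xpredT (ltW e0))).
by apply: lee_nneseries => // n _; case: (hK n).
Qed.

(** Asking inner regularity of a set and of its complement gives a class stable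
    under complements; it is a sigma-algebra that contains the half-open slabs,
    hence all Borel sets. *)
Definition biregular (A : set (Rn R d)) := inner_regular A /\ inner_regular (~` A).

Lemma biregularC A : biregular A -> biregular (~` A).
Proof. by move=> [a b]; split; rewrite ?setCK. Qed.

Lemma biregular_bigcup (A : nat -> set (Rn R d)) :
  (forall n, biregular (A n)) -> biregular (\bigcup_n A n).
Proof.
move=> rA; split; first by apply: inner_regular_bigcup => n; case: (rA n).
by rewrite setC_bigcup; apply: inner_regular_bigcap => n; case: (rA n).
Qed.

Lemma biregular0 : biregular set0.
Proof.
split; apply: inner_regular_eclosed; split => //.
- by exists set0; [exact: closed0|rewrite preimage_set0].
- exact: measurableC.
- by exists setT; [exact: closedT|rewrite setC0 preimage_setT].
Qed.

Lemma eclosed_coord i (B : set R) : closed B -> eclosed ((fun x : Rn R d => coord x i) @^-1` B).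
Proof.
move=> cB; split.
  rewrite -[X in measurable X]setTI; apply: (@measurable_coord R d i) => //.
  exact: closed_measurable.
exists [set v : 'rV[R]_d | B (v ord0 i)].
  by apply: preimage_closed cB => v _; exact: coord_continuous.
by apply/seteqP; split => x /=; rewrite mxE.
Qed.

Lemma biregular_coord_ocitv i (a b : R) :
  biregular ((fun x : Rn R d => coord x i) @^-1` `]a, b]).
Proof.
split.
  rewrite itv_open_bnd_bigcup preimage_bigcup; apply: inner_regular_bigcup => n.
  by apply: inner_regular_eclosed; apply: eclosed_coord; exact: itv_closed.
rewrite preimage_setC setCitv preimage_setU.
have -> : forall A B : set (Rn R d), A `|` B = \bigcup_(n : nat) (if n == 0%N then A else B).
  move=> A B; apply/seteqP; split => x.
    by case=> ?; [exists 0%N|exists 1%N].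
  by move=> [n _]; case: ifP => _ ?; [left|right].
apply: inner_regular_bigcup => n; case: ifP => _.
  by apply: inner_regular_eclosed; apply: eclosed_coord; exact: lray_closed.
rewrite [X in _ @^-1` X](itvoyEbigcup b) preimage_bigcup; apply: inner_regular_bigcup => k.
by apply: inner_regular_eclosed; apply: eclosed_coord; exact: rray_closed.
Qed.

Lemma biregular_coord i (B : set (measurableTypeR R)) : measurable B ->
  biregular ((fun x : Rn R d => coord x i) @^-1` B).
Proof.
pose G := [set B : set R | biregular ((fun x : Rn R d => coord x i) @^-1` B)].
apply: (@smallest_sub _ _ _ G); last by move=> _ [[a b]] _ <-; exact: biregular_coord_ocitv.
split => [|A GA|A GA]; rewrite /G/=.
- by rewrite preimage_set0; exact: biregular0.
- by rewrite setTD -preimage_setC; exact: biregularC.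
- by rewrite preimage_bigcup; exact: biregular_bigcup.
Qed.

Lemma measurable_biregular (A : set (Rn R d)) : measurable A -> biregular A.
Proof.
apply: (@smallest_sub _ _ _ biregular).
  split => [|B rB|B rB]; first exact: biregular0.
  - by rewrite setTD; exact: biregularC.
  - exact: biregular_bigcup.
elim/big_ind : _ => [|S T hS hT|i _].
- by [].
- by move=> B [/hS|/hT].
- move=> _ [B mB <-]; rewrite setTI; exact: (biregular_coord i mB).
Qed.

(** The continuous function |d(x, y) - t| on the compact set K x K has a closed
    image, which avoids 0. *)
Lemma edist_gap (K : set (Rn R d)) (t : R) : eclosed K -> K `<=` @unit_cube R d ->
  ~ distance_set K t -> exists2 eta : R, 0 < eta &
    forall x y, K x -> K y -> eta <= `|edist x y - t|.
Proof.
move=> [_ [C cC KC]] Ku nt.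
pose Q := [set v : 'rV[R]_d | forall i, `[0, 1]%classic (v ord0 i)].
have cQ : compact Q by exact: (@rV_compact R d (fun=> `[0, 1]%classic) (fun=> @segment_compact R 0 1)).
pose L := C `&` Q.
have cL : compact L.
  apply: (subclosed_compact _ cQ) => [|v []//].
  by apply: closedI => //; apply: compact_closed cQ; exact: norm_hausdorff.
pose dd (p : 'rV[R]_d * 'rV[R]_d) :=
  `|Num.sqrt (\sum_(i < d) (p.1 ord0 i - p.2 ord0 i) ^+ 2) - t|.
have cdd : continuous dd.
  pose S (p : 'rV[R]_d * 'rV[R]_d) : R := \sum_(i < d) (p.1 ord0 i - p.2 ord0 i) ^+ 2.
  have cS : continuous S.
    move=> p; apply: cvg_big; first exact: add_continuous.
    move=> i _.
    have c1 : (fun q : 'rV[R]_d * 'rV[R]_d => q.1 ord0 i) @ p --> p.1 ord0 i.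
      exact: (cvg_comp _ _ (@cvg_fst _ _ (nbhs p.1) (nbhs p.2) _) (@coord_continuous R 1 d ord0 i p.1)).
    have c2 : (fun q : 'rV[R]_d * 'rV[R]_d => q.2 ord0 i) @ p --> p.2 ord0 i.
      exact: (cvg_comp _ _ (@cvg_snd _ _ (nbhs p.1) (nbhs p.2) _) (@coord_continuous R 1 d ord0 i p.2)).
    exact: (cvg_comp _ _ (cvgB c1 c2) (@exprn_continuous R 2 _)).
  move=> p; apply: cvg_norm; apply: cvgB; last exact: cvg_cst.
  exact: (cvg_comp _ _ (cS p) (@sqrt_continuous R (S p))).
have cLL : compact (L `*` L) by exact: compact_setX.
have cim : closed (dd @` (L `*` L)).
  apply: compact_closed; first exact: norm_hausdorff.
  by apply: continuous_compact => //; exact: continuous_subspaceT.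
have n0 : (~` (dd @` (L `*` L))) 0.
  move=> [p [L1 L2] /eqP]; rewrite normr_eq0 subr_eq0 => /eqP e.
  pose x : Rn R d := [tuple p.1 ord0 i | i < d].
  pose y : Rn R d := [tuple p.2 ord0 i | i < d].
  have rx : to_row x = p.1 by apply/rowP => i; rewrite mxE coord_mktuple.
  have ry : to_row y = p.2 by apply/rowP => i; rewrite mxE coord_mktuple.
  apply: nt; exists (x, y).
    by split; rewrite /= KC /= ?rx ?ry; [case: L1|case: L2].
  rewrite -e /edist /=; congr Num.sqrt; apply: eq_bigr => i _.
  by rewrite !coord_mktuple.
have /nbhs_ballP[eta eta0 hb] : nbhs (0 : R) (~` (dd @` (L `*` L))).
  by apply: open_nbhs_nbhs; split => //; exact: closed_openC.
exists eta => // x y Kx Ky.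
rewrite leNgt; apply/negP => lt.
have inL z : K z -> L (to_row z).
  move=> Kz; split; first by move: Kz; rewrite KC.
  by move=> i; rewrite /= mxE in_itv/=; exact: (Ku _ Kz i).
apply: (hb `|edist x y - t|).
  by rewrite /ball/= sub0r normrN normr_id.
exists (to_row x, to_row y); first by split; exact: inL.
rewrite /dd /edist /=; congr (`|Num.sqrt _ - t|); apply: eq_bigr => i _.
by rewrite !mxE.
Qed.

Lemma compact_gap (E : set (Rn R d)) (t eps : R) : measurable E -> mu E = 1%E ->
  E `<=` @unit_cube R d -> ~ distance_set E t -> 0 < eps ->
  exists (K : set (Rn R d)) (eta : R), [/\ measurable K, (mu (~` K) <= eps%:E)%E,
    0 < eta & forall x y, K x -> K y -> eta <= `|edist x y - t|].
Proof.
move=> mE mE1 Eu nt e0.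
have [[_ /(_ _ e0)[K [cK KE muK]]] _] := measurable_biregular mE.
have [mK _] := cK.
have [|//|eta eta0 h] := @edist_gap K t cK.
- by move=> x /KE /Eu.
- by move=> [p [/KE Kx /KE Ky] e]; apply: nt; exists p.
exists K, eta; split => //.
have mE0 : mu (~` E) = 0%E by rewrite probability_setC// mE1 subee.
have sub : ~` K `<=` (E `\` K) `|` ~` E.
  by move=> x Kx; have [Ex|nEx] := pselect (E x); [left|right].
have mEK : measurable (E `\` K) by exact: measurableD.
have mCE : measurable (~` E) by exact: measurableC.
apply: (le_trans (le_measure mu _ _ sub)); rewrite ?inE.
- exact: measurableC.
- exact: measurableU.
apply: (le_trans (measureU2 _ _ _)) => //.
by rewrite [X in (_ + X <= _)%E](_ : _ = 0%E)// adde0.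
Qed.

End InnerRegularity.

(** * The sphere energy from below *)
Section RestrictedIntegral.
Context dT {T : measurableType dT} {R : realType} (m : {measure set T -> \bar R}).

Lemma integrable_mul_indic (f : T -> R) (S : set T) (M : R) : measurable S ->
  measurable_fun setT f -> (forall x, 0 <= f x) ->
  (\int[m]_(x in S) (f x)%:E <= M%:E)%E ->
  m.-integrable setT (fun x => (f x * \1_S x)%:E) /\
  (\int[m]_x (f x * \1_S x))%:E = (\int[m]_(x in S) (f x)%:E)%E.
Proof.
move=> mS mf f0 hM.
have e : (\int[m]_x (f x * \1_S x)%:E)%E = (\int[m]_(x in S) (f x)%:E)%E.
  rewrite [RHS]integral_mkcond; apply: eq_integral => x _.
  by rewrite patchE indicE; case: ifP => _; rewrite ?mulr1 ?mulr0.
have Ifi : m.-integrable setT (fun x => (f x * \1_S x)%:E).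
  apply/integrableP; split.
    by apply/measurable_EFinP; apply: measurable_funM => //; exact: measurable_indic.
  rewrite (_ : (fun x => _) = (fun x => (f x * \1_S x)%:E)); last first.
    by apply/funext => x /=; rewrite ger0_norm// mulr_ge0.
  by rewrite e (le_lt_trans hM) ?ltry.
by split => //; rewrite -integralRE.
Qed.

End RestrictedIntegral.

Section LowerBound.
Context {R : realType} {d : nat}.
Variable mu : probability (Rn R d) R.
Context dO (Om : measurableType dO) (P : probability Om R) (w : Om -> Rn R d).
Hypotheses (mw : measurable_fun setT w) (w1 : forall p, edot (w p) (w p) = 1).
Variable Cl : R.
Hypothesis decay : forall xi phi,
  Num.sqrt (enorm xi) * `|\int[P]_p cos (edot xi (w p) + phi)| <= Cl.
Notation lebn := (@lebesgue_measure_Rn R d).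
Notation e1 := (energy_density mu (cst 1)).
Notation FR T := (fine (ball_energy e1 T)).

Variables (C0 D : R).
Hypotheses (C01 : 1 <= C0) (D0 : 0 <= D) (D4 : D <= 4^-1).
Hypothesis growth : forall T, 1 <= T ->
  ((C0^-1 * T `^ D)%:E <= ball_energy e1 T <= (C0 * T `^ D)%:E)%E.

(** The quantity computed in two ways; [kernel_identity] is its space side. *)
Definition sphere_energy (v t : R) : R :=
  \int[lebn]_xi (weight v xi * (e1 xi * sphere_cos P w t xi)).

Lemma ball_energyE T : 1 <= T -> ball_energy e1 T = (FR T)%:E.
Proof.
move=> T1; rewrite fineK// ge0_fin_numE.
  by have /andP[_ h] := growth T1; rewrite (le_lt_trans h) ?ltry.
by apply: integral_ge0 => xi _; rewrite lee_fin energy_density_ge0.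
Qed.

Let me1 : measurable_fun setT e1.
Proof. exact: measurable_energy_density (@unit_valued1 R d). Qed.

Let e1_ge0 xi : 0 <= e1 xi. Proof. exact: energy_density_ge0. Qed.

Let integrable_ball T : 1 <= T ->
  lebn.-integrable setT (fun xi => (e1 xi * \1_(origin_ball T) xi)%:E) /\
  \int[lebn]_xi (e1 xi * \1_(origin_ball T) xi) = FR T.
Proof.
move=> T1; have /andP[_ h] := growth T1.
have [I1 I2] := integrable_mul_indic (measurable_origin_ball T) me1 e1_ge0 h.
by split => //; apply: EFin_inj; rewrite I2 -ball_energyE.
Qed.

(** Three ranges of frequencies.  For |xi| <= 1/t the integrand is at least c1 e,
    since u_t >= 1/2 there and the weight is at least 2^(-d).  For
    1/t <= |xi| <= A/t it is at least - e, and the energy of this range is small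
    by assumption.  For |xi| > A/t the decay of u_t and [tail_energy] bound the
    loss by a multiple of A^(D - 1/2) <= A^(-1/4). *)
Lemma sphere_energy_ge (c1 A v t : R) : c1 = 2^-1 ^+ d / 2 -> 0 < t <= 1 -> 0 < v <= t ->
  1 <= A -> 4 * Cl * C0 * A `^ (- 4^-1) <= c1 / (4 * C0) ->
  FR (A / t) - FR (t^-1) <= c1 / (4 * C0) * t^-1 `^ D ->
  c1 / (2 * C0) * t^-1 `^ D <= sphere_energy v t.
Proof.
move=> c1E /andP[t0 t1] /andP[v0 vt] A1 hA hmid.
have num : 4^-1 <= - 4^-1 + 2^-1 :> R by lra.
have A0 : 0 < A by apply: lt_le_trans A1.
have C00 : 0 < C0 by apply: lt_le_trans C01.
have Cl0 : 0 <= Cl := sphere_decay_ge0 decay.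
have it1 : 1 <= t^-1 by rewrite invf_ge1.
have it0 : 0 < t^-1 by rewrite invr_gt0.
have At1 : 1 <= A / t by rewrite ler_pdivlMr// mul1r (le_trans t1).
have At0 : 0 < A / t by rewrite divr_gt0.
have [I1 E1] := integrable_ball it1.
have [I2 E2] := integrable_ball At1.
pose g xi := (Num.sqrt (enorm xi))^-1 * e1 xi.
have mg : measurable_fun setT g.
  by apply: measurable_funM => //; exact: measurable_sqrt_enormV.
have g0 (xi : Rn R d) : 0 <= g xi by rewrite mulr_ge0// invr_ge0 sqrtr_ge0.
have tail : (\int[lebn]_(xi in ~` origin_ball (A / t)) (g xi)%:E <=
    (4 * C0 * (A / t) `^ D / Num.sqrt (A / t))%:E)%E.
  apply: tail_energy => //; rewrite ?D0 ?D4 ?(ltW C00)//.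
  by move=> T AT; have /andP[] := growth (le_trans At1 AT).
have [I3 E3] := integrable_mul_indic (measurableC (measurable_origin_ball (A / t))) mg g0 tail.
set S3 := ~` origin_ball (A / t) in I3 E3.
have {}tail : \int[lebn]_xi (g xi * \1_S3 xi) <= 4 * C0 * (A / t) `^ D / Num.sqrt (A / t).
  by rewrite -lee_fin E3.
pose cs := Cl / Num.sqrt t.
have cs0 : 0 <= cs by rewrite divr_ge0 ?sqrtr_ge0.
pose h xi := weight v xi * (e1 xi * sphere_cos P w t xi).
have c10 : 0 <= c1 by rewrite c1E divr_ge0// exprn_ge0// invr_ge0.
have Ih : lebn.-integrable setT (fun xi => (h xi)%:E).
  apply: (integrable_weight_mul (M := 2)) => //.
    by apply: measurable_funM => //; exact: measurable_sphere_cos.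
  move=> xi; rewrite normrM -[leRHS]mulr1 ler_pM ?sphere_cos_le1//.
  by rewrite ger0_norm// energy_density_le2//; exact: unit_valued1.
(* The minorant: c1 e on the small ball, - e on the rest of the large ball, and the
   decay of the sphere measure outside; 1 is added to c1 because the large ball,
   subtracted as a whole, contains the small one. *)
pose k xi := (c1 + 1) * (e1 xi * \1_(origin_ball t^-1) xi) - e1 xi * \1_(origin_ball (A / t)) xi
   - cs * (g xi * \1_S3 xi).
have I12 := integrableRB (integrableRZl (c1 + 1) I1) I2.
have Ik : lebn.-integrable setT (fun xi => (k xi)%:E).
  exact: integrableRB I12 (integrableRZl cs I3).
have kh xi : k xi <= h xi.
  rewrite /k /h !indicE.
  have w0 := weight_ge0 v xi; have wl1 := weight_le1 v xi.
  have u1 := sphere_cos_le1 P mw t xi.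
  have hge : - (`|sphere_cos P w t xi| * e1 xi) <= weight v xi * (e1 xi * sphere_cos P w t xi).
    rewrite lerNl (le_trans (ler_norm _))// normrN !normrM (ger0_norm w0).
    by rewrite (ger0_norm (e1_ge0 xi)) [leRHS]mulrC -[leRHS]mul1r ler_wpM2r// mulr_ge0.
  have [x1|x1] := leP (enorm xi) t^-1.
    have -> : (xi \in origin_ball t^-1) = true by apply/mem_set.
    have x1' : (xi \in origin_ball (A / t)) = true.
      by apply/mem_set; rewrite /origin_ball/= (le_trans x1)// -[leLHS]mul1r ler_wpM2r// ltW.
    rewrite in_setC x1'.
    have uh : 2^-1 <= sphere_cos P w t xi.
      by apply: sphere_cos_ge_half => //; [exact: ltW|rewrite mulrC -ler_pdivlMr// mul1r].
    have wh : 2^-1 ^+ d <= weight v xi.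
      apply: (weight_ge_on_ball (T := t^-1)) => //.
      by rewrite ler_pdivrMr// mul1r.
    rewrite /= !mulr0 !mulr1 subr0 c1E.
    have : 2^-1 ^+ d * (e1 xi * 2^-1) <= weight v xi * (e1 xi * sphere_cos P w t xi).
      rewrite ler_pM ?exprn_ge0 ?mulr_ge0// ler_wpM2l//.
    lra.
  have -> : (xi \in origin_ball t^-1) = false.
    by apply: memNset; rewrite /origin_ball/= => h1; move: x1; rewrite ltNge h1.
  have [x2|x2] := leP (enorm xi) (A / t).
    have x2' : (xi \in origin_ball (A / t)) = true by apply/mem_set.
    rewrite in_setC x2' /= !mulr0 mulr1 subr0 sub0r (le_trans _ hge)// lerN2.
    by rewrite -[leRHS]mul1r ler_wpM2r.
  have x2' : (xi \in origin_ball (A / t)) = false.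
    by apply: memNset; rewrite /origin_ball/= => h1; move: x2; rewrite ltNge h1.
  rewrite in_setC x2' /= !mulr0 !mulr1 subr0 sub0r (le_trans _ hge)// lerN2.
  rewrite /g /cs mulrA ler_wpM2r//.
  have x0 : 0 < enorm xi by apply: lt_trans x2.
  have := sphere_cos_decay decay xi (ltW t0).
  rewrite sqrtrM ?(ltW t0)// => hd.
  have st0 : 0 < Num.sqrt t by rewrite sqrtr_gt0.
  have sx0 : 0 < Num.sqrt (enorm xi) by rewrite sqrtr_gt0.
  by rewrite -mulrA -invfM ler_pdivlMr ?mulr_gt0// mulrC.
have := le_Rintegral measurableT Ik Ih (fun xi _ => kh xi).
rewrite -/(sphere_energy v t); apply: le_trans.
have -> : \int[lebn]_xi k xi = (c1 + 1) * FR t^-1 - FR (A / t) -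
    cs * \int[lebn]_xi (g xi * \1_S3 xi).
  transitivity (\int[lebn]_xi ((c1 + 1) * (e1 xi * \1_(origin_ball t^-1) xi) -
     e1 xi * \1_(origin_ball (A / t)) xi) - \int[lebn]_xi (cs * (g xi * \1_S3 xi))).
    exact: (RintegralB measurableT I12 (integrableRZl cs I3)).
  congr (_ - _); last exact: (RintegralZl _ measurableT I3).
  transitivity (\int[lebn]_xi ((c1 + 1) * (e1 xi * \1_(origin_ball t^-1) xi)) -
     \int[lebn]_xi (e1 xi * \1_(origin_ball (A / t)) xi)).
    exact: (RintegralB measurableT (integrableRZl (c1 + 1) I1) I2).
  rewrite E2; congr (_ - _); rewrite -E1; exact: (RintegralZl _ measurableT I1).
have low : C0^-1 * t^-1 `^ D <= FR t^-1.
  by have /andP[+ _] := growth it1; rewrite ball_energyE// lee_fin.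
have high : cs * \int[lebn]_xi (g xi * \1_S3 xi) <= c1 / (4 * C0) * t^-1 `^ D.
  apply: (le_trans (ler_wpM2l cs0 tail)).
  have -> : cs * (4 * C0 * (A / t) `^ D / Num.sqrt (A / t)) =
      4 * Cl * C0 * (A `^ D * A `^ (- 2^-1)) * t^-1 `^ D.
    rewrite powRM ?(ltW A0) ?(ltW it0)// sqrtrM ?(ltW A0)// sqrtrV ?(ltW t0)//.
    rewrite powRN powR12_sqrt ?(ltW A0)// /cs; field.
    by rewrite !gt_eqF ?sqrtr_gt0.
  rewrite ler_wpM2r ?powR_ge0// (le_trans _ hA)// ler_wpM2l ?mulr_ge0 ?(ltW C00)//.
  rewrite -powRD; last by rewrite (gt_eqF A0) implybT.
  by apply: ler_powR => //; rewrite lerBlDr (le_trans D4)//.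
have p0 : 0 <= t^-1 `^ D by exact: powR_ge0.
have : c1 * (C0^-1 * t^-1 `^ D) <= c1 * FR t^-1 by rewrite ler_wpM2l.
have -> : c1 / (2 * C0) * t^-1 `^ D = c1 * (C0^-1 * t^-1 `^ D) - c1 / (4 * C0) * t^-1 `^ D
   - c1 / (4 * C0) * t^-1 `^ D by field; rewrite gt_eqF.
move: hmid high; lra.
Qed.

End LowerBound.

(** * The sphere energy at a missing distance *)
Section UpperBound.
Context {R : realType} {d : nat}.
Variable mu : probability (Rn R d) R.
Context dO (Om : measurableType dO) (P : probability Om R) (w : Om -> Rn R d).
Hypotheses (mw : measurable_fun setT w) (w1 : forall p, edot (w p) (w p) = 1).
Variable Cl : R.
Hypothesis decay : forall xi phi,
  Num.sqrt (enorm xi) * `|\int[P]_p cos (edot xi (w p) + phi)| <= Cl.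
Notation lebn := (@lebesgue_measure_Rn R d).
Variables (s C : R).
Hypotheses (C_gt0 : 0 < C) (mu_unit : mu (@unit_cube R d) = 1%E).
Hypothesis mu_cube : forall (a : Rn R d) (l : R), 0 < l -> cube a l `<=` @unit_cube R d ->
  (mu (cube a l) <= (C * l `^ s)%:E)%E.
Hypotheses (D0 : 0 <= d%:R - s) (D4 : d%:R - s <= 4^-1).
Variable t : R.
Hypothesis t0 : 0 < t.

Let D := d%:R - s.
Let K := 2 ^+ d * (fejer_mass ^+ d * C * 2 `^ s) : R.
Let cs := Cl / Num.sqrt t.
Let M := K * 2 `^ D * (1 + 4 * cs / Num.sqrt 2).

Let Cl0 : 0 <= Cl := sphere_decay_ge0 decay.

Let K0 : 0 <= K.
Proof. by rewrite !mulr_ge0 ?exprn_ge0 ?fejer_mass_ge0 ?powR_ge0// ltW. Qed.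

Let cs0 : 0 <= cs. Proof. by rewrite divr_ge0 ?sqrtr_ge0. Qed.

(** A common bound for the cosine and sine transforms of the sphere of radius t,
    trivial near the origin and by decay elsewhere. *)
Definition sphere_majorant (xi : Rn R d) : R :=
  \1_(origin_ball 2) xi + cs * ((Num.sqrt (enorm xi))^-1 * \1_(~` origin_ball 2) xi).

Let factor_le (u : R) xi : `|u| <= 1 -> Num.sqrt (t * enorm xi) * `|u| <= Cl ->
  `|u| <= sphere_majorant xi.
Proof.
move=> u1 ud; rewrite /sphere_majorant !indicE in_setC.
have [x2|x2] := leP (enorm xi) 2.
  have -> : (xi \in origin_ball 2) = true by apply/mem_set.
  by rewrite /= !mulr0 addr0.
have -> : (xi \in origin_ball 2) = false.
  by apply: memNset; rewrite /origin_ball/= => h; move: x2; rewrite ltNge h.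
rewrite /= mulr1 add0r /cs -mulrA -invfM ler_pdivlMr.
  by rewrite mulrC -sqrtrM// ltW.
by apply: mulr_gt0; rewrite sqrtr_gt0// (lt_trans _ x2).
Qed.

(** The decay makes the energy of f mu summable over all frequencies, linearly in
    the mass of f. *)
Lemma majorant_energy f : unit_valued f ->
  lebn.-integrable setT (fun xi => (sphere_majorant xi * energy_density mu f xi)%:E) /\
  \int[lebn]_xi (sphere_majorant xi * energy_density mu f xi) <= M * \int[mu]_x f x.
Proof.
move=> fu; have [mf f01] := fu.
pose e := energy_density mu f.
have me : measurable_fun setT e := measurable_energy_density mu fu.
have e0 (xi : Rn R d) : 0 <= e xi := energy_density_ge0 mu f xi.
pose I := \int[mu]_x f x.
have I0 : 0 <= I by apply: Rintegral_ge0 => x _; case/andP: (f01 x).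
have growth T : 2 <= T -> (ball_energy e T <= (K * I * T `^ D)%:E)%E.
  by move=> T2; have := schur_energy mu_unit mu_cube T2 fu; rewrite -/D -/K -/I mulrAC.
have [I1 E1] := integrable_mul_indic (measurable_origin_ball 2) me e0 (growth _ (lexx _)).
pose g xi := (Num.sqrt (enorm xi))^-1 * e xi.
have mg : measurable_fun setT g.
  by apply: measurable_funM => //; exact: measurable_sqrt_enormV.
have g0 (xi : Rn R d) : 0 <= g xi by rewrite mulr_ge0// invr_ge0 sqrtr_ge0.
have tail : (\int[lebn]_(xi in ~` origin_ball 2) (g xi)%:E <=
    (4 * (K * I) * 2 `^ D / Num.sqrt 2)%:E)%E.
  by apply: (tail_energy (D := D)) => //; [exact: mulr_ge0|apply/andP; split].
have [I3 E3] := integrable_mul_indic (measurableC (measurable_origin_ball 2)) mg g0 tail.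
have eq xi : sphere_majorant xi * e xi =
    e xi * \1_(origin_ball 2) xi + cs * (g xi * \1_(~` origin_ball 2) xi).
  by rewrite /sphere_majorant /g; ring.
split.
  have := integrableRD I1 (integrableRZl cs I3).
  by congr (lebn.-integrable _ _); apply/funext => xi; rewrite -eq.
have -> : \int[lebn]_xi (sphere_majorant xi * energy_density mu f xi) =
    \int[lebn]_xi (e xi * \1_(origin_ball 2) xi) + cs * \int[lebn]_xi (g xi * \1_(~` origin_ball 2) xi).
  transitivity (\int[lebn]_xi (e xi * \1_(origin_ball 2) xi + cs * (g xi * \1_(~` origin_ball 2) xi))).
    by apply: eq_Rintegral => xi _; exact: eq.
  transitivity (\int[lebn]_xi (e xi * \1_(origin_ball 2) xi) +
      \int[lebn]_xi (cs * (g xi * \1_(~` origin_ball 2) xi))).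
    exact: (RintegralD measurableT I1 (integrableRZl cs I3)).
  by congr (_ + _); exact: (RintegralZl _ measurableT I3).
have h1 : \int[lebn]_xi (e xi * \1_(origin_ball 2) xi) <= K * I * 2 `^ D.
  by rewrite -lee_fin E1; exact: growth.
have h3 : \int[lebn]_xi (g xi * \1_(~` origin_ball 2) xi) <= 4 * (K * I) * 2 `^ D / Num.sqrt 2.
  by rewrite -lee_fin E3.
apply: (le_trans (lerD h1 (ler_wpM2l cs0 h3))).
by rewrite /M -/I le_eqVlt; apply/orP; left; apply/eqP; ring.
Qed.

Let M0 : 0 <= M.
Proof.
apply: mulr_ge0; first by apply: mulr_ge0 => //; exact: powR_ge0.
by rewrite addr_ge0// divr_ge0 ?sqrtr_ge0// mulr_ge0.
Qed.

Definition trilinear (v : R) (f g : Rn R d -> R) : R :=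
  \int[((mu \x mu) \x P)%E]_p (f p.1.1 * g p.1.2 * tentn v (displacement w t p)).

(** The free parameter [k] in this inequality between arithmetic and geometric
    means lets a density of small mass be paired with one of mass 1. *)
Lemma cross_term_le (p q p' q' u u' m k : R) : 0 < k -> `|u| <= m -> `|u'| <= m ->
  (p * p' + q * q') * u + (q * p' - p * q') * u' <=
  m * (k^-1 * (p ^+ 2 + q ^+ 2) + k * (p' ^+ 2 + q' ^+ 2)).
Proof.
move=> k0 um um'.
have m0 : 0 <= m by apply: le_trans um.
have ik0 : 0 < k^-1 by rewrite invr_gt0.
have kk : k * k^-1 = 1 by rewrite divff// gt_eqF.
have amgm (a b : R) : 2 * (`|a| * `|b|) <= k^-1 * a ^+ 2 + k * b ^+ 2.
  rewrite -(real_normK (num_real a)) -(real_normK (num_real b)).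
  set x := `|a|; set y := `|b|.
  have h : 0 <= k^-1 * (x - k * y) ^+ 2 by rewrite mulr_ge0 ?sqr_ge0// ltW.
  rewrite -subr_ge0; apply: (le_trans h); rewrite le_eqVlt; apply/orP; left; apply/eqP.
  by field; rewrite gt_eqF.
have term (a b c : R) : `|c| <= m -> a * b * c <= m * (`|a| * `|b|).
  by move=> cm; apply: (le_trans (ler_norm _)); rewrite !normrM mulrC ler_wpM2r// mulr_ge0.
have h1 := term p p' u um; have h2 := term q q' u um.
have h3 := term q p' u' um'.
have h4 : - (p * q' * u') <= m * (`|p| * `|q'|).
  by rewrite -mulrN; apply: term; rewrite normrN.
have a1 := amgm p p'; have a2 := amgm q q'; have a3 := amgm q p'; have a4 := amgm p q'.
apply: (@le_trans _ _ (m * (`|p| * `|p'| + `|q| * `|q'| + `|q| * `|p'| + `|p| * `|q'|))).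
  rewrite !mulrDr [X in X <= _](_ : _ = p * p' * u + q * q' * u + q * p' * u' + - (p * q' * u')).
    by rewrite !lerD.
  by ring.
by apply: ler_wpM2l => //; lra.
Qed.

(** A bound uniform in [v]; for indicators and the best [k], it is a multiple of
    the product of their L^2 norms. *)
Lemma trilinear_le (v k : R) f g : 0 < v -> 0 < k -> unit_valued f -> unit_valued g ->
  trilinear v f g <= k^-1 * (M * \int[mu]_x f x) + k * (M * \int[mu]_x g x).
Proof.
move=> v0 k0 fu gu.
rewrite /trilinear -(kernel_identity mu P mw t v0 fu gu).
have [If Ef] := majorant_energy fu; have [Ig Eg] := majorant_energy gu.
have ik0 : 0 < k^-1 by rewrite invr_gt0.
set u := sphere_cos P w t; set u' := sphere_sin P w t.
pose J xi := (cosint mu f xi * cosint mu g xi + sinint mu f xi * sinint mu g xi) * u xi +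
  (sinint mu f xi * cosint mu g xi - cosint mu f xi * sinint mu g xi) * u' xi.
have mJ : measurable_fun setT J.
  have := measurable_cosint mu fu; have := measurable_cosint mu gu.
  have := measurable_sinint mu fu; have := measurable_sinint mu gu.
  have := measurable_sphere_cos P mw t; have := measurable_sphere_sin P mw t => *.
  apply: measurable_funD; apply: measurable_funM => //.
    by apply: measurable_funD; exact: measurable_funM.
  by apply: measurable_funB; exact: measurable_funM.
have J4 xi : `|J xi| <= 4.
  have a1 := cosint_le1 mu xi fu; have a2 := cosint_le1 mu xi gu.
  have a3 := sinint_le1 mu xi fu; have a4 := sinint_le1 mu xi gu.
  have a5 := sphere_cos_le1 P mw t xi; have a6 := sphere_sin_le1 P mw t xi.
  have prod (a b : R) : `|a| <= 1 -> `|b| <= 1 -> `|a * b| <= 1.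
    by move=> h1 h2; rewrite normrM -[leRHS]mulr1 ler_pM.
  have sum (a b c : R) : `|a| <= 1 -> `|b| <= 1 -> `|c| <= 1 -> `|(a + b) * c| <= 2.
    move=> h1 h2 h3; rewrite normrM -[leRHS]mulr1 ler_pM//.
    by rewrite (le_trans (ler_normD _ _))//; lra.
  rewrite /J (le_trans (ler_normD _ _))// (_ : 4 = 2 + 2 :> R); last by ring.
  by rewrite lerD// sum// ?prod// normrN prod.
have IJ : lebn.-integrable setT (fun xi => (weight v xi * J xi)%:E).
  exact: (integrable_weight_mul v0 mJ J4).
have Ikk := integrableRD (integrableRZl k^-1 If) (integrableRZl k Ig).
apply: (@le_trans _ _ (\int[lebn]_xi (k^-1 * (sphere_majorant xi * energy_density mu f xi) +
   k * (sphere_majorant xi * energy_density mu g xi)))).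
  apply: (le_Rintegral measurableT IJ Ikk) => xi _.
  have um : `|u xi| <= sphere_majorant xi.
    by apply: factor_le; [exact: sphere_cos_le1|exact: (sphere_cos_decay decay xi (ltW t0))].
  have um' : `|u' xi| <= sphere_majorant xi.
    by apply: factor_le; [exact: sphere_sin_le1|exact: (sphere_sin_decay decay xi (ltW t0))].
  have hx := cross_term_le (cosint mu f xi) (sinint mu f xi) (cosint mu g xi) (sinint mu g xi) k0 um um'.
  set X := (X in _ <= X).
  have XE : X = sphere_majorant xi * (k^-1 * energy_density mu f xi + k * energy_density mu g xi).
    by rewrite /X; ring.
  have X0 : 0 <= X.
    rewrite XE mulr_ge0//; first exact: le_trans um.
    by rewrite addr_ge0// mulr_ge0 ?energy_density_ge0// ltW.
  apply: (@le_trans _ _ (weight v xi * X)).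
    by rewrite ler_wpM2l ?weight_ge0// XE.
  by rewrite -[leRHS]mul1r ler_wpM2r// weight_le1.
rewrite Rintegral_lin// lerD// ler_wpM2l// ltW//.
Qed.

Lemma sphere_energyE (v : R) : 0 < v -> sphere_energy mu P w v t = trilinear v (cst 1) (cst 1).
Proof.
move=> v0; have u1 := @unit_valued1 R d.
rewrite /trilinear -(kernel_identity mu P mw t v0 u1 u1).
apply: eq_Rintegral => xi _; congr (_ * _).
by rewrite /energy_density; ring.
Qed.

Lemma integrable_trilinear (v : R) f g : 0 < v -> unit_valued f -> unit_valued g ->
  ((mu \x mu) \x P)%E.-integrable setT
    (fun p => (f p.1.1 * g p.1.2 * tentn v (displacement w t p))%:E).
Proof.
move=> v0 fu gu; have [mf _] := fu; have [mg _] := gu.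
apply: (@integrableR_bounded _ _ _ _ _ ((fejer_mass / v) ^+ d)).
- exact: (probability_lty ((mu \x mu) \x P)%E).
- apply: measurable_funM; last first.
    exact: (measurableT_comp (@measurable_tentn R d v) (measurable_displacement mw t)).
  apply: measurable_funM.
    exact: (measurableT_comp mf (measurableT_comp measurable_fst measurable_fst)).
  exact: (measurableT_comp mg (measurableT_comp measurable_snd measurable_fst)).
- move=> p; rewrite normrM -[leRHS]mul1r ler_pM//.
    by rewrite normrM -[leRHS]mulr1 ler_pM ?unit_valued_norm.
  by rewrite ger0_norm ?tentn_ge0//; exact: tentn_le.
Qed.

Lemma unit_valued_indic (S : set (Rn R d)) : measurable S -> unit_valued (\1_S : Rn R d -> R).
Proof.
move=> mS; split; first exact: measurable_indic.
by move=> x; rewrite indicE; case: (_ \in _); rewrite ?ler01 ?lexx.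
Qed.

(** Only the first term counts pairs that both lie in [S]. *)
Lemma trilinear_split (v : R) (S : set (Rn R d)) : 0 < v -> measurable S ->
  trilinear v (cst 1) (cst 1) =
  trilinear v \1_S \1_S + (trilinear v \1_(~` S) (cst 1) + trilinear v \1_S \1_(~` S)).
Proof.
move=> v0 mS.
have uS := unit_valued_indic mS; have uC := unit_valued_indic (measurableC mS).
have u1 := @unit_valued1 R d.
have I1 := integrable_trilinear v0 uS uS.
have I2 := integrable_trilinear v0 uC u1.
have I3 := integrable_trilinear v0 uS uC.
rewrite /trilinear.
rewrite -(RintegralD measurableT I2 I3) -(RintegralD measurableT I1 (integrableRD I2 I3)).
apply: eq_Rintegral => p _; rewrite !indicE !in_setC.
by case: (_ \in _) => /=; case: (_ \in _) => /=;
  rewrite ?mulr0n ?mulr1n !(mul0r, mulr0, mul1r, addr0, add0r).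
Qed.

(** The reverse triangle inequality for x - y and t w, where w is a unit vector. *)
Lemma edist_displacement (x y : Rn R d) q :
  `|edist x y - t| ^+ 2 <= \sum_(i < d) coord (displacement w t ((x, y), q)) i ^+ 2.
Proof.
pose a : Rn R d := [tuple coord x i - coord y i | i < d].
have ea : edist x y = enorm a.
  by rewrite /edist /enorm; congr Num.sqrt; apply: eq_bigr => i _; rewrite coord_mktuple expr2.
have -> : \sum_(i < d) coord (displacement w t ((x, y), q)) i ^+ 2 =
    edot a a - 2 * t * edot (w q) a + t ^+ 2.
  have -> : t ^+ 2 = t ^+ 2 * edot (w q) (w q) by rewrite w1 mulr1.
  rewrite /edot !mulr_sumr -sumrB -big_split/=.
  by apply: eq_bigr => i _; rewrite !coord_mktuple /=; ring.
rewrite real_normK ?num_real// ea -sqr_enorm.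
have := normr_edot_le a (w1 q); rewrite ler_norml => /andP[_ h].
have : t * edot (w q) a <= t * enorm a by rewrite ler_wpM2l// ltW.
rewrite sqrrB; lra.
Qed.

(** If all coordinates of x - y - t w are less than [v], then |x - y| differs from
    t by less than sqrt d v < eta, which no pair in [S] does. *)
Lemma trilinear_gap (v eta : R) (S : set (Rn R d)) : 0 < v -> 0 < eta -> d%:R * v ^+ 2 < eta ^+ 2 ->
  (forall x y, S x -> S y -> eta <= `|edist x y - t|) ->
  trilinear v \1_S \1_S = 0.
Proof.
move=> v0 eta0 hv gap; rewrite /trilinear.
transitivity (\int[((mu \x mu) \x P)%E]_p (0 : R)); last first.
  by rewrite /Rintegral integral0.
apply: eq_Rintegral => -[[x y] q] _; rewrite /= !indicE.
have [Sx|] := boolP (x \in S); last by rewrite !mul0r.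
have [Sy|] := boolP (y \in S); last by rewrite mulr0 mul0r.
rewrite !mul1r.
have [i hi] : exists i, v <= `|coord (displacement w t ((x, y), q)) i|.
  apply: contrapT => /forallNP hn.
  have := edist_displacement x y q; apply/negP; rewrite -ltNge.
  apply: (@lt_le_trans _ _ (eta ^+ 2)); last first.
    by rewrite lerXn2r ?nnegrE ?(ltW eta0)//; apply: gap; rewrite -in_setE.
  apply: (le_lt_trans _ hv).
  apply: (@le_trans _ _ (\sum_(i < d) v ^+ 2)).
    apply: ler_sum => i _; rewrite -(real_normK (num_real (coord _ _))).
    rewrite lerXn2r ?nnegrE ?(ltW v0)//.
    by have /negP := hn i; rewrite -ltNge => /ltW.
  by rewrite sumr_const card_ord mulr_natl.
exact: (tentn_eq0 v0 hi).
Qed.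

(** The complement of the set given by [compact_gap] has mass at most k^2; the
    parameters k and 1 / k in [trilinear_le] then bound each of the two remaining
    terms by 2 k M. *)
Lemma sphere_energy_small (E : set (Rn R d)) (c : R) : measurable E -> mu E = 1%E ->
  E `<=` @unit_cube R d -> ~ distance_set E t -> 0 < c ->
  exists2 v, 0 < v <= t & sphere_energy mu P w v t < c.
Proof.
move=> mE mE1 Eu nt c0.
pose k := c / (8 * (M + 1)).
have M10 : 0 < M + 1 by rewrite ltr_wpDl.
have k0 : 0 < k by rewrite divr_gt0// mulr_gt0.
have k20 : 0 < k ^+ 2 by rewrite exprn_gt0.
have [S [eta [mS muS eta0 gap]]] := compact_gap mE mE1 Eu nt k20.
pose v := Num.min t (eta / (d%:R + 1)).
have d10 : 0 < d%:R + 1 :> R by rewrite ltr_wpDl.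
have v0 : 0 < v by rewrite lt_min t0 divr_gt0.
exists v; first by rewrite v0 ge_min lexx.
have uS := unit_valued_indic mS; have uC := unit_valued_indic (measurableC mS).
have u1 := @unit_valued1 R d.
have hv : d%:R * v ^+ 2 < eta ^+ 2.
  apply: (@le_lt_trans _ _ (d%:R * (eta / (d%:R + 1)) ^+ 2)).
    rewrite ler_wpM2l// lerXn2r ?nnegrE ?(ltW v0) ?divr_ge0 ?(ltW eta0) ?(ltW d10)//.
    by rewrite ge_min lexx orbT.
  rewrite expr_div_n mulrCA -[ltRHS]mulr1 ltr_pM2l ?exprn_gt0//.
  rewrite ltr_pdivrMr ?exprn_gt0// mul1r; have : 0 <= d%:R :> R by []; nra.
rewrite (sphere_energyE v0) (trilinear_split v0 mS) (trilinear_gap v0 eta0 hv gap) add0r.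
have iC : \int[mu]_x (\1_(~` S) x : R) <= k ^+ 2.
  have IC : mu.-integrable setT (fun x => (\1_(~` S) x : R)%:E).
    apply: (integrableR_bounded (M := 1) (probability_lty mu)); first by case: uC.
    by move=> x; exact: unit_valued_norm.
  by rewrite -lee_fin -integralRE// integral_indic ?setIT//; exact: measurableC.
have i1 : \int[mu]_x (cst 1 x : R) = 1 by exact: Rintegral_probability_cst.
have iS : \int[mu]_x (\1_S x : R) <= 1.
  rewrite -i1; apply: le_Rintegral => //.
  - apply: (integrableR_bounded (M := 1) (probability_lty mu)); first by case: uS.
    by move=> x; exact: unit_valued_norm.
  - exact: finite_measure_integrable_cst.
  - by move=> x _; case: uS => _ /(_ x)/andP[].
have b1 := trilinear_le v0 k0 uC u1.
have ik0 : 0 < k^-1 by rewrite invr_gt0.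
have b2 := trilinear_le v0 ik0 uS uC.
rewrite invrK in b2; rewrite i1 mulr1 in b1.
have kk : k^-1 * (M * k ^+ 2) = k * M by rewrite expr2; field; rewrite gt_eqF.
have h1 : k^-1 * (M * \int[mu]_x (\1_(~` S) x : R)) <= k * M.
  by rewrite -kk ler_wpM2l ?(ltW ik0)// ler_wpM2l.
have h2 : k * (M * \int[mu]_x (\1_S x : R)) <= k * M.
  by rewrite ler_wpM2l ?(ltW k0)// -[leRHS]mulr1 ler_wpM2l.
apply: (@le_lt_trans _ _ (4 * (k * M))); first by lra.
have : k * (M + 1) = c / 8 by rewrite /k; field; rewrite gt_eqF.
rewrite mulrDr mulr1 => e; have := k0; lra.
Qed.

End UpperBound.

(** * A scale with little energy above it *)
Section Pigeonhole.
Context {R : realType}.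

(** Otherwise each step from T i to T (i + 1) >= A T i increases G by more than
    c (T i)^D >= c (T 0)^D; after N steps this exceeds
    G (T N) <= C0 (T N)^D <= 2 C0 (T 0)^D. *)
Lemma scale_pigeonhole (G : R -> R) (T : nat -> R) (A C0 c D : R) (N : nat) :
  1 <= A -> 0 <= c -> 0 <= D ->
  (forall x, 1 <= x -> 0 <= G x) ->
  (forall x y, 1 <= x -> x <= y -> G x <= G y) ->
  (forall i, (i <= N)%N -> 1 <= T i) ->
  (forall i, (i < N)%N -> A * T i <= T i.+1) ->
  G (T N) <= C0 * T N `^ D -> T N `^ D <= 2 * T 0%N `^ D -> 0 <= C0 ->
  2 * C0 < N%:R * c ->
  exists2 i, (i < N)%N & G (A * T i) - G (T i) <= c * T i `^ D.
Proof.
move=> A1 c0 D0 G0 Gmon T1 TA GN TN C00 hN.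
apply: contrapT => hno.
have no i : (i < N)%N -> c * T i `^ D < G (A * T i) - G (T i).
  by move=> iN; rewrite ltNge; apply/negP => h; apply: hno; exists i.
have Tmon i : (i <= N)%N -> T 0%N <= T i.
  elim: i => // i IH iN; apply: (le_trans (IH (ltnW iN))).
  have T1i := T1 i (ltnW iN).
  by apply: (le_trans _ (TA i iN)); rewrite -[leLHS]mul1r ler_wpM2r// (le_trans ler01).
have grow i : (i <= N)%N -> i%:R * (c * T 0%N `^ D) <= G (T i).
  elim: i => [|i IH] iN; first by rewrite mul0r G0// T1.
  have T1i := T1 i (ltnW iN); have Ti0 : 0 <= T i by apply: le_trans T1i.
  have h1 := IH (ltnW iN); have h2 := no i iN.
  have h3 : G (A * T i) <= G (T i.+1).
    by apply: Gmon; [rewrite (le_trans T1i)// -[leLHS]mul1r ler_wpM2r|exact: TA].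
  have h4 : c * T 0%N `^ D <= c * T i `^ D.
    rewrite ler_wpM2l// ge0_ler_powR ?nnegrE//; last exact: Tmon (ltnW iN).
    by rewrite (le_trans ler01)// T1.
  rewrite -natr1 mulrDl mul1r; lra.
have T00 : 0 < T 0%N `^ D by rewrite powR_gt0// (lt_le_trans ltr01)// T1.
have := grow N (leqnn N); rewrite leNgt => /negP; apply.
apply: (le_lt_trans GN); apply: (le_lt_trans (ler_wpM2l C00 TN)).
by rewrite [ltLHS]mulrA [C0 * 2]mulrC [ltRHS]mulrA ltr_pM2r.
Qed.

End Pigeonhole.

Section Lacunary.
Context {R : realType}.

Lemma lacunary_expl (tau1 tau2 : R) (J : nat) (t : nat -> R) : 0 < tau1 -> 0 < tau2 ->
  lacunary tau1 tau2 [set j | (1 <= j <= J)%N] t ->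
  forall j k, (1 <= j)%N -> (j + k <= J)%N ->
    tau1 ^+ k * t j <= t (j + k)%N <= tau2 ^+ k * t j.
Proof.
move=> tau10 tau20 [tpos tlac] j k j1; elim: k => [|k IH] jk.
  by rewrite !expr0 !mul1r addn0 !lexx.
rewrite addnS in jk *.
have jkJ : (1 <= j + k <= J)%N by rewrite (ltnW jk) andbT (leq_trans j1)// leq_addr.
have /andP[h1 h2] := IH (ltnW jk).
have /andP[p0 _] := tpos _ jkJ.
have /andP[l1 l2] := tlac (j + k)%N jkJ jk.
rewrite ler_pdivlMr// in l1; rewrite ler_pdivrMr// in l2.
apply/andP; split.
  by apply: le_trans l1; rewrite exprS -mulrA ler_wpM2l// ltW.
by apply: (le_trans l2); rewrite exprS -mulrA ler_wpM2l// ltW.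
Qed.

(** From x^D = exp (D ln x) >= 1 + D ln x.  The term 1 in the last hypothesis
    keeps 1 - ln x positive when x = 1. *)
Lemma powR_ge_half (x D e : R) : 0 < x -> x <= 1 -> 0 <= D -> D <= e ->
  e * (2 * (1 - ln x)) <= 1 -> 2^-1 <= x `^ D.
Proof.
move=> x0 x1 D0 De he.
have lx : ln x <= 0 by exact: ln_le0.
have : D * (- ln x) <= e * (1 - ln x) by rewrite ler_pM//; lra.
rewrite /powR gt_eqF// => h.
apply: (le_trans _ (expR_ge1Dx _)); lra.
Qed.

Lemma exists_expr_le (x y : R) : 0 < x -> x < 1 -> 0 < y -> exists m, x ^+ m <= y.
Proof.
move=> x0 x1 y0.
have xn1 : `|x| < 1 by rewrite ger0_norm// ltW.
have /cvgrPdist_le/(_ _ y0)[m _ /(_ m (leqnn m))] := cvg_expr xn1.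
rewrite sub0r normrN => h; exists m.
exact: le_trans (ler_norm _) h.
Qed.

End Lacunary.

(** * Choice of the constants *)
Section Main.
Context {R : realType}.

(** The constants are chosen in the order A, m, N, eps0: A makes the tail of the
    frequency side negligible, m terms of the sequence shrink it by a factor A, N
    exceeds 2 C0 / c as the pigeonhole requires, and eps0 makes t^(-D) vary by a
    factor at most 2 along the N m terms. *)
Lemma exists_lacunary_distance (d : nat) (C0 tau1 tau2 : R) :
  (2 <= d)%N -> 1 <= C0 -> 0 < tau1 -> tau1 <= tau2 -> tau2 < 1 ->
  exists (eps0 : R) (J0 : nat),
    [/\ 0 < eps0, eps0 < 1, (0 < J0)%N &
      forall (s : R) (E : set (Rn R d)) (mu : probability (Rn R d) R),
        d%:R - eps0 < s -> s < d%:R ->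
        measurable E -> E `<=` @unit_cube R d ->
        locally_uniformly_dimensional s mu -> mu E = 1%E ->
        (forall T : R, 1 <= T ->
          ((C0^-1 * T `^ (d%:R - s))%:E <= fourier_energy mu T
             <= (C0 * T `^ (d%:R - s))%:E)%E) ->
        forall t : nat -> R, lacunary tau1 tau2 [set j | (1 <= j <= J0)%N] t ->
          exists2 j, (1 <= j <= J0)%N & distance_set E (t j)].
Proof.
move=> d2 C01 tau10 tau12 tau21.
have tau20 : 0 < tau2 := lt_le_trans tau10 tau12.
have [dO [Om [P [w [Cl [mw w1 decay]]]]]] := @sphere_measure_decay R d d2.
have Cl0 : 0 <= Cl := sphere_decay_ge0 decay.
have C00 : 0 < C0 := lt_le_trans ltr01 C01.
pose c1 : R := 2^-1 ^+ d / 2.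
have c10 : 0 < c1 by rewrite divr_gt0// exprn_gt0// invr_gt0.
pose c := c1 / (4 * C0).
have c0 : 0 < c by rewrite divr_gt0// mulr_gt0.
pose a := 1 + 4 * Cl * C0 / c.
have a1 : 1 <= a.
  by rewrite lerDl divr_ge0 ?(ltW c0)// mulr_ge0 ?(ltW C00)// mulr_ge0.
have a0 : 0 < a := lt_le_trans ltr01 a1.
(* A fourth power, since the tail gains only the factor A^(-1/4). *)
pose A := a ^+ 4.
have A1 : 1 <= A by rewrite exprn_ege1.
have A0 : 0 < A := lt_le_trans ltr01 A1.
have hA : 4 * Cl * C0 * A `^ (- 4^-1) <= c.
  rewrite powRN /A -powR_mulrn ?(ltW a0)// -powRrM divff ?pnatr_eq0// powRr1 ?(ltW a0)//.
  rewrite ler_pdivrMr// /a mulrDr mulr1 mulrCA divff ?gt_eqF// mulr1 lerDr ltW//.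
have iA0 : 0 < A^-1 by rewrite invr_gt0.
have [m hm] := exists_expr_le tau20 tau21 iA0.
pose N := (Num.truncn (2 * C0 / c)).+1.
have hN : 2 * C0 < N%:R * c by rewrite -ltr_pdivrMr// truncnS_gt.
pose x := tau1 ^+ (N * m).
have tau11 : tau1 <= 1 by rewrite (le_trans tau12)// ltW.
have x0 : 0 < x by rewrite exprn_gt0.
have x1 : x <= 1 by rewrite exprn_ile1// ltW.
have lx : ln x <= 0 by exact: ln_le0.
pose eps0 := Num.min (4^-1 : R) (2 * (1 - ln x))^-1.
have l0 : 0 < 2 * (1 - ln x) by lra.
have eps00 : 0 < eps0 by rewrite lt_min !invr_gt0 l0 ltr0n.
exists eps0, (1 + N * m)%N; split => //.
  by rewrite gt_min; apply/orP; left; lra.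
move=> s E mu s1 s2 mE Eu [mu1 [C C_gt0 mu_cube]] muE growth t tlac.
pose D := d%:R - s.
have D0 : 0 <= D by rewrite subr_ge0 ltW.
have De : D <= eps0 by rewrite /D; lra.
have D4 : D <= 4^-1 by rewrite (le_trans De)// ge_min lexx.
have xD : 2^-1 <= x `^ D.
  apply: (powR_ge_half x0 x1 D0 De).
  by rewrite -ler_pdivlMr// mul1r ge_min lexx orbT.
pose e1 := energy_density mu (cst 1).
have growth' T : 1 <= T ->
    ((C0^-1 * T `^ D)%:E <= ball_energy e1 T <= (C0 * T `^ D)%:E)%E.
  by move=> T1; rewrite -fourier_energyE; exact: growth.
(* The indices of the thinned sequence; the pigeonhole runs over i < N, and i = N
   only serves as the end of the last step. *)
pose idx i := (1 + i * m)%N.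
have idxJ i : (i <= N)%N -> (1 <= idx i <= 1 + N * m)%N.
  by move=> iN; rewrite /idx leq_addr/= leq_add2l leq_mul2r iN orbT.
have tpos i : (i <= N)%N -> 0 < t (idx i) <= 1 by move=> iN; exact: tlac.1 (idxJ i iN).
pose T i := (t (idx i))^-1.
pose G y := fine (ball_energy e1 y).
have GE y : 1 <= y -> ball_energy e1 y = (G y)%:E.
  by move=> y1; apply: (ball_energyE (C0 := C0) (D := D)).
have [i iN hi] : exists2 i, (i < N)%N & G (A * T i) - G (T i) <= c * T i `^ D.
  apply: (@scale_pigeonhole _ G T A C0 c D N) => //.
  - exact: ltW.
  - by move=> y y1; apply: fine_ge0; apply: integral_ge0 => xi _; rewrite lee_fin energy_density_ge0.
  - move=> y z y1 yz; rewrite -lee_fin -!GE//; last exact: le_trans yz.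
    apply: ge0_subset_integral => //; try exact: measurable_origin_ball.
    + apply/measurable_EFinP; apply: measurable_funTS.
      exact: measurable_energy_density (@unit_valued1 R d).
    + by move=> xi _; rewrite lee_fin energy_density_ge0.
    + by move=> xi /= h; exact: le_trans yz.
  - by move=> k kN; have /andP[p1 p2] := tpos k kN; rewrite invf_ge1.
  - move=> k kN; have /andP[p1 p2] := tpos k (ltnW kN); have /andP[q1 q2] := tpos k.+1 kN.
    have jk : (idx k + m <= 1 + N * m)%N.
      by have /andP[_] := idxJ k.+1 kN; rewrite /idx mulSn [(m + _)%N]addnC addnA.
    have /andP[_] := lacunary_expl tau10 tau20 tlac (leq_addr _ _ : (1 <= idx k)%N) jk.
    have -> : (idx k + m)%N = idx k.+1 by rewrite /idx mulSn [(m + _)%N]addnC addnA.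
    move=> h; rewrite /T ler_pdivrMr// mulrC ler_pdivlMr//.
    have : t (idx k.+1) <= A^-1 * t (idx k).
      by apply: (le_trans h); rewrite ler_wpM2r// ltW.
    by rewrite ler_pdivlMl.
  - have /andP[p1 p2] := tpos N (leqnn N).
    by rewrite -lee_fin -GE ?invf_ge1//; have /andP[] := growth' (T N) ltac:(by rewrite invf_ge1).
  - have /andP[p1 p2] := tpos N (leqnn N); have /andP[q1 q2] := tpos 0%N (leq0n N).
    have /andP[h _] := lacunary_expl tau10 tau20 tlac (leqnn 1) (leqnn (1 + N * m)).
    have TN : T N <= x^-1 * T 0%N.
      by rewrite /T -invfM lef_pV2 ?posrE ?mulr_gt0//.
    have T00 : 0 <= T 0%N by rewrite invr_ge0 ltW.
    have TN0 : 0 <= T N by rewrite invr_ge0 ltW.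
    apply: (@le_trans _ _ ((x^-1 * T 0%N) `^ D)).
      have xT0 : 0 <= x^-1 * T 0%N by rewrite mulr_ge0// invr_ge0 ltW.
      by apply: ge0_ler_powR => //; rewrite nnegrE.
    have ix0 : 0 <= x^-1 by rewrite invr_ge0 ltW.
    rewrite powRM// ler_wpM2r ?powR_ge0//.
    rewrite -powR_inv1 ?(ltW x0)// -powRrM mulN1r powRN.
    by rewrite invf_ple ?posrE ?powR_gt0.
  - exact: ltW.
exists (idx i); first exact: idxJ (ltnW iN).
apply: contrapT => nE.
have ti := tpos i (ltnW iN); have /andP[ti0 ti1] := ti.
pose b := c1 / (2 * C0) * (t (idx i))^-1 `^ D.
have b0 : 0 < b by rewrite mulr_gt0 ?powR_gt0 ?invr_gt0// divr_gt0// mulr_gt0.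
have [v vt hv] := sphere_energy_small mw w1 decay C_gt0 mu1 mu_cube D0 D4 ti0 mE muE Eu nE b0.
have := sphere_energy_ge mw w1 decay C01 D0 D4 growth' (erefl c1) ti vt A1 hA.
by move=> /(_ hi); apply/negP; rewrite -ltNge.
Qed.

End Main.

Theorem theorem1p8 (R : realType) (d : nat) (C0 tau1 tau2 : R) :
  (2 <= d)%N -> 1 <= C0 -> 0 < tau1 -> tau1 <= tau2 -> tau2 < 1 ->
  exists (eps0 : R) (J0 : nat),
    [/\ 0 < eps0, eps0 < 1, (0 < J0)%N &
      forall (s : R) (E : set (Rn R d)) (mu : probability (Rn R d) R),
        d%:R - eps0 < s -> s < d%:R ->
        measurable E -> E `<=` @unit_cube R d -> quasi_regular s E ->
        locally_uniformly_dimensional s mu -> mu E = 1%E ->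
        (forall T : R, 1 <= T ->
          ((C0^-1 * T `^ (d%:R - s))%:E <= fourier_energy mu T
             <= (C0 * T `^ (d%:R - s))%:E)%E) ->
        (forall t : nat -> R,
          lacunary tau1 tau2 [set j | (1 <= j <= J0)%N] t ->
          (`I_1 #<= distance_set E `&`
                    [set t j | j in [set j | (1 <= j <= J0)%N]])%card) /\
        (forall t : nat -> R,
          lacunary tau1 tau2 [set j | (1 <= j)%N] t ->
          forall k : nat, exists2 j : nat,
            (k + 1 <= j <= k + J0)%N & distance_set E (t j))].
Proof.
move=> d2 C01 tau10 tau12 tau21.
have [eps0 [J0 [eps00 eps01 J00 H]]] :=
  exists_lacunary_distance d2 C01 tau10 tau12 tau21.
exists eps0, J0; split => // s E mu s1 s2 mE Eu _ mudim muE growth.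
have {}H := H s E mu s1 s2 mE Eu mudim muE growth.
split=> [t tlac|t [tpos tlac] k].
  have [j jJ Ej] := H t tlac.
  have sub : [set t j] `<=` distance_set E `&` [set t j | j in [set j | (1 <= j <= J0)%N]].
    by move=> _ ->; split => //; exists j.
  by rewrite -(card_le_eql (card_set1 (x := t j))); exact: subset_card_le.
have [|j jJ Ej] := H (fun j => t (k + j)%N).
  split=> [j /andP[j1 _]|j /andP[j1 _] _].
    by apply: tpos; rewrite /= (leq_trans j1)// leq_addl.
  have kj : (1 <= k + j)%N by rewrite (leq_trans j1)// leq_addl.
  by rewrite addnS; apply: tlac => //=; rewrite ltnW.
by exists (k + j)%N => //; rewrite !leq_add2l.
Qed.
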